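(* Let $f:\mathbb{R}^{m}\to\overline{\mathbb{R}}$ be a lower semicontinuous proper convex function, $x\in\operatorname{dom}f$ and $u\in\partial f(x)$. Say that (A) holds at $(x',u')$ (with $u'\in\partial f(x')$) if $f$ is parabolically regular at $x'$ for $u'$ and parabolically epi-differentiable at $x'$ for every $d$ with $df(x')(d)=\langle u',d\rangle$; and that (C) holds at $(x,u)$ if there exists $\overline{W}\in\partial_{B}\operatorname{Prox}_{f}(x+u)$ with $\bigcup_{V\in\mathcal{J}\operatorname{Prox}_{f}(x+u)}\operatorname{rge}V=\operatorname{rge}\overline{W}$ and for every $y$ in this union $y=\overline{W}\bar z$ for some $\bar z$ with $\min_{z\in\mathbb{R}^m,\,y=Vz,\,V\in\mathcal{J}\operatorname{Prox}_{f}(x+u)}\langle y,z-y\rangle=\langle y,\bar z-y\rangle=\langle y,(\overline{W}^{\dagger}-I)y\rangle$. Then: (i) If (A) holds at $(x,u)$, then for any $v\in\operatorname{dom}D^{*}(\partial f)(x,u)$ there exist sequences $(x^{k},u^{k})\to(x,u)$ with $u^{k}\in\partial f(x^{k})$ and $v^{k}\to v$ such that $$\min_{v^{*}\in D^{*}(\partial f)(x,u)(v)}\langle v^{*},v\rangle\ge\limsup_{k\to\infty}d^{2}f(x^{k},u^{k})(v^{k});$$ if in addition (C) holds at $(x,u)$, then also $\Gamma_{f}(x,u)(v)\ge\limsup_{k\to\infty}d^{2}f(x^{k},u^{k})(v^{k})$. (ii) If (A) and (C) hold at $(x,u)$, then for any $v\in\operatorname{dom}\Gamma_{f}(x,u)$,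 any sequence $(\tilde x^{k},\tilde u^{k})\to(x,u)$ with $\tilde u^{k}\in\partial f(\tilde x^{k})$ and any $\tilde v^{k}\to v$, $$\Gamma_{f}(x,u)(v)\le\liminf_{k\to\infty}d^{2}f(\tilde x^{k},\tilde u^{k})(\tilde v^{k}).$$ (iii) If $f$ is $\mathcal{C}^{2}$-cone reducible, (A) holds at all $(x',u')\in\operatorname{gph}\partial f$ with $x'$ in a neighborhood of $x$, and (C) holds at $(x,u)$, then for any $v\in\operatorname{dom}D^{*}(\partial f)(x,u)$ and $\beta\in\mathbb{R}$ with $(v,\beta)\in\operatorname{dom}D^{*}\mathcal{N}_{\operatorname{epi}f}((x,f(x)),(u,-1))$, $$\min_{v^{*}\in D^{*}(\partial f)(x,u)(v)}\langle v^{*},v\rangle=\min_{(z,\gamma)\in D^{*}\mathcal{N}_{\operatorname{epi}f}((x,f(x)),(u,-1))(v,\beta)}\langle(z,\gamma),(v,\beta)\rangle.$$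
   Context: $df(x)(d):=\liminf_{t\downarrow0,\,d'\to d}\frac{f(x+td')-f(x)}{t}$; second subderivative $d^{2}f(x,u)(d):=\liminf_{\tau\downarrow0,\,d'\to d}\frac{f(x+\tau d')-f(x)-\tau\langle u,d'\rangle}{\tau^2/2}$; for $d$ with $df(x)(d)$ finite, parabolic subderivative $d^{2}f(x)(d,w):=\liminf_{t\downarrow0,\,w'\to w}\frac{f(x+td+\frac12t^2w')-f(x)-t\,df(x)(d)}{t^2/2}$. $f$ is parabolically epi-differentiable at $x$ for $d$ if $\operatorname{dom}d^2f(x)(d,\cdot)\neq\emptyset$ and for every $w$ and $t_k\downarrow0$ there are $w_k\to w$ with $d^2f(x)(d,w)=\lim_k\frac{f(x+t_kd+\frac12t_k^2w_k)-f(x)-t_k\,df(x)(d)}{t_k^2/2}$; parabolically regular at $x$ for $u$ if $\inf_w\{d^2f(x)(d,w)-\langle u,w\rangle\}=d^2f(x,u)(d)$ for all $d$. $\operatorname{Prox}_f(y):=\operatorname{argmin}_z\{f(z)+\frac12\|z-y\|^2\}$; $\partial_B$ the B-subdifferential (limits of Jacobians at nearby differentiability points), $\mathcal{J}:=\operatorname{conv}\partial_B$; $\operatorname{rge}V$ range of a matrix, $V^\dagger$ Moore–Penrose inverse. Limiting coderivative of set-valued $S$: $D^*S(x,u)(w):=\{z\mid(z,-w)\in N_{\operatorname{gph}S}(x,u)\}$, $N$ the limiting normal cone; $\mathcal{N}_{\operatorname{epi}f}$ is the normal cone mapping of the closed convex set $\operatorname{epi}f$. SOVF: $\Gamma_f(x,u)(v):=\min_{d,\,v=Vd,\,V\in\mathcal{J}\operatorname{Prox}_f(x+u)}\langle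 v,d-v\rangle$ if $v\in\bigcup_{V\in\mathcal{J}\operatorname{Prox}_f(x+u)}\operatorname{rge}V$, $\infty$ otherwise. A closed convex set $C$ is $\mathcal{C}^2$-cone reducible at $x\in C$ if there are a neighborhood $U$ of $x$, a set $K$ and a $\mathcal{C}^2$ map $\Xi:U\to\mathbb{R}^p$ with surjective derivative at $x$, $\Xi(x)=0$, $C\cap U=\{x'\in U\mid\Xi(x')\in K\}$, and $K-\Xi(x)$ a pointed closed convex cone; $f$ is $\mathcal{C}^2$-cone reducible if $\operatorname{epi}f$ is $\mathcal{C}^2$-cone reducible at $(x',f(x'))$ for all $x'\in\operatorname{dom}f$. *)

(* Defs.v *)
From HB Require Import structures.
From mathcomp Require Import all_boot all_order all_algebra.
From mathcomp Require Import all_classical all_reals all_analysis.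
Set Implicit Arguments. Unset Strict Implicit. Unset Printing Implicit Defensive.
Import Order.TTheory GRing.Theory Num.Theory.
Local Open Scope classical_set_scope.
Local Open Scope ring_scope.

Section Defs.
Variable R : realType.

Definition dotv (n : nat) (x y : 'cV[R]_n) : R := \sum_(i < n) x i 0 * y i 0.
Definition nrmv (n : nat) (x : 'cV[R]_n) : R := Num.sqrt (dotv x x).

Definition cvgv (n : nat) (a : nat -> 'cV[R]_n) (y : 'cV[R]_n) : Prop :=
  forall e : R, 0 < e -> exists N : nat, forall k, (N <= k)%N -> nrmv (a k - y) < e.
Definition cvgm (p n : nat) (a : nat -> 'M[R]_(p, n)) (V : 'M[R]_(p, n)) : Prop :=
  forall i j, forall e : R, 0 < e -> exists N : nat, forall k, (N <= k)%N -> `|a k i j - V i j| < e.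

Local Open Scope ereal_scope.
Definition ex_min (S : set (\bar R)) (a : \bar R) : Prop := S a /\ forall b, S b -> a <= b.
Local Close Scope ereal_scope.

Section Analysis.
Variable m : nat.
Local Notation vec := 'cV[R]_m.

Local Open Scope ereal_scope.

Definition dom (f : vec -> \bar R) : set vec := [set x | f x < +oo].

Definition proper_fun (f : vec -> \bar R) : Prop :=
  (forall x, f x != -oo) /\ (exists x, f x < +oo).

Definition convex_fun (f : vec -> \bar R) : Prop :=
  forall (x y : vec) (t : R), (0 < t < 1)%R ->
    f (t *: x + (1 - t) *: y)%R <= t%:E * f x + (1 - t)%:E * f y.

Definition lsc_fun (f : vec -> \bar R) : Prop :=
  forall (x : vec) (a : R), a%:E < f x ->
    exists2 d : R, (0 < d)%R & forall x', (nrmv (x' - x)%R < d)%R -> a%:E < f x'.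

Definition subdiff (f : vec -> \bar R) (x : vec) : set vec :=
  [set u | f x \is a fin_num /\ forall y, f x + (dotv u (y - x)%R)%:E <= f y].

Definition liminf_td (g : R -> vec -> \bar R) (d : vec) : \bar R :=
  ereal_sup [set ereal_inf [set z | exists t d', (0 < t < e)%R /\
                 (nrmv (d' - d)%R < e)%R /\ z = g t d'] | e in [set e : R | (0 < e)%R]].

Definition subderiv (f : vec -> \bar R) (x d : vec) : \bar R :=
  liminf_td (fun t d' => (f (x + t *: d')%R - f x) * (t^-1)%:E) d.

Definition subderiv2 (f : vec -> \bar R) (x u d : vec) : \bar R :=
  liminf_td (fun t d' => (f (x + t *: d')%R - f x - (t * dotv u d')%:E)
                          * (((t ^+ 2) / 2)^-1)%:E) d.

Definition parab_quot (f : vec -> \bar R) (x d : vec) (t : R) (w' : vec) : \bar R :=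
  (f (x + t *: d + ((t ^+ 2) / 2) *: w')%R - f x - t%:E * subderiv f x d)
    * (((t ^+ 2) / 2)^-1)%:E.

(* parabolic subderivative d^2 f(x)(d, w) (meaningful when df(x)(d) is finite) *)
Definition parab_subderiv (f : vec -> \bar R) (x d w : vec) : \bar R :=
  liminf_td (parab_quot f x d) w.

Definition parab_epi_diff (f : vec -> \bar R) (x d : vec) : Prop :=
  (exists w, parab_subderiv f x d w < +oo) /\
  forall (w : vec) (t : nat -> R), (forall k, (0 < t k)%R) -> (t @ \oo --> 0%R) ->
    exists wk : nat -> vec, cvgv wk w /\
      ((fun k => parab_quot f x d (t k) (wk k)) @ \oo --> parab_subderiv f x d w).

Definition parab_regular (f : vec -> \bar R) (x u : vec) : Prop :=
  forall d, subderiv f x d = (dotv u d)%:E ->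
    ereal_inf [set parab_subderiv f x d w - (dotv u w)%:E | w in [set: vec]]
      = subderiv2 f x u d.

Definition condA (f : vec -> \bar R) (x u : vec) : Prop :=
  parab_regular f x u /\
  forall d, subderiv f x d = (dotv u d)%:E -> parab_epi_diff f x d.

Local Close Scope ereal_scope.

Definition prox_set (f : vec -> \bar R) (y : vec) : set vec :=
  [set z | forall z', (f z + ((nrmv (z - y)) ^+ 2 / 2)%:E <=
                       f z' + ((nrmv (z' - y)) ^+ 2 / 2)%:E)%E].
(* Prox_f(y): the (for proper lsc convex f, unique) minimizer *)
Definition Prox (f : vec -> \bar R) (y : vec) : vec := xget 0 (prox_set f y).

End Analysis.

Definition is_jacobian (n p : nat) (F : 'cV[R]_n -> 'cV[R]_p) (y : 'cV[R]_n)
  (V : 'M[R]_(p, n)) : Prop :=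
  forall e : R, 0 < e -> exists2 d : R, 0 < d & forall h : 'cV[R]_n,
    nrmv h < d -> nrmv (F (y + h) - F y - V *m h) <= e * nrmv h.

Definition B_subdiff (n p : nat) (F : 'cV[R]_n -> 'cV[R]_p) (y : 'cV[R]_n)
  : set 'M[R]_(p, n) :=
  [set V | exists (yk : nat -> 'cV[R]_n) (Vk : nat -> 'M[R]_(p, n)),
     (forall k, is_jacobian F (yk k) (Vk k)) /\ cvgv yk y /\ cvgm Vk V].

Definition mconv (p n : nat) (S : set 'M[R]_(p, n)) : set 'M[R]_(p, n) :=
  [set V | exists (k : nat) (l : 'I_k -> R) (Vs : 'I_k -> 'M[R]_(p, n)),
     (forall i, 0 <= l i) /\ \sum_(i < k) l i = 1 /\ (forall i, S (Vs i)) /\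
     V = \sum_(i < k) l i *: Vs i].

Definition clarke_jac (n p : nat) (F : 'cV[R]_n -> 'cV[R]_p) (y : 'cV[R]_n) :=
  mconv (B_subdiff F y).

Definition rge (p n : nat) (V : 'M[R]_(p, n)) : set 'cV[R]_p :=
  [set V *m d | d in [set: 'cV[R]_n]].

(* Moore-Penrose inverse: the unique matrix satisfying the Penrose equations *)
Definition penrose (n : nat) (A W : 'M[R]_n) : Prop :=
  A *m W *m A = A /\ W *m A *m W = W /\ (A *m W)^T = A *m W /\ (W *m A)^T = W *m A.
Definition mp_inv (n : nat) (A : 'M[R]_n) : 'M[R]_n := xget 0 (penrose A).

Section SOVF.
Variable m : nat.
Local Notation vec := 'cV[R]_m.

Definition JProx (f : vec -> \bar R) (x u : vec) := clarke_jac (Prox f) (x + u).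

Definition rge_union (f : vec -> \bar R) (x u : vec) : set vec :=
  [set y | exists V, JProx f x u V /\ rge V y].

(* second-order variational function Gamma_f(x,u)(v); the min of the paper is
   rendered as an infimum (= +oo when v is not in the union of ranges) *)
Definition SOVF (f : vec -> \bar R) (x u v : vec) : \bar R :=
  ereal_inf [set (dotv v (d - v))%:E | d in
               [set d | exists V, JProx f x u V /\ v = V *m d]].

Definition condC (f : vec -> \bar R) (x u : vec) : Prop :=
  exists2 Wb, B_subdiff (Prox f) (x + u) Wb &
    rge_union f x u = rge Wb /\
    forall y, rge_union f x u y -> exists zb, y = Wb *m zb /\
      ex_min [set (dotv y (z - y))%:E | z in
               [set z | exists V, JProx f x u V /\ y = V *m z]]
             (dotv y (zb - y))%:E /\
      dotv y (zb - y) = dotv y ((mp_inv Wb - 1%:M) *m y).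

End SOVF.

Definition reg_normal (n : nat) (C : set 'cV[R]_n) (x : 'cV[R]_n) : set 'cV[R]_n :=
  [set v | C x /\ forall e : R, 0 < e -> exists2 d : R, 0 < d &
     forall x', C x' -> nrmv (x' - x) < d -> dotv v (x' - x) <= e * nrmv (x' - x)].

Definition lim_normal (n : nat) (C : set 'cV[R]_n) (x : 'cV[R]_n) : set 'cV[R]_n :=
  [set v | exists (xk vk : nat -> 'cV[R]_n), (forall k, C (xk k)) /\ cvgv xk x /\
      cvgv vk v /\ forall k, reg_normal C (xk k) (vk k)].

Definition gph (n p : nat) (S : 'cV[R]_n -> set 'cV[R]_p) : set 'cV[R]_(n + p) :=
  [set z | exists x u, S x u /\ z = col_mx x u].

Definition coderiv (n p : nat) (S : 'cV[R]_n -> set 'cV[R]_p) (x : 'cV[R]_n)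
  (u w : 'cV[R]_p) : set 'cV[R]_n :=
  [set z | lim_normal (gph S) (col_mx x u) (col_mx z (- w))].

Definition coderiv_dom (n p : nat) (S : 'cV[R]_n -> set 'cV[R]_p) (x : 'cV[R]_n)
  (u : 'cV[R]_p) : set 'cV[R]_p := [set w | coderiv S x u w !=set0].

Definition epi (m : nat) (f : 'cV[R]_m -> \bar R) : set 'cV[R]_(m + 1) :=
  [set p | (f (usubmx p) <= (dsubmx p 0 0)%:E)%E].

Definition pt (m : nat) (x : 'cV[R]_m) (a : R) : 'cV[R]_(m + 1) := col_mx x (const_mx a).

Definition N_epi (m : nat) (f : 'cV[R]_m -> \bar R) (p : 'cV[R]_(m + 1))
  : set 'cV[R]_(m + 1) := lim_normal (epi f) p.

Definition open_setv (n : nat) (U : set 'cV[R]_n) : Prop :=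
  forall y, U y -> exists2 d : R, 0 < d & forall y', nrmv (y' - y) < d -> U y'.

Definition closed_setv (n : nat) (K : set 'cV[R]_n) : Prop :=
  forall (a : nat -> 'cV[R]_n) y, (forall k, K (a k)) -> cvgv a y -> K y.

Definition pointed_closed_convex_cone (n : nat) (K : set 'cV[R]_n) : Prop :=
  K 0 /\ (forall t k, 0 <= t -> K k -> K (t *: k)) /\
  (forall k k', K k -> K k' -> K (k + k')) /\ closed_setv K /\
  (forall k, K k -> K (- k) -> k = 0).

Definition is_grad (n : nat) (g : 'cV[R]_n -> R) (y : 'cV[R]_n) (G : 'cV[R]_n) : Prop :=
  forall e : R, 0 < e -> exists2 d : R, 0 < d & forall h : 'cV[R]_n,
    nrmv h < d -> `|g (y + h) - g y - dotv G h| <= e * nrmv h.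

Definition C2_on (n p : nat) (U : set 'cV[R]_n) (Xi : 'cV[R]_n -> 'cV[R]_p)
  (J : 'cV[R]_n -> 'M[R]_(p, n)) : Prop :=
  exists G : 'I_p -> 'I_n -> 'cV[R]_n -> 'cV[R]_n,
    forall y, U y ->
      is_jacobian Xi y (J y) /\
      (forall i j, is_grad (fun z => J z i j) y (G i j y)) /\
      (forall i j, forall e : R, 0 < e -> exists2 d : R, 0 < d &
          forall y', U y' -> nrmv (y' - y) < d -> nrmv (G i j y' - G i j y) < e).

Definition C2_cone_reducible_at (n : nat) (C : set 'cV[R]_n) (x : 'cV[R]_n) : Prop :=
  C x /\
  exists (U : set 'cV[R]_n) (p : nat) (K : set 'cV[R]_p)
         (Xi : 'cV[R]_n -> 'cV[R]_p) (J : 'cV[R]_n -> 'M[R]_(p, n)),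
    open_setv U /\ U x /\ C2_on U Xi J /\ \rank (J x) = p /\ Xi x = 0 /\
    (forall x', U x' -> (C x' <-> K (Xi x'))) /\
    pointed_closed_convex_cone [set k - Xi x | k in K].

Definition C2_cone_reducible (m : nat) (f : 'cV[R]_m -> \bar R) : Prop :=
  forall x', dom f x' -> C2_cone_reducible_at (epi f) (pt x' (fine (f x'))).

End Defs.

(* Main.v *)
(** Write [P] for [Prox f].  As [P] is the gradient of a convex function, its
    Jacobians [V] are symmetric and firmly nonexpansive; a Jacobian at [y] bounds
    the second subderivative of [f] at [(P y, y - P y)] in direction [V z] by
    [<z - V z, V z>] and makes [(z - V z, - V z)] a regular normal to [gph (subdiff f)].

    Conversely, a bound [c] on the second subderivative at [(x, u)] in direction [v] is
    realised, up to [e], by a Jacobian of [P] near [x + u]: the Moreau envelope of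
    [l (f - f x - <u, . - x>)] has a Lipschitz gradient and grows by at most
    [l (c + e) t^2 / 2] from [x] to [x + t v'] with [v'] near [v], so that, by Rademacher's
    theorem on a nearby line, its Hessian has curvature at most [l (c + 2 e)] along [v']
    at some point of the segment.  A compactness argument then turns any bound [c] on the limit
    of second subderivatives along [(x_k, u_k, v_k) -> (x, u, v)] into some [V] in the
    B-subdifferential of [P] at [x + u] and [z] with [v = V z] and [<z - v, v> <= c].

    Regular normals [(w, - v)] bound the second subderivative in direction [- v] by [<w, v>].
    Hence the minimum over the coderivative is the least limit of second subderivatives,
    from which (i) and (ii) follow.  For (iii), the normal cone mapping of [epi f] is the
    subdifferential of the indicator of [epi f], and the second subderivative of that
    indicator at [((x', f x'), (s u', - s))] is finite only in directions [(v', <u', v'>)],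
    where it is [s] times that of [f] at [(x', u')] in direction [v']. *)
Require Import Defs.
From HB Require Import structures.
From mathcomp Require Import all_boot all_order all_algebra.
From mathcomp Require Import all_classical all_reals all_analysis.
From mathcomp Require Import measurable_realfun ring lra.
Set Implicit Arguments. Unset Strict Implicit. Unset Printing Implicit Defensive.
Import Order.TTheory GRing.Theory Num.Theory.
Import numFieldNormedType.Exports.
Local Open Scope classical_set_scope.
Local Open Scope ring_scope.

(** The scale [l] is what makes the realised directions converge. A Jacobian [T] of the proximal
    mapping of the scaled function is firmly nonexpansive, so |v' - T v'|^2 <= <v', v' - T v'>:
    curvature of order [l] puts [T v'] within O(sqrt l) of [v']. The Jacobian [V] of [Prox f]
    derived from [T] has V z = T v' with z - V z = (v' - T v') / l, so the factor [l] cancels in <z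
    - V z, V z>. Returning to [Prox f] multiplies distances by 1 + 1/l, hence the displacement is
    chosen after [l].

    In the passage to the limit the preimages [z_k] need not be bounded. They are eliminated in
    favour of the inequalities 2 <v, h> - <h, V h> <= c + <v, v> for all h, in whose derivation only
    V_k z_k has to converge: they survive the limit, force v into the range of the symmetric limit
    V, and return <z - v, v> <= c at h = z.

    The curvature argument needs differentiability at almost every point of a line with prescribed
    direction. This is why Rademacher's theorem is proved through a translation invariant measure
    whose null sets can be tested on parallel lines in any direction. *)

Ltac vec_ring := apply/matrixP => ? ?; rewrite !mxE; ring.

Lemma exists_small (R : realFieldType) (a b : R) : 0 < a -> 0 < b ->
  exists2 t, 0 < t & t < a /\ t < b.
Proof.
move=> a0 b0; exists (Num.min a b / 2); first by rewrite divr_gt0// lt_min a0.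
have : Num.min a b <= a by rewrite ge_min lexx.
have : Num.min a b <= b by rewrite ge_min lexx orbT.
have : 0 < Num.min a b by rewrite lt_min a0.
by move: (Num.min a b) => X; split; lra.
Qed.

(** * Euclidean vectors and sequences *)

Section Euclid.
Variable R : realType.
Implicit Types (m n p : nat).

Lemma dotvC n (x y : 'cV[R]_n) : dotv x y = dotv y x.
Proof. by apply: eq_bigr => i _; rewrite mulrC. Qed.

Lemma dotvDl n (x y z : 'cV[R]_n) : dotv (x + y) z = dotv x z + dotv y z.
Proof. by rewrite -big_split; apply: eq_bigr => i _; rewrite mxE mulrDl. Qed.

Lemma dotvZl n (a : R) (x y : 'cV[R]_n) : dotv (a *: x) y = a * dotv x y.
Proof. by rewrite /dotv mulr_sumr; apply: eq_bigr => i _; rewrite mxE mulrA. Qed.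

Lemma dotvNl n (x y : 'cV[R]_n) : dotv (- x) y = - dotv x y.
Proof. by rewrite -scaleN1r dotvZl mulN1r. Qed.

Lemma dotvDr n (x y z : 'cV[R]_n) : dotv z (x + y) = dotv z x + dotv z y.
Proof. by rewrite dotvC dotvDl !(dotvC z). Qed.

Lemma dotvZr n (a : R) (x y : 'cV[R]_n) : dotv y (a *: x) = a * dotv y x.
Proof. by rewrite dotvC dotvZl dotvC. Qed.

Lemma dotvNr n (x y : 'cV[R]_n) : dotv x (- y) = - dotv x y.
Proof. by rewrite dotvC dotvNl dotvC. Qed.

Definition dotvE := (dotvDl, dotvDr, dotvNl, dotvNr, dotvZl, dotvZr).

Lemma dotv0l n (x : 'cV[R]_n) : dotv 0 x = 0.
Proof. by rewrite -(scale0r 0) dotvZl mul0r. Qed.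

Lemma dotv0r n (x : 'cV[R]_n) : dotv x 0 = 0.
Proof. by rewrite dotvC dotv0l. Qed.

Lemma dotv_ge0 n (x : 'cV[R]_n) : 0 <= dotv x x.
Proof. by apply: sumr_ge0 => i _; rewrite -expr2 sqr_ge0. Qed.

Lemma dotv_eq0 n (x : 'cV[R]_n) : dotv x x = 0 -> x = 0.
Proof.
move=> /eqP; rewrite psumr_eq0; last by move=> i _; rewrite -expr2 sqr_ge0.
move=> /allP h; apply/matrixP => i j; rewrite ord1 mxE; apply/eqP.
by have := h i (mem_index_enum i); rewrite /= mulf_eq0 orbb.
Qed.

Lemma nrmv_ge0 n (x : 'cV[R]_n) : 0 <= nrmv x.
Proof. exact: sqrtr_ge0. Qed.

Lemma sqr_nrmv n (x : 'cV[R]_n) : nrmv x ^+ 2 = dotv x x.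
Proof. by rewrite sqr_sqrtr ?dotv_ge0. Qed.

Lemma nrmv0 n : nrmv (0 : 'cV[R]_n) = 0.
Proof. by rewrite /nrmv dotv0l sqrtr0. Qed.

Lemma nrmv_eq0 n (x : 'cV[R]_n) : nrmv x = 0 -> x = 0.
Proof. by move=> h; apply: dotv_eq0; rewrite -sqr_nrmv h expr0n. Qed.

Lemma nrmvN n (x : 'cV[R]_n) : nrmv (- x) = nrmv x.
Proof. by rewrite /nrmv dotvNl dotvNr opprK. Qed.

Lemma nrmvC n (x y : 'cV[R]_n) : nrmv (x - y) = nrmv (y - x).
Proof. by rewrite -nrmvN opprB. Qed.

Lemma nrmvZ n (a : R) (x : 'cV[R]_n) : nrmv (a *: x) = `|a| * nrmv x.
Proof.
by rewrite /nrmv dotvZl dotvZr mulrA -expr2 sqrtrM ?sqr_ge0// sqrtr_sqr.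
Qed.

Lemma CauchySchwarz n (x y : 'cV[R]_n) : dotv x y <= nrmv x * nrmv y.
Proof.
have [x0|x0] := eqVneq (nrmv x) 0.
  by rewrite x0 (nrmv_eq0 x0) dotv0l mul0r.
have [y0|y0] := eqVneq (nrmv y) 0.
  by rewrite y0 (nrmv_eq0 y0) dotv0r mulr0.
have xp : 0 < nrmv x by rewrite lt_neqAle eq_sym x0 nrmv_ge0.
have yp : 0 < nrmv y by rewrite lt_neqAle eq_sym y0 nrmv_ge0.
have := dotv_ge0 (nrmv y *: x - nrmv x *: y).
rewrite !dotvE (dotvC y x) -(sqr_nrmv x) -(sqr_nrmv y) => h.
have : 0 <= 2 * (nrmv x * nrmv y) * (nrmv x * nrmv y - dotv x y) by lra.
by rewrite pmulr_rge0 ?subr_ge0// !mulr_gt0.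
Qed.

Lemma CauchySchwarz_abs n (x y : 'cV[R]_n) : `|dotv x y| <= nrmv x * nrmv y.
Proof.
rewrite ler_norml CauchySchwarz andbT lerNl -dotvNl -(nrmvN x).
exact: CauchySchwarz.
Qed.

Lemma nrmvD n (x y : 'cV[R]_n) : nrmv (x + y) <= nrmv x + nrmv y.
Proof.
rewrite -(@ler_pXn2r _ 2)// ?nnegrE ?addr_ge0 ?nrmv_ge0//.
rewrite sqrrD !sqr_nrmv !dotvE (dotvC y x).
by have := CauchySchwarz x y; lra.
Qed.

Lemma nrmvB n (x y : 'cV[R]_n) : nrmv (x - y) <= nrmv x + nrmv y.
Proof. by rewrite -(nrmvN y); exact: nrmvD. Qed.

Lemma nrmv_tri n (z x y : 'cV[R]_n) : nrmv (x - y) <= nrmv (x - z) + nrmv (z - y).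
Proof.
have -> : x - y = (x - z) + (z - y) by rewrite addrA subrK.
exact: nrmvD.
Qed.

Lemma nrmv_subl n (x y : 'cV[R]_n) : nrmv x <= nrmv (x - y) + nrmv y.
Proof. by rewrite -{1}(subrK y x) nrmvD. Qed.

Lemma le_coord_nrmv n (x : 'cV[R]_n) i : `|x i 0| <= nrmv x.
Proof.
rewrite -(@ler_pXn2r _ 2)// ?nnegrE ?nrmv_ge0// sqr_nrmv real_normK ?num_real//.
rewrite /dotv (bigD1 i)//= expr2 lerDl; apply: sumr_ge0 => j _.
by rewrite -expr2 sqr_ge0.
Qed.

Lemma nrmv_le_coord n (x : 'cV[R]_n) : nrmv x <= \sum_i `|x i 0|.
Proof.
have S0 : 0 <= \sum_i `|x i 0| by exact: sumr_ge0.
rewrite -(@ler_pXn2r _ 2)// ?nnegrE ?nrmv_ge0// sqr_nrmv expr2 mulr_suml.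
apply: ler_sum => i _; rewrite -[x i 0 * _]expr2 -real_normK ?num_real// expr2.
rewrite ler_wpM2l//; rewrite (bigD1 i)//= lerDl; exact: sumr_ge0.
Qed.

Lemma dotv_mulmxl m n (A : 'M[R]_(m, n)) x y : dotv (A *m x) y = dotv x (A^T *m y).
Proof.
rewrite /dotv; under eq_bigr do rewrite mxE mulr_suml.
rewrite exchange_big; apply: eq_bigr => j _; rewrite mxE mulr_sumr.
by apply: eq_bigr => i _; rewrite !mxE; ring.
Qed.

Lemma dotv_delta n (i : 'I_n) (x : 'cV[R]_n) : dotv (delta_mx i 0) x = x i 0.
Proof.
rewrite /dotv (bigD1 i)//= mxE !eqxx mul1r big1 ?addr0// => j ji.
by rewrite mxE (negbTE ji) mul0r.
Qed.

Lemma mulmx_bound m n (A : 'M[R]_(m, n)) :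
  exists2 C : R, 0 < C & forall h, nrmv (A *m h) <= C * nrmv h.
Proof.
exists (1 + \sum_i \sum_j `|A i j|).
  by rewrite ltr_pwDl// sumr_ge0// => i _; rewrite sumr_ge0.
move=> h; apply: (le_trans (nrmv_le_coord _)).
rewrite mulrDl mul1r; apply: ler_wpDl; first exact: nrmv_ge0.
rewrite mulr_suml; apply: ler_sum => i _; rewrite mxE mulr_suml.
apply: (le_trans (ler_norm_sum _ _ _)); apply: ler_sum => j _.
by rewrite normrM ler_wpM2l// le_coord_nrmv.
Qed.

End Euclid.

Section Sequences.
Variable R : realType.
Implicit Types (m n p : nat).

Definition cvgr (a : nat -> R) (l : R) : Prop :=
  forall e : R, 0 < e -> exists N : nat, forall k, (N <= k)%N -> `|a k - l| < e.

Lemma cvgrP (a : nat -> R) l : cvgr a l <-> a @ \oo --> l.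
Proof.
split=> [h|h e e0].
  apply/cvgrPdist_lt => e /h [N Nh]; exists N => // k /= /Nh.
  by rewrite distrC.
move/cvgrPdist_lt: h => /(_ _ e0) [N _ Nh]; exists N => k /Nh /=.
by rewrite distrC.
Qed.

Lemma cvgr_cst (l : R) : cvgr (fun=> l) l.
Proof. by move=> e e0; exists 0%N => k _; rewrite subrr normr0. Qed.

Lemma cvgr_inv : cvgr (fun k => k.+1%:R^-1) 0.
Proof. by apply/cvgrP; exact: cvg_harmonic. Qed.

Lemma cvgrD a b la lb : cvgr a la -> cvgr b lb -> cvgr (fun k => a k + b k) (la + lb).
Proof. by move=> /cvgrP ha /cvgrP hb; apply/cvgrP; exact: (cvgD ha hb). Qed.

Lemma cvgrN a la : cvgr a la -> cvgr (fun k => - a k) (- la).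
Proof. by move=> /cvgrP ha; apply/cvgrP; exact: (cvgN ha). Qed.

Lemma cvgrM a b la lb : cvgr a la -> cvgr b lb -> cvgr (fun k => a k * b k) (la * lb).
Proof. by move=> /cvgrP ha /cvgrP hb; apply/cvgrP; exact: (cvgM ha hb). Qed.

Lemma cvgr_sum (I : Type) (s : seq I) (a : I -> nat -> R) l :
  (forall i, cvgr (a i) (l i)) ->
  cvgr (fun k => \sum_(i <- s) a i k) (\sum_(i <- s) l i).
Proof.
move=> h; elim: s => [|i s ih].
  rewrite big_nil; under eq_fun do rewrite big_nil; exact: cvgr_cst.
rewrite big_cons; under eq_fun do rewrite big_cons; exact: cvgrD.
Qed.

Lemma cvgr_le a b la lb : cvgr a la -> cvgr b lb -> (forall k, a k <= b k) -> la <= lb.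
Proof.
move=> ha hb ab; rewrite leNgt; apply/negP => lt.
have e0 : 0 < (la - lb) / 2 by lra.
have [N1 h1] := ha _ e0; have [N2 h2] := hb _ e0.
have := h1 _ (leq_maxl N1 N2); have := h2 _ (leq_maxr N1 N2).
have := ab (maxn N1 N2); rewrite !ltr_norml => ? /andP[? ?] /andP[? ?]; lra.
Qed.

Lemma cvgr_squeeze a b l : cvgr b 0 -> (forall k, `|a k - l| <= b k) -> cvgr a l.
Proof.
move=> hb ab e e0; have [N h] := hb _ e0; exists N => k /h.
by rewrite subr0; apply: le_lt_trans; exact: le_trans (ab k) (ler_norm _).
Qed.

Definition incr_seq (s : nat -> nat) := forall k, (s k < s k.+1)%N.

Lemma incr_seq_ge s : incr_seq s -> forall k, (k <= s k)%N.
Proof. by move=> h; elim=> // k ih; exact: leq_ltn_trans ih (h k). Qed.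

Lemma incr_seq_mono s : incr_seq s -> forall j k, (j < k)%N -> (s j < s k)%N.
Proof.
move=> h j; elim=> // k ih; rewrite ltnS leq_eqVlt => /orP[/eqP->//|/ih lt].
exact: ltn_trans lt (h k).
Qed.

Lemma incr_seq_comp s t : incr_seq s -> incr_seq t -> incr_seq (s \o t).
Proof. by move=> hs ht k; apply: (incr_seq_mono hs (ht k)). Qed.

Lemma cvgr_sub a l s : incr_seq s -> cvgr a l -> cvgr (a \o s) l.
Proof.
move=> hs ha e /ha [N h]; exists N => k Nk; apply: h.
exact: leq_trans Nk (incr_seq_ge hs k).
Qed.

Lemma cvgv_sub n (a : nat -> 'cV[R]_n) l s : incr_seq s -> cvgv a l -> cvgv (a \o s) l.
Proof.
move=> hs ha e /ha [N h]; exists N => k Nk; apply: h.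
exact: leq_trans Nk (incr_seq_ge hs k).
Qed.

Lemma bounded_cvgr_sub (a : nat -> R) (C : R) : (forall k, `|a k| <= C) ->
  exists2 s, incr_seq s & exists l, cvgr (a \o s) l.
Proof.
move=> aC; have : bounded_fun a.
  by exists C; split; [exact: num_real|move=> x Cx k _; apply: le_trans (aC k) (ltW Cx)].
move=> /bolzano_weierstrass [s s_incr /cvg_ex [l h]]; exists s; last by exists l; apply/cvgrP.
by move=> k; have := leqW_mono s_incr k k.+1; rewrite ltnSn.
Qed.

Lemma bounded_cvgr_sub_fam (I : eqType) (a : I -> nat -> R) (C : R) (r : seq I) :
  (forall i k, `|a i k| <= C) ->
  exists2 s, incr_seq s & forall i, i \in r -> exists l, cvgr (a i \o s) l.
Proof.
move=> aC; elim: r => [|i r [s hs ih]]; first by exists id => //; move=> k /=.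
have [t ht [l hl]] := @bounded_cvgr_sub (a i \o s) C (fun k => aC i (s k)).
exists (s \o t); first exact: incr_seq_comp.
move=> j; rewrite inE => /predU1P[->|/ih [l' hl']]; first by exists l.
by exists l'; exact: (cvgr_sub ht hl').
Qed.

Lemma cvgvP n (a : nat -> 'cV[R]_n) l :
  cvgv a l <-> forall i, cvgr (fun k => a k i 0) (l i 0).
Proof.
split=> [h i e /h [N Nh]|h].
  exists N => k /Nh; apply: le_lt_trans.
  by have := le_coord_nrmv (a k - l) i; rewrite !mxE.
have hs : cvgr (fun k => \sum_i `|a k i 0 - l i 0|) 0.
  have := @cvgr_sum _ (index_enum 'I_n) (fun i k => `|a k i 0 - l i 0|) (fun=> 0).
  rewrite big1//; apply=> i e /(h i) [N Nh]; exists N => k /Nh.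
  by rewrite subr0 normr_id.
move=> e /hs [N Nh]; exists N => k /Nh; rewrite subr0.
rewrite ger0_norm ?sumr_ge0//; apply: le_lt_trans.
apply: (le_trans (nrmv_le_coord _)); apply: ler_sum => i _.
by rewrite !mxE.
Qed.

Lemma bounded_cvgv_sub n (a : nat -> 'cV[R]_n) (C : R) : (forall k, nrmv (a k) <= C) ->
  exists2 s, incr_seq s & exists l, cvgv (a \o s) l.
Proof.
move=> aC; have [|s hs h] := @bounded_cvgr_sub_fam _ (fun i k => a k i 0) C (enum 'I_n).
  by move=> i k; exact: le_trans (le_coord_nrmv _ _) (aC k).
exists s => //.
have {}h : forall i, exists l, cvgr (fun k => a (s k) i 0) l.
  by move=> i; apply: h; rewrite mem_enum.
have [l hl] := choice h; exists (\col_i l i); apply/cvgvP => i.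
by rewrite mxE; exact: hl.
Qed.

Lemma bounded_cvgm_sub p n (a : nat -> 'M[R]_(p, n)) (C : R) :
  (forall k i j, `|a k i j| <= C) ->
  exists2 s, incr_seq s & exists l, cvgm (a \o s) l.
Proof.
move=> aC; have [|s hs h] := @bounded_cvgr_sub_fam _ (fun ij k => a k ij.1 ij.2) C
  (enum {: 'I_p * 'I_n}).
  by move=> i k.
exists s => //.
have {}h : forall ij : 'I_p * 'I_n, exists l, cvgr (fun k => a (s k) ij.1 ij.2) l.
  by move=> ij; apply: h; rewrite mem_enum.
have [l hl] := choice h; exists (\matrix_(i, j) l (i, j)) => i j.
by rewrite mxE; exact: (hl (i, j)).
Qed.

Lemma cvgv_cst n (l : 'cV[R]_n) : cvgv (fun=> l) l.
Proof. by move=> e e0; exists 0%N => k _; rewrite subrr nrmv0. Qed.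

Lemma cvgvD n (a b : nat -> 'cV[R]_n) la lb :
  cvgv a la -> cvgv b lb -> cvgv (fun k => a k + b k) (la + lb).
Proof.
move=> /cvgvP ha /cvgvP hb; apply/cvgvP => i; rewrite mxE.
by under eq_fun do rewrite mxE; exact: cvgrD.
Qed.

Lemma cvgvZ n (s : nat -> R) (a : nat -> 'cV[R]_n) ls la :
  cvgr s ls -> cvgv a la -> cvgv (fun k => s k *: a k) (ls *: la).
Proof.
move=> hs /cvgvP ha; apply/cvgvP => i; rewrite mxE.
by under eq_fun do rewrite mxE; exact: cvgrM.
Qed.

Lemma cvgvN n (a : nat -> 'cV[R]_n) la : cvgv a la -> cvgv (fun k => - a k) (- la).
Proof.
move=> ha; rewrite -scaleN1r; under eq_fun do rewrite -scaleN1r.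
by apply: cvgvZ ha; exact: cvgr_cst.
Qed.

Lemma cvgvB n (a b : nat -> 'cV[R]_n) la lb :
  cvgv a la -> cvgv b lb -> cvgv (fun k => a k - b k) (la - lb).
Proof. by move=> ha hb; apply: cvgvD => //; exact: cvgvN. Qed.

Lemma cvgv_dotv n (a b : nat -> 'cV[R]_n) la lb :
  cvgv a la -> cvgv b lb -> cvgr (fun k => dotv (a k) (b k)) (dotv la lb).
Proof. by move=> /cvgvP ha /cvgvP hb; apply: cvgr_sum => i; exact: cvgrM. Qed.

Lemma cvgm_mulmx p n (A : nat -> 'M[R]_(p, n)) (z : nat -> 'cV[R]_n) lA lz :
  cvgm A lA -> cvgv z lz -> cvgv (fun k => A k *m z k) (lA *m lz).
Proof.
move=> hA /cvgvP hz; apply/cvgvP => i; rewrite mxE.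
under eq_fun do rewrite mxE.
by apply: cvgr_sum => j; apply: cvgrM => //; exact: hA.
Qed.

Lemma cvgv_squeeze n (a : nat -> 'cV[R]_n) b l :
  cvgr b 0 -> (forall k, nrmv (a k - l) <= b k) -> cvgv a l.
Proof.
move=> hb ab e e0; have [N h] := hb _ e0; exists N => k /h.
by rewrite subr0; apply: le_lt_trans; exact: le_trans (ab k) (ler_norm _).
Qed.

Lemma cvgr_uniq a (l l' : R) : cvgr a l -> cvgr a l' -> l = l'.
Proof.
by move=> h h'; apply/eqP; rewrite eq_le (cvgr_le h h')// (cvgr_le h' h).
Qed.

Lemma cvgv_nrmv n (a : nat -> 'cV[R]_n) l : cvgv a l -> cvgr (fun k => nrmv (a k)) (nrmv l).
Proof.
move=> h e /h [N Nh]; exists N => k /Nh; apply: le_lt_trans.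
have := nrmv_subl (a k) l; have := nrmv_subl l (a k).
by rewrite (nrmvC l) ler_norml => ? ?; apply/andP; split; lra.
Qed.

Lemma cvgv_bounded n (a : nat -> 'cV[R]_n) l : cvgv a l ->
  exists C, forall k, nrmv (a k) <= C.
Proof.
move=> /cvgv_nrmv /cvgrP h; have [C [_ hC]] := cvg_seq_bounded (cvgP _ h).
exists (C + 1) => k; have /(_ k I) /= := hC (C + 1) (ltr_pwDr ltr01 (lexx _)).
by rewrite ger0_norm ?nrmv_ge0.
Qed.

End Sequences.

(** * Proximal mappings and their Jacobians *)

Section Prox.
Variables (R : realType) (m : nat).
Local Notation vec := 'cV[R]_m.
Implicit Types (f : vec -> \bar R) (x y z u v h : vec).

(** The last clause provides an affine minorant, which bounds the proximal objective from below in
    [prox_set_ex]. Besides [f], the predicate is applied to the tilted functions and, in dimension m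
    + 1, to the indicator of the epigraph. *)
Definition closed_convex f : Prop :=
  [/\ lsc_fun f, proper_fun f, convex_fun f & exists x u, subdiff f x u].

Lemma domE f x : proper_fun f -> (f x < +oo)%E -> f x = (fine (f x))%:E.
Proof. by move=> [/(_ x)]; case: (f x). Qed.

Lemma lsc_seq f (z : nat -> vec) (l : vec) (a : nat -> R) (b : R) :
  lsc_fun f -> cvgv z l -> cvgr a b -> (forall k, (f (z k) <= (a k)%:E)%E) ->
  (f l <= b%:E)%E.
Proof.
move=> hl zl ab h; rewrite leNgt; apply/negP => lt.
have [c bc cf] : exists2 c : R, b < c & (c%:E < f l)%E.
  case: (f l) lt => [r|_|//]; last by exists (b + 1); [lra|rewrite ltry].
  by rewrite lte_fin => br; exists ((b + r) / 2); rewrite ?lte_fin; lra.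
have [d d0 hd] := hl _ _ cf.
have [N1 h1] := zl _ d0.
have [|N2 h2] := ab (c - b); first lra.
have := hd _ (h1 _ (leq_maxl N1 N2)); have := h2 _ (leq_maxr N1 N2).
move=> + /lt_le_trans /(_ (h _)); rewrite lte_fin ltr_norml => /andP[_]; lra.
Qed.

Lemma subdiff_le f x u z (r : R) : subdiff f x u -> f z = r%:E ->
  fine (f x) + dotv u (z - x) <= r.
Proof. by case=> fx /(_ z); rewrite -(fineK fx) => + fz; rewrite fz -EFinD lee_fin. Qed.

Lemma subdiff_dom f x u : subdiff f x u -> f x = (fine (f x))%:E.
Proof. by case=> fx _; rewrite fineK. Qed.

Lemma subdiff_le2 f x u x' u' : subdiff f x u -> subdiff f x' u' ->
  fine (f x) + dotv u (x' - x) <= fine (f x').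
Proof. by move=> h /subdiff_dom; exact: subdiff_le. Qed.

Lemma subdiff_mono f x u x' u' : subdiff f x u -> subdiff f x' u' ->
  0 <= dotv (u - u') (x - x').
Proof.
move=> h h'; have := subdiff_le2 h h'; have := subdiff_le2 h' h.
rewrite !dotvE; lra.
Qed.

Lemma prox_set_subdiff f y z : proper_fun f -> convex_fun f ->
  prox_set f y z <-> subdiff f z (y - z).
Proof.
move=> hp hc; split=> [h|[fz h] z'].
  have fzE : f z = (fine (f z))%:E.
    apply: domE => //; have [x1 fx1] := hp.2.
    have := h x1; rewrite (domE hp fx1) -EFinD.
    by case: (f z) => [r|//|//]; rewrite ltry.
  split; first by rewrite fzE.
  move=> z'; have [fz'|] := boolP (f z' < +oo)%E; last by rewrite -leNgt leye_eq => /eqP ->; rewrite leey.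
  rewrite fzE (domE hp fz') -EFinD lee_fin.
  set a := fine (f z); set b := fine (f z').
  (* Minimality is tested at the point t z' + (1 - t) z. After convexity and division by t, the
     quadratic term leaves an error of order t only. *)
  have key (t : R) : 0 < t < 1 -> a + dotv (y - z) (z' - z) - b <= t * (dotv (z' - z) (z' - z) / 2).
    move=> /andP[t0 t1]; have := hc z' z t; rewrite t0 t1 => /(_ isT).
    rewrite fzE (domE hp fz') -/a -/b -!EFinM -EFinD => h1.
    have := h (t *: z' + (1 - t) *: z).
    move=> /le_trans /(_ (leeD h1 (lexx _))).
    rewrite fzE -!EFinD lee_fin !sqr_nrmv.
    have -> : t *: z' + (1 - t) *: z - y = (z - y) + t *: (z' - z).
      by vec_ring.
    rewrite -/a -(opprB z y) !dotvE (dotvC z z') (dotvC z y) (dotvC z' y) => h2.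
    have : t * (a + dotv (y - z) (z' - z) - b) <= t * (t * (dotv (z' - z) (z' - z) / 2)).
      by rewrite !dotvE (dotvC z z'); lra.
    rewrite ler_pM2l// !dotvE ?(dotvC z z') ?(dotvC z y) ?(dotvC z' y); lra.
  rewrite -subr_ge0 -oppr_le0 opprB.
  (* The steps are 1/(k + 2), so that already the first one is below 1. *)
  apply: (@cvgr_le _ (fun=> a + dotv (y - z) (z' - z) - b) (fun k => (k.+2%:R)^-1 * (dotv (z' - z) (z' - z) / 2))).
  - exact: cvgr_cst.
  - rewrite -(mul0r (dotv (z' - z) (z' - z) / 2)); apply: cvgrM; last exact: cvgr_cst.
    apply: (@cvgr_squeeze _ _ (fun k => k.+1%:R^-1)); first exact: cvgr_inv.
    by move=> k; rewrite subr0 ger0_norm ?invr_ge0// lef_pV2 ?posrE// ler_nat.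
  - by move=> k; apply: key; rewrite invr_gt0 ltr0n/= invf_lt1 ?ltr1n ?ltr0n.
rewrite -(fineK fz) -EFinD; have := h z'.
have [fz'|] := boolP (f z' < +oo)%E; last first.
  by rewrite -leNgt leye_eq => /eqP -> _; rewrite addye// leey.
rewrite -(fineK fz) (domE hp fz') -!EFinD !lee_fin !sqr_nrmv.
have := dotv_ge0 (z' - z).
rewrite !dotvE (dotvC z z') (dotvC y z) (dotvC y z'); lra.
Qed.

Lemma prox_set_uniq f y z z' : proper_fun f -> convex_fun f ->
  prox_set f y z -> prox_set f y z' -> z = z'.
Proof.
move=> hp hc /(prox_set_subdiff _ _ hp hc) h /(prox_set_subdiff _ _ hp hc) h'.
have := subdiff_mono h h'; have -> : y - z - (y - z') = - (z - z') by vec_ring.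
rewrite dotvNl => H; apply/eqP; rewrite -subr_eq0; apply/eqP/dotv_eq0.
by apply/eqP; rewrite eq_le dotv_ge0 andbT; lra.
Qed.

Lemma prox_set_ex f y : closed_convex f -> exists z, prox_set f y z.
Proof.
move=> [hl hp hc [x0 [u0 h0]]].
pose phi z := fine (f z) + nrmv (z - y) ^+ 2 / 2.
(* The square (|u0| - |z - y| / 2)^2 >= 0 absorbs the linear term <u0, z - y> at the cost of |u0|^2
   and half of the quadratic term; this leaves |z - y|^2 / 4. *)
pose c := fine (f x0) + dotv u0 (y - x0) - nrmv u0 ^+ 2.
have lb z : (f z < +oo)%E -> nrmv (z - y) ^+ 2 / 4 <= phi z - c.
  move=> /(domE hp) /(subdiff_le h0); rewrite /phi /c.
  have -> : z - x0 = (z - y) + (y - x0) by vec_ring.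
  rewrite dotvDr; have := CauchySchwarz (- u0) (z - y); rewrite dotvNl nrmvN.
  have := sqr_ge0 (nrmv u0 - nrmv (z - y) / 2); rewrite sqrrB; lra.
pose S := [set phi z | z in [set z | (f z < +oo)%E]].
have hS : has_inf S.
  split; first by have [x1 fx1] := hp.2; exists (phi x1), x1.
  exists c => _ [z fz <-]; have := lb _ fz.
  have := sqr_ge0 (nrmv (z - y)); lra.
have /choice [z hz] : forall k : nat, exists z, (f z < +oo)%E /\ phi z < inf S + k.+1%:R^-1.
  move=> k; have [|_ [z fz <-] lt] := @inf_adherent _ S k.+1%:R^-1 _ hS.
    by rewrite invr_gt0.
  by exists z.
have [C hC] : exists C, forall k, nrmv (z k) <= C.
  exists (1 + 4 * (inf S + 1 - c) + nrmv y) => k.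
  have [fz pz] := hz k; have := lb _ fz => lbz.
  have k1 : (k.+1%:R^-1 : R) <= 1 by rewrite invf_le1 ?ler1n.
  have := sqr_ge0 (nrmv (z k - y)).
  have := sqr_ge0 (nrmv (z k - y) - 1); rewrite sqrrB expr1n mulr1.
  have := nrmv_subl (z k) y.
  move: pz lbz k1; move: (phi (z k)) (k.+1%:R^-1) (nrmv (z k - y)) => A B D; lra.
have [s hs [l hl']] := bounded_cvgv_sub hC.
have fl : (f l <= (inf S - nrmv (l - y) ^+ 2 / 2)%:E)%E.
  (* Lower semicontinuity is applied to [f] alone; the continuous quadratic term is moved into the
     bound. *)
  apply: (lsc_seq (z := z \o s) (a := fun k => inf S + (s k).+1%:R^-1 - nrmv (z (s k) - y) ^+ 2 / 2)) => //.
    apply: cvgrD; last first.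
      apply: cvgrN; apply: cvgrM; last exact: cvgr_cst.
      rewrite sqr_nrmv; under eq_fun do rewrite sqr_nrmv.
      by apply: cvgv_dotv; apply: cvgvB => //; exact: cvgv_cst.
    rewrite -[X in cvgr _ X]addr0; apply: cvgrD; first exact: cvgr_cst.
    exact: (cvgr_sub hs (@cvgr_inv R)).
  move=> k /=; have [fz pz] := hz (s k).
  rewrite (domE hp fz) lee_fin; move: pz; rewrite /phi.
  by move: ((s k).+1%:R^-1) => A; lra.
exists l => z'; have [fz'|] := boolP (f z' < +oo)%E; last first.
  by rewrite -leNgt leye_eq => /eqP ->; rewrite addye// leey.
have : inf S <= phi z' by apply: ge_inf; [exact: hS.2|exists z'].
rewrite (domE hp fz') -EFinD -/(phi z') => le1.
apply: (le_trans (leeD fl (lexx _))).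
by rewrite -EFinD lee_fin; lra.
Qed.

Section Nice.
Variable f : vec -> \bar R.
Hypothesis hf : closed_convex f.
Let hp : proper_fun f. Proof. by case: hf. Qed.
Let hc : convex_fun f. Proof. by case: hf. Qed.
Local Notation P := (Prox f).

Lemma Prox_subdiff y : subdiff f (P y) (y - P y).
Proof.
apply/prox_set_subdiff => //; rewrite /Prox.
by case: xgetP => // none; have [z /none] := prox_set_ex y hf.
Qed.

Lemma subdiff_Prox x u : subdiff f x u -> P (x + u) = x.
Proof.
move=> h; apply: (@prox_set_uniq f (x + u)) => //.
  by apply/prox_set_subdiff => //; exact: Prox_subdiff.
by apply/prox_set_subdiff => //; rewrite addrAC subrr add0r.
Qed.

Lemma Prox_firm y y' : dotv (P y - P y') (P y - P y') <= dotv (P y - P y') (y - y').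
Proof.
have := subdiff_mono (Prox_subdiff y) (Prox_subdiff y').
move: (P y) (P y') => q q'; rewrite !dotvE (dotvC q y) (dotvC q y') (dotvC q' y) (dotvC q' y') (dotvC q' q).
by move: (dotv _ _) (dotv _ _) (dotv _ _) (dotv _ _) (dotv _ _) (dotv _ _) (dotv _ _) => *; lra.
Qed.

Lemma Prox_lip y y' : nrmv (P y - P y') <= nrmv (y - y').
Proof.
have := le_trans (Prox_firm y y') (CauchySchwarz _ _); rewrite -sqr_nrmv expr2.
have := nrmv_ge0 (P y - P y'); rewrite le_eqVlt => /predU1P[<- _|p0].
  exact: nrmv_ge0.
by rewrite ler_pM2l.
Qed.

Lemma Prox_colip y y' : nrmv ((y - P y) - (y' - P y')) <= nrmv (y - y').
Proof.
rewrite -(@ler_pXn2r _ 2)// ?nnegrE ?nrmv_ge0// !sqr_nrmv.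
have -> : (y - P y) - (y' - P y') = (y - y') - (P y - P y').
  by vec_ring.
move: (Prox_firm y y'); move: (P y - P y') (y - y') => a b.
by have := dotv_ge0 a; rewrite !dotvE (dotvC b a); lra.
Qed.

(* The convex conjugate of [f + |.|^2/2], whose gradient is [Prox f]. *)
Definition prox_potential y := dotv y (P y) - fine (f (P y)) - dotv (P y) (P y) / 2.

(** The subgradient inequality of [f] at [P y'], tested at [P y], plus |P y' - P y|^2 >= 0.
    Convexity of the potential enters later arguments in this form only. *)
Lemma prox_potential_sub y y' : dotv (P y) (y' - y) <= prox_potential y' - prox_potential y.
Proof.
have := subdiff_le2 (Prox_subdiff y') (Prox_subdiff y).
rewrite /prox_potential; move: (fine _) => a; move: (fine _) => b.
move: (P y) (P y') => q q'; have := dotv_ge0 (q' - q).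
rewrite !dotvE ?(dotvC q y') ?(dotvC q y) ?(dotvC q' y') ?(dotvC q' q).
by move: (dotv y q) (dotv y' q') (dotv y' q) (dotv q q') (dotv q q) (dotv q' q') => *; lra.
Qed.

End Nice.

End Prox.

(** * Firm nonexpansiveness and symmetry of the Jacobians of a proximal mapping *)

Section Jacobian.
Variables (R : realType) (m : nat).
Local Notation vec := 'cV[R]_m.
Implicit Types (f : vec -> \bar R) (x y z u v h : vec).

(* Replaces the mean value theorem when only a one-sided slope inequality is known. *)
Lemma riemann_ub (phi k : R -> R) (a b e : R) :
  (forall s s', 0 <= s -> s <= s' -> s' <= 1 -> phi s' - phi s <= k s' * (s' - s)) ->
  (forall s, 0 <= s <= 1 -> k s <= a + b * s + e) ->
  phi 1 - phi 0 <= a + b / 2 + e.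
Proof.
move=> hphi hk.
have step (N : nat) : phi 1 - phi 0 <= a + b / 2 + e + b / 2 * N.+1%:R^-1.
  set n := N.+1; have n0 : (0 : R) < n%:R by rewrite ltr0n.
  (* Telescoping over equal steps with slopes at the right ends gives a Riemann sum of
     [a + e + b s]; the indices up to j sum to j (j + 1) / 2, so the full sum exceeds the integral
     by b / (2 n). *)
  have claim j : (j <= n)%N -> phi (j%:R / n%:R) - phi 0 <=
      (a + e) * (j%:R / n%:R) + b * (j%:R * (j%:R + 1)) / 2 / n%:R ^+ 2.
    elim: j => [_|j ih jn]; first by rewrite !mul0r subrr mulr0 !mulr0 !mul0r addr0.
    have {}ih := ih (ltnW jn).
    have d : j.+1%:R / n%:R = j%:R / n%:R + n%:R^-1 :> R by rewrite -natr1 mulrDl mul1r.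
    have j1 : j.+1%:R / n%:R <= (1 : R) by rewrite ler_pdivrMr// mul1r ler_nat.
    have := hphi (j%:R / n%:R) (j.+1%:R / n%:R).
    rewrite divr_ge0// d lerDl invr_ge0 (ltW n0) -d j1 => /(_ isT isT isT).
    have -> : j.+1%:R / n%:R - j%:R / n%:R = n%:R^-1 :> R by rewrite d addrAC subrr add0r.
    have := hk (j.+1%:R / n%:R); rewrite divr_ge0// j1 => /(_ isT) hk1 h1.
    have h2 : k (j.+1%:R / n%:R) * n%:R^-1 <= (a + b * (j.+1%:R / n%:R) + e) * n%:R^-1.
      by rewrite ler_wpM2r// invr_ge0 ltW.
    have -> : (a + e) * (j.+1%:R / n%:R) + b * (j.+1%:R * (j.+1%:R + 1)) / 2 / n%:R ^+ 2 =
      ((a + e) * (j%:R / n%:R) + b * (j%:R * (j%:R + 1)) / 2 / n%:R ^+ 2) +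
      (a + b * (j.+1%:R / n%:R) + e) * n%:R^-1.
      by rewrite -!natr1; field; rewrite natr1 gt_eqF.
    lra.
  have := claim n (leqnn n); rewrite divff ?gt_eqF// mulr1.
  have -> : b * (n%:R * (n%:R + 1)) / 2 / n%:R ^+ 2 = b / 2 + b / 2 * n%:R^-1.
    by field; rewrite gt_eqF.
  by rewrite !addrA (addrAC a).
apply: (cvgr_le (a := fun=> phi 1 - phi 0) _ _ step); first exact: cvgr_cst.
rewrite -[X in cvgr _ X]addr0; apply: cvgrD; first exact: cvgr_cst.
rewrite -(mulr0 (b / 2)); apply: cvgrM; first exact: cvgr_cst.
exact: cvgr_inv.
Qed.

(** The lower estimate is the upper estimate for the reversed function s -> phi (1 - s): since [k]
    is a subgradient of [phi], it bounds slopes from both sides. *)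
Lemma riemann_expansion (phi k : R -> R) (a b e : R) :
  (forall s s', k s * (s' - s) <= phi s' - phi s) ->
  (forall s, 0 <= s <= 1 -> `|k s - a - s * b| <= e) ->
  `|phi 1 - phi 0 - a - b / 2| <= e.
Proof.
move=> hphi hk.
have U : phi 1 - phi 0 <= a + b / 2 + e.
  apply: (@riemann_ub phi k) => [s s' _ _ _|s /hk].
    by have := hphi s' s; move: (phi s) (phi s') (k s') => p q r; lra.
  by rewrite ler_norml => /andP[_]; lra.
have L : phi (1 - 1) - phi (1 - 0) <= - (a + b) + b / 2 + e.
  apply: (@riemann_ub (fun s => phi (1 - s)) (fun s => - k (1 - s))) => [s s' _ _ _|s s01].
    by have := hphi (1 - s') (1 - s); move: (phi (1 - s)) (phi (1 - s')) (k (1 - s')) => p q r; lra.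
  have /hk : 0 <= 1 - s <= 1 by lra.
  by rewrite ler_norml => /andP[+ _]; move: (k (1 - s)) => r; lra.
by move: U L; rewrite subrr subr0 ler_norml => U L; apply/andP; split; lra.
Qed.

(** Arithmetic of [prox_jacobian_sym]. The hypotheses are, in order, the second order expansions of
    the potential at [t h] and [t (h + e k)], the first order expansion of [P] at [t h], and the
    subgradient inequality between these two points. *)
Lemma sym_arith n (p0 p1 pp N t e eta : R) (h k q q' Vh Vk : 'cV[R]_n) :
  `|p0 - pp - dotv q (t *: h) - dotv (t *: Vh) (t *: h) / 2| <=
     eta * dotv (t *: h) (t *: h) ->
  `|p1 - pp - dotv q (t *: (h + e *: k)) -
     dotv (t *: (Vh + e *: Vk)) (t *: (h + e *: k)) / 2| <=
     eta * dotv (t *: (h + e *: k)) (t *: (h + e *: k)) ->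
  - (eta * (t ^+ 2 * N)) <= dotv (q' - q - t *: Vh) (t *: (e *: k)) ->
  dotv q' (t *: (e *: k)) <= p1 - p0 ->
  t ^+ 2 * - (eta * (dotv (h + e *: k) (h + e *: k) + dotv h h + N)) <=
  t ^+ 2 * (e / 2 * (dotv Vk h - dotv Vh k + e * dotv Vk k)).
Proof.
rewrite !ler_norml => /andP[+ _] /andP[_ +]; rewrite !dotvE (dotvC k h).
move: (dotv q h) (dotv q k) (dotv q' k) (dotv Vh h) (dotv Vh k) (dotv Vk h) (dotv Vk k).
move: (dotv h h) (dotv h k) (dotv k k) => *; lra.
Qed.

Lemma is_jacobian_seq n p (F : 'cV[R]_n -> 'cV[R]_p) (y : 'cV[R]_n) V
    (t : nat -> R) (h : 'cV[R]_n) :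
  is_jacobian F y V -> (forall k, 0 < t k) -> cvgr t 0 ->
  cvgv (fun k => (t k)^-1 *: (F (y + t k *: h) - F y)) (V *m h).
Proof.
move=> hV t0 ht e e0.
have h1 : 0 < nrmv h + 1 by rewrite ltr_wpDl ?nrmv_ge0.
set c := e / (nrmv h + 1); have c0 : 0 < c by rewrite divr_gt0.
have ce : e = c * (nrmv h + 1) by rewrite /c divfK ?gt_eqF.
have [d d0 hd] := hV _ c0; have [|N hN] := ht (d / (nrmv h + 1)); first by rewrite divr_gt0.
exists N => k /hN; rewrite subr0 ltr_pdivlMr// => tk.
have := hd (t k *: h); rewrite nrmvZ => hk.
have {}hk : nrmv (F (y + t k *: h) - F y - V *m (t k *: h)) <= c * (`|t k| * nrmv h).
  by apply: hk; apply: le_lt_trans tk; rewrite ler_wpM2l// lerDl.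
have -> : (t k)^-1 *: (F (y + t k *: h) - F y) - V *m h =
  (t k)^-1 *: (F (y + t k *: h) - F y - V *m (t k *: h)).
  by rewrite -scalemxAr [RHS]scalerBr scalerA mulVf ?gt_eqF// scale1r.
rewrite nrmvZ gtr0_norm ?invr_gt0// ltr_pdivrMl//.
apply: (le_lt_trans hk); rewrite gtr0_norm// ce.
have : 0 < c * t k by rewrite mulr_gt0.
lra.
Qed.

Section Prox.
Variable f : vec -> \bar R.
Hypothesis hf : closed_convex f.
Local Notation P := (Prox f).
Local Notation Pot := (prox_potential f).

Lemma prox_jacobian_firm y V h : is_jacobian P y V ->
  dotv (V *m h) (V *m h) <= dotv (V *m h) h.
Proof.
move=> hV; have hs := is_jacobian_seq h hV _ (@cvgr_inv R).
have {}hs := hs (fun k => ltac:(by rewrite invr_gt0)).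
apply: (cvgr_le (cvgv_dotv hs hs) (cvgv_dotv hs (cvgv_cst h))) => k.
set t := (k.+1%:R^-1 : R); have t0 : 0 < t by rewrite invr_gt0.
rewrite !dotvZl !dotvZr ler_pM2l ?invr_gt0// ler_pdivrMl// -dotvZr.
have E : (y + t *: h) - y = t *: h by vec_ring.
by have := Prox_firm hf (y + t *: h) y; rewrite E.
Qed.

(** The first order expansion of [P] at [y] is integrated along the segment to [y + h]. *)
Lemma prox_potential_expansion y V e : is_jacobian P y V -> 0 < e ->
  exists2 d, 0 < d & forall h, nrmv h < d ->
  `|Pot (y + h) - Pot y - dotv (P y) h - dotv (V *m h) h / 2| <= e * dotv h h.
Proof.
move=> hV e0; have [d d0 hd] := hV _ e0; exists d => // h hh.
pose phi s := Pot (y + s *: h); pose k s := dotv (P (y + s *: h)) h.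
have hk s : 0 <= s <= 1 -> `|k s - dotv (P y) h - s * dotv (V *m h) h| <= e * dotv h h.
  move=> /andP[s0 s1]; have sh : nrmv (s *: h) <= nrmv h.
    by rewrite nrmvZ ger0_norm// ler_piMl// nrmv_ge0.
  have := hd _ (le_lt_trans sh hh).
  rewrite /k -dotvZl -!dotvNl -!dotvDl scalemxAr => le1.
  apply: (le_trans (CauchySchwarz_abs _ _)).
  rewrite -sqr_nrmv expr2 mulrA ler_wpM2r ?nrmv_ge0//; apply: (le_trans le1).
  by rewrite ler_wpM2l// ltW.
have := @riemann_expansion phi k (dotv (P y) h) (dotv (V *m h) h) (e * dotv h h) _ hk.
rewrite /phi scale1r scale0r addr0; apply=> s s'.
have := prox_potential_sub hf (y + s *: h) (y + s' *: h).
rewrite (_ : y + s' *: h - (y + s *: h) = (s' - s) *: h); last by vec_ring.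
by rewrite dotvZr mulrC.
Qed.

(** Symmetry of a Hessian at a single point of differentiability of the gradient. The increment of
    the potential from [y + t h] to [y + t (h + e k)] is at least <P (y + t h), t e k>. Expanding
    both sides to order t^2 gives <V k, h> - <V h, k> + e <V k, k> >= 0, and e -> 0 leaves an
    inequality in which [h] and [k] may be exchanged. *)
Lemma prox_jacobian_sym y V : is_jacobian P y V -> V^T = V.
Proof.
move=> hV.
have key h k : dotv (V *m h) k <= dotv (V *m k) h.
  suff : 0 <= dotv (V *m k) h - dotv (V *m h) k by lra.
  have step e : 0 < e -> 0 <= dotv (V *m k) h - dotv (V *m h) k + e * dotv (V *m k) k.
    move=> e0.
    set X := _ + _.
    (* [C] collects the coefficients of [eta] in the three error terms; [eta] is then chosen so
       small that their sum cannot compensate the assumed negative value of (e / 2) X. *)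
    pose C := dotv (h + e *: k) (h + e *: k) + dotv h h + nrmv (e *: k) * nrmv h.
    have C0 : 0 <= C by rewrite !addr_ge0 ?dotv_ge0 ?mulr_ge0 ?nrmv_ge0.
    rewrite -(@pmulr_rge0 _ (e / 2)) ?divr_gt0// leNgt; apply/negP => X0.
    have eta0 : 0 < - (e / 2 * X) / (C + 1) / 2 by rewrite !divr_gt0 ?oppr_gt0// ltr_wpDl.
    move: eta0; set eta := _ / _ => eta0.
    have eC : eta * (C + 1) < - (e / 2 * X).
      by rewrite /eta mulrAC divfK ?gt_eqF ?ltr_wpDl// ltr_pdivrMr// ltr_pMr ?oppr_gt0// ltr1n.
    have [d1 d10 h1] := prox_potential_expansion hV eta0.
    have [d2 d20 h2] := hV _ eta0.
    pose B := nrmv h + nrmv (h + e *: k) + 1.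
    have B0 : 0 < B by rewrite ltr_wpDl// addr_ge0 ?nrmv_ge0.
    have [t t0 [t1 t2]] : exists2 t, 0 < t & t * B < d1 /\ t * B < d2.
      exists (Num.min d1 d2 / B / 2); first by rewrite !divr_gt0// lt_min d10.
      have : 0 < Num.min d1 d2 by rewrite lt_min d10.
      have -> : Num.min d1 d2 / B / 2 * B = Num.min d1 d2 / 2 by field; rewrite gt_eqF.
      have : Num.min d1 d2 <= d1 by rewrite ge_min lexx.
      have : Num.min d1 d2 <= d2 by rewrite ge_min lexx orbT.
      lra.
    have bnd w : nrmv w <= B -> forall d, t * B < d -> nrmv (t *: w) < d.
      move=> wB d; apply: le_lt_trans; by rewrite nrmvZ gtr0_norm// ler_pM2l.
    have Bh : nrmv h <= B by rewrite /B; have := nrmv_ge0 (h + e *: k); lra.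
    have Bk : nrmv (h + e *: k) <= B by rewrite /B; have := nrmv_ge0 h; lra.
    have a1 := h1 _ (bnd _ _ Bh _ t1); have a2 := h1 _ (bnd _ _ Bk _ t1).
    have a3 := h2 _ (bnd _ _ Bh _ t2).
    have a4 : - (eta * (t ^+ 2 * (nrmv (e *: k) * nrmv h))) <=
       dotv (P (y + t *: h) - P y - V *m (t *: h)) (t *: (e *: k)).
      have := CauchySchwarz_abs (P (y + t *: h) - P y - V *m (t *: h)) (t *: (e *: k)).
      rewrite ler_norml => /andP[+ _]; apply: le_trans.
      rewrite lerNr opprK; apply: (le_trans (ler_wpM2r (nrmv_ge0 _) a3)).
      by rewrite !nrmvZ (gtr0_norm t0); move: (nrmv h) (nrmv k) => p q; lra.
    have a5 := prox_potential_sub hf (y + t *: h) (y + t *: (h + e *: k)).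
    have E : y + t *: (h + e *: k) - (y + t *: h) = t *: (e *: k) by vec_ring.
    rewrite {}E in a5.
    move: a1 a2 a4 a5 eta0 eC; rewrite /X /C -!scalemxAr !mulmxDr -!scalemxAr.
    move: (Pot _) (Pot _) (Pot _) (P _) (P _) (V *m h) (V *m k) => p1 p2 p3 q1 q2 Vh Vk.
    move: (nrmv (e *: k) * nrmv h) => N a1 a2 a4 a5 eta0 eC.
    have := sym_arith a1 a2 a4 a5; rewrite ler_pM2l ?exprn_gt0//.
    by lra.
  apply: (@cvgr_le _ (fun=> 0) (fun j => dotv (V *m k) h - dotv (V *m h) k + j.+1%:R^-1 * dotv (V *m k) k)).
  - exact: cvgr_cst.
  - rewrite -[X in cvgr _ X]addr0; apply: cvgrD; first exact: cvgr_cst.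
    rewrite -(mul0r (dotv (V *m k) k)); apply: cvgrM; last exact: cvgr_cst.
    exact: cvgr_inv.
  - by move=> j; apply: step; rewrite invr_gt0.
apply/matrixP => i j; rewrite mxE.
have E a b : V a b = dotv (V *m delta_mx b 0) (delta_mx a 0).
  by rewrite dotvC dotv_delta -colE mxE.
by rewrite !E; apply/eqP; rewrite eq_le !key.
Qed.

End Prox.
End Jacobian.

(** * Second subderivatives and the graph of the subdifferential *)

Section SecondOrder.
Variables (R : realType) (m : nat).
Local Notation vec := 'cV[R]_m.
Implicit Types (f : vec -> \bar R) (x y z u v w h : vec).

(** The nested extrema become a single tolerance that bounds the step, the direction and the value
    at once. *)
Lemma liminf_td_leP (g : R -> vec -> \bar R) d (c : R) :
  (liminf_td g d <= c%:E)%E <->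
  forall e : R, 0 < e -> exists t d', [/\ 0 < t < e, nrmv (d' - d) < e &
    (g t d' <= (c + e)%:E)%E].
Proof.
split=> [h e e0|h].
  set S := [set z | exists t d', 0 < t < e /\ nrmv (d' - d) < e /\ z = g t d'].
  have : (ereal_inf S <= c%:E)%E.
    by apply: le_trans h; apply: ereal_sup_ubound; exists e.
  move=> /le_lt_trans /(_ (_ : c%:E < (c + e)%:E)%E).
  rewrite lte_fin ltrDl => /(_ e0) /ereal_inf_lt [_ [t [d' [te [de ->]]]] lt].
  by exists t, d'; split=> //; exact: ltW.
apply: ge_ereal_sup => _ [e /= e0 <-]; apply/lee_addgt0Pr => r r0.
have [|t [d' [/andP[t0 te] de le]]] := h (Num.min e r); first by rewrite lt_min e0.
apply: (@le_trans _ _ (g t d')).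
  apply: ereal_inf_lbound; exists t, d'; split; last split=> //.
    by rewrite t0 (lt_le_trans te)// ge_min lexx.
  by rewrite (lt_le_trans de)// ge_min lexx.
by apply: (le_trans le); rewrite -EFinD lee_fin lerD2l ge_min lexx orbT.
Qed.

Lemma second_quot_le f x u t d (c : R) : subdiff f x u -> 0 < t ->
  ((f (x + t *: d)%R - f x - (t * dotv u d)%:E) * (((t ^+ 2) / 2)^-1)%:E <= c%:E)%E <->
  (f (x + t *: d)%R <= (fine (f x) + t * dotv u d + c * (t ^+ 2 / 2))%:E)%E.
Proof.
move=> hu t0; rewrite (subdiff_dom hu) /=.
have t2 : 0 < t ^+ 2 / 2 by rewrite divr_gt0// exprn_gt0.
case: (f (x + t *: d)) => [r||] /=.
- rewrite -!EFinB -EFinM !lee_fin ler_pdivrMr//; split; lra.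
- by rewrite !addye// gt0_mulye ?lte_fin ?invr_gt0// !leye_eq.
- by rewrite !addNye gt0_mulNye ?lte_fin ?invr_gt0// !leNye.
Qed.

Lemma subderiv2_leP f x u d (c : R) : subdiff f x u ->
  (subderiv2 f x u d <= c%:E)%E <->
  forall e : R, 0 < e -> exists t d', [/\ 0 < t < e, nrmv (d' - d) < e &
    (f (x + t *: d')%R <= (fine (f x) + t * dotv u d' + (c + e) * (t ^+ 2 / 2))%:E)%E].
Proof.
move=> hu; split=> [/liminf_td_leP h e /h|h].
  move=> [t [d' [/andP[t0 te] de /(second_quot_le _ _ hu t0) le]]].
  by exists t, d'; rewrite t0.
apply/liminf_td_leP => e /h [t [d' [/andP[t0 te] de /(second_quot_le _ _ hu t0) le]]].
by exists t, d'; rewrite t0.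
Qed.

Lemma subderiv2_ge0 f x u d : subdiff f x u -> (0 <= subderiv2 f x u d)%E.
Proof.
move=> hu; rewrite leNgt; apply/negP => lt.
have [c c0 h] : exists2 c : R, c < 0 & (subderiv2 f x u d <= c%:E)%E.
  case: (subderiv2 f x u d) lt => [r||]//; first by rewrite lte_fin; exists r.
  by move=> _; exists (-1); rewrite ?leNye// ltrN10.
have [|t [d' [/andP[t0 _] _]]] := (subderiv2_leP d c hu).1 h (- c / 2).
  by rewrite divr_gt0// oppr_gt0.
have [_ /(_ (x + t *: d')) le1] := hu; rewrite (subdiff_dom hu) in le1 *.
move=> /(le_trans le1); rewrite -EFinD lee_fin addrAC subrr add0r dotvZr /=.
have : c / 2 * (t ^+ 2 / 2) < 0 by rewrite pmulr_llt0 ?pmulr_llt0 ?divr_gt0 ?exprn_gt0.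
lra.
Qed.

(** Arithmetic of [subderiv2_prox_jacobian]: [W] stands for V z, [D] for the difference quotient of
    [P], [E] for the increment of the potential beyond its linear part and [X] for <z - V z, V
    z>. *)
Lemma second_quot_arith n (F t e eta X E : R) (u z W D : 'cV[R]_n) : 0 < t ->
  2 * dotv z D - dotv D D - dotv W z - X < e / 2 ->
  - (eta * dotv (t *: z) (t *: z)) <= E - dotv (t *: W) (t *: z) / 2 ->
  eta * (2 * dotv z z + 1) = e / 2 -> 0 < eta ->
  F + dotv u (t *: D) + (dotv (t *: z) (t *: D) - dotv (t *: D) (t *: D) / 2 - E) <=
  F + t * dotv u D + (X + e) * (t ^+ 2 / 2).
Proof.
move=> t0; rewrite !dotvE; have t2 : 0 < t ^+ 2 by rewrite exprn_gt0.
move: (dotv z D) (dotv D D) (dotv W z) (dotv z z) (dotv u D) => a b c d g h1 h2 h3 eta0.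
have h4 : t ^+ 2 * (2 * a - b - c - X) <= t ^+ 2 * (e / 2) by rewrite ler_pM2l// ltW.
have h5 : t ^+ 2 * (eta * (2 * d + 1)) = t ^+ 2 * (e / 2) by rewrite h3.
have : 0 < t ^+ 2 * eta by rewrite mulr_gt0.
lra.
Qed.

Section Prox.
Variable f : vec -> \bar R.
Hypothesis hf : closed_convex f.
Local Notation P := (Prox f).
Local Notation Pot := (prox_potential f).

(** Fenchel equality at [y] and at [y + h]. The growth of [f] at [P (y + h)] is expressed exactly
    through the increment of the potential, so that estimates of the potential turn into estimates
    of second order quotients of [f]. *)
Lemma prox_value y h (x := P y) (u := y - x) (xi := P (y + h) - x) :
  f (P (y + h)) = (fine (f x) + dotv u xi +
    (dotv h xi - dotv xi xi / 2 - (Pot (y + h) - Pot y - dotv x h)))%:E.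
Proof.
rewrite (subdiff_dom (Prox_subdiff hf (y + h))); congr (_%:E).
rewrite /prox_potential /xi /u /x {xi u x}.
move: (fine _) => a; move: (fine _) => b; move: (P (y + h)) (P y) => q x.
by rewrite !dotvE (dotvC q x) (dotvC h x) (dotvC y x) (dotvC y q) (dotvC h q); lra.
Qed.

(** The test directions are the difference quotients of [P] along [z], which tend to V z and end at
    proximal points, where [prox_value] gives [f]. The quotient is then 2 <z, D> - <D, D> - <V z, z>
    up to the error of the potential. *)
Lemma subderiv2_prox_jacobian y V z : is_jacobian P y V ->
  (subderiv2 f (P y) (y - P y) (V *m z) <= (dotv (z - V *m z) (V *m z))%:E)%E.
Proof.
move=> hV; have hs := Prox_subdiff hf y; apply/(subderiv2_leP _ _ hs) => e e0.
pose D k := (k.+1%:R : R) *: (P (y + k.+1%:R^-1 *: z) - P y).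
have hD : cvgv D (V *m z).
  have := is_jacobian_seq z hV _ (@cvgr_inv R).
  by under eq_fun do rewrite invrK; apply=> k; rewrite invr_gt0.
have hq : cvgr (fun k => 2 * dotv z (D k) - dotv (D k) (D k) - dotv (V *m z) z)
    (dotv (z - V *m z) (V *m z)).
  have -> : dotv (z - V *m z) (V *m z) =
      2 * dotv z (V *m z) - dotv (V *m z) (V *m z) - dotv (V *m z) z.
    by rewrite !dotvE (dotvC (V *m z) z); ring.
  apply: cvgrD; last exact: cvgr_cst.
  apply: cvgrD; last by apply: cvgrN; exact: cvgv_dotv.
  by apply: cvgrM; [exact: cvgr_cst|apply: cvgv_dotv => //; exact: cvgv_cst].
(* The error [eta] t^2 <z, z> of the potential doubles on division by t^2 / 2; the added 1 covers z
   = 0. *)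
have z1 : 0 < 2 * dotv z z + 1 by rewrite ltr_wpDl// mulr_ge0 ?dotv_ge0.
have eta0 : 0 < e / 2 / (2 * dotv z z + 1) by rewrite !divr_gt0.
move: eta0; set eta := e / 2 / _ => eta0.
have etaE : eta * (2 * dotv z z + 1) = e / 2 by rewrite divfK// gt_eqF.
have [d d0 hd] := prox_potential_expansion hf hV eta0.
have [N1 h1] := hD _ e0; have [|N2 h2] := hq (e / 2); first by rewrite divr_gt0.
have [|N3 h3] := @cvgr_inv R (Num.min e (d / (nrmv z + 1))).
  by rewrite lt_min e0 divr_gt0// ltr_wpDl ?nrmv_ge0.
pose k := maxn N1 (maxn N2 N3).
have k1 : (N1 <= k)%N by rewrite leq_maxl.
have k2 : (N2 <= k)%N by rewrite /k maxnCA leq_maxl.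
have k3 : (N3 <= k)%N by rewrite /k maxnA leq_maxr.
have {h3} := h3 _ k3; rewrite subr0; set t := (k.+1%:R^-1 : R).
have t0 : 0 < t by rewrite invr_gt0.
rewrite gtr0_norm// lt_min => /andP[te td].
exists t, (D k); split; rewrite ?t0 ?te//; first exact: h1.
have -> : P y + t *: D k = P (y + t *: z).
  by rewrite /D scalerA mulVf ?gt_eqF// scale1r addrC subrK.
rewrite prox_value lee_fin.
have -> : P (y + t *: z) - P y = t *: D k by rewrite /D scalerA mulVf ?gt_eqF// scale1r.
have hdk : nrmv (t *: z) < d.
  rewrite nrmvZ gtr0_norm//; move: td; rewrite ltr_pdivlMr ?ltr_wpDl ?nrmv_ge0//.
  by apply: le_lt_trans; rewrite ler_pM2l// lerDl.
have := hd _ hdk; rewrite ler_norml -scalemxAr => /andP[+ _].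
have := h2 _ k2; rewrite ltr_norml => /andP[_ ].
move: (dotv (z - V *m z) (V *m z)) => X; move: (V *m z) (D k) (fine _) => W Dk F.
move: (Pot _ - Pot _ - _) (y - P y) => E u h2' hE.
exact: (second_quot_arith F u t0 h2' hE etaE eta0).
Qed.

Lemma dotv_col n p (a c : 'cV[R]_n) (b d : 'cV[R]_p) :
  dotv (col_mx a b) (col_mx c d) = dotv a c + dotv b d.
Proof.
rewrite /dotv big_split_ord; congr (_ + _); apply: eq_bigr => i _.
  by rewrite !col_mxEu.
by rewrite !col_mxEd.
Qed.

Lemma col_mxB n p (a c : 'cV[R]_n) (b d : 'cV[R]_p) :
  col_mx a b - col_mx c d = col_mx (a - c) (b - d).
Proof. by rewrite opp_col_mx add_col_mx. Qed.

Lemma nrmv_col_ge n p (a : 'cV[R]_n) (b : 'cV[R]_p) :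
  nrmv a <= nrmv (col_mx a b) /\ nrmv b <= nrmv (col_mx a b).
Proof.
split; rewrite -(@ler_pXn2r _ 2)// ?nnegrE ?nrmv_ge0// !sqr_nrmv dotv_col.
  by rewrite lerDl dotv_ge0.
by rewrite lerDr dotv_ge0.
Qed.

Lemma nrmv_col_le n p (a : 'cV[R]_n) (b : 'cV[R]_p) :
  nrmv (col_mx a b) <= nrmv a + nrmv b.
Proof.
rewrite -(@ler_pXn2r _ 2)// ?nnegrE ?addr_ge0 ?nrmv_ge0// sqr_nrmv dotv_col.
rewrite sqrrD !sqr_nrmv; have := mulr_ge0 (nrmv_ge0 a) (nrmv_ge0 b); lra.
Qed.

Lemma cvgv_col n p (a : nat -> 'cV[R]_n) (b : nat -> 'cV[R]_p) la lb :
  cvgv (fun k => col_mx (a k) (b k)) (col_mx la lb) <-> cvgv a la /\ cvgv b lb.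
Proof.
split=> [h|[ha hb] e e0].
  split=> e /h [N hN]; exists N => k /hN; apply: le_lt_trans; rewrite col_mxB.
    exact: (nrmv_col_ge _ _).1.
  exact: (nrmv_col_ge _ _).2.
have e2 : 0 < e / 2 by rewrite divr_gt0.
have [N1 h1] := ha _ e2; have [N2 h2] := hb _ e2; exists (maxn N1 N2) => k.
rewrite geq_max => /andP[/h1 + /h2]; rewrite col_mxB.
have := nrmv_col_le (a k - la) (b k - lb); lra.
Qed.

Lemma gphP (S : vec -> set vec) x u : gph S (col_mx x u) <-> S x u.
Proof.
split=> [[x' [u' [h /eq_col_mx [-> ->]]]]//|h]; by exists x, u.
Qed.

(** With h = x' + u' - y, every graph point satisfies x' = P (y + h). Symmetry of V turns the
    pairing with the candidate normal into <z, x' - P y - V h>, which is o(|h|). *)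
Lemma reg_normal_jacobian y V z : is_jacobian P y V ->
  reg_normal (gph (subdiff f)) (col_mx (P y) (y - P y)) (col_mx (z - V *m z) (- (V *m z))).
Proof.
move=> hV; split; first by apply/gphP; exact: Prox_subdiff.
move=> e e0; have z1 : 0 < nrmv z + 1 by rewrite ltr_wpDl ?nrmv_ge0.
have e1 : 0 < e / 2 / (nrmv z + 1) by rewrite !divr_gt0.
have [d d0 hd] := hV _ e1; exists (d / 2); first by rewrite divr_gt0.
move=> _ [x' [u' [hx' ->]]]; rewrite col_mxB dotv_col => lt.
have PE := subdiff_Prox hf hx'.
pose h := x' + u' - y.
have hle : nrmv h <= 2 * nrmv (col_mx (x' - P y) (u' - (y - P y))).
  have -> : h = (x' - P y) + (u' - (y - P y)) by rewrite /h; vec_ring.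
  apply: (le_trans (nrmvD _ _)).
  by have [] := nrmv_col_ge (x' - P y) (u' - (y - P y)); lra.
have := hd h; have -> : y + h = x' + u' by rewrite /h; vec_ring.
rewrite PE => hdh; have {hdh} le1 : nrmv (x' - P y - V *m h) <= e / 2 / (nrmv z + 1) * nrmv h.
  by apply: hdh; apply: (le_lt_trans hle); lra.
have -> : dotv (z - V *m z) (x' - P y) + dotv (- (V *m z)) (u' - (y - P y)) =
   dotv z (x' - P y - V *m h).
  rewrite (dotvDr _ _ z) (dotvNr z) -[in dotv z (V *m h)](prox_jacobian_sym hf hV).
  rewrite [dotv z (V^T *m h)]dotvC dotv_mulmxl trmxK /h !dotvE.
  rewrite !(dotvC (V *m z)); lra.
apply: (le_trans (CauchySchwarz _ _)).
have : nrmv z * nrmv (x' - P y - V *m h) <= e / 2 * nrmv h.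
  apply: (@le_trans _ _ ((nrmv z + 1) * nrmv (x' - P y - V *m h))).
    by rewrite ler_wpM2r ?nrmv_ge0// lerDl.
  apply: (le_trans (ler_wpM2l (ltW z1) le1)).
  by rewrite mulrA [_ * (e / 2 / _)]mulrC divfK// gt_eqF.
move=> /le_trans; apply; have := ler_wpM2l (ltW e0) hle; lra.
Qed.

Lemma coderiv_B_subdiff x u V z : B_subdiff P (x + u) V -> subdiff f x u ->
  coderiv (subdiff f) x u (V *m z) (z - V *m z).
Proof.
move=> [yk [Vk [hV [hy hVk]]]] hu.
have hx : cvgv (fun k => P (yk k)) x.
  move=> e /hy [N hN]; exists N => k /hN; apply: le_lt_trans.
  by rewrite -{1}(subdiff_Prox hf hu); exact: Prox_lip.
have hVz : cvgv (fun k => Vk k *m z) (V *m z) by apply: cvgm_mulmx => //; exact: cvgv_cst.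
exists (fun k => col_mx (P (yk k)) (yk k - P (yk k))),
  (fun k => col_mx (z - Vk k *m z) (- (Vk k *m z))); split; last split; last split.
- by move=> k; apply/gphP; exact: Prox_subdiff.
- apply/cvgv_col; split=> //.
  have E : u = (x + u) - x by vec_ring.
  by rewrite [in X in cvgv _ X]E; exact: cvgvB.
- by apply/cvgv_col; split; [apply: cvgvB => //; exact: cvgv_cst|exact: cvgvN].
- by move=> k; exact: reg_normal_jacobian.
Qed.

End Prox.
End SecondOrder.

(** * Functions with an affine minorant subtracted and scaled *)

Section Tilt.
Variables (R : realType) (m : nat).
Local Notation vec := 'cV[R]_m.
Implicit Types (f : vec -> \bar R) (x y z u v w h q g : vec).

(** Subtracting the affine minorant given by [u] makes [x] a minimiser with value 0, hence a fixed
    point of the proximal mapping at every scale [l]. *)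
Definition tilt f x u (l : R) : vec -> \bar R :=
  fun y => (l%:E * (f y - (fine (f x) + dotv u (y - x))%:E))%E.

Lemma tiltE f x u l y (r : R) : f y = r%:E ->
  tilt f x u l y = (l * (r - (fine (f x) + dotv u (y - x))))%:E.
Proof. by move=> fy; rewrite /tilt fy -EFinB -EFinM. Qed.

Lemma tilty f x u l y : 0 < l -> f y = +oo%E -> tilt f x u l y = +oo%E.
Proof. by move=> l0 fy; rewrite /tilt fy addye// gt0_muley ?lte_fin. Qed.

Lemma tilt_lty f x u l y : proper_fun f -> 0 < l -> (tilt f x u l y < +oo)%E -> (f y < +oo)%E.
Proof.
move=> [fN _] l0; case E: (f y) (fN y) => [r||] // _.
  by rewrite ltry.
by rewrite tilty.
Qed.

Section TiltFacts.
Variables (f : vec -> \bar R) (x u : vec) (l : R).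
Hypotheses (hf : closed_convex f) (hu : subdiff f x u) (l0 : 0 < l).

Lemma tilt_self : tilt f x u l x = 0%E.
Proof. by rewrite (tiltE _ _ _ (subdiff_dom hu)) subrr dotv0r addr0 subrr mulr0. Qed.

Lemma tilt_ge0 y : (0 <= tilt f x u l y)%E.
Proof.
have [_ [fN _] _ _] := hf; case E: (f y) (fN y) => [r||] // _.
  rewrite (tiltE _ _ _ E) lee_fin mulr_ge0 ?(ltW l0)// subr_ge0.
  exact: subdiff_le hu E.
by rewrite tilty// leey.
Qed.

Lemma subdiff_tilt q g : subdiff (tilt f x u l) q g -> subdiff f q (u + l^-1 *: g).
Proof.
have [_ [fN f1] _ _] := hf => -[tq hq].
have fq : f q = (fine (f q))%:E.
  by apply: domE => //; apply: (@tilt_lty f x u l q (conj fN f1) l0); rewrite ltey_eq tq.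
split; first by rewrite fq.
move=> y; case E: (f y) (fN y) => [r||] // _; last by rewrite leey.
rewrite fq -EFinD lee_fin; have := hq y.
rewrite (tiltE _ _ _ E) (tiltE _ _ _ fq) -EFinD lee_fin => h.
have : l * (fine (f q) - (fine (f x) + dotv u (q - x)) + l^-1 * dotv g (y - q)) <=
  l * (r - (fine (f x) + dotv u (y - x))).
  by rewrite mulrDr [l * (l^-1 * _)]mulrA divff ?gt_eqF// mul1r.
rewrite ler_pM2l// dotvDl dotvZl !(dotvDr, dotvNr) => {}h.
move: h; move: (l^-1 * _) => X.
by move: (fine _) => a; move: (fine _) => b; lra.
Qed.

Lemma closed_convex_tilt : closed_convex (tilt f x u l).
Proof.
have [hl [fN f1] hc _] := hf; split.
- move=> y a lt.
  have [b ab bf] : exists2 b : R, a / l + (fine (f x) + dotv u (y - x)) < b & (b%:E < f y)%E.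
    case E: (f y) (fN y) => [r||] // _; last first.
      by exists (a / l + (fine (f x) + dotv u (y - x)) + 1); rewrite ?ltry// ltrDl ltr01.
    move: lt; rewrite (tiltE _ _ _ E) lte_fin mulrC -ltr_pdivrMr// => lt.
    exists ((a / l + (fine (f x) + dotv u (y - x)) + r) / 2); last rewrite lte_fin.
      by move: (fine _) (dotv _ _) lt => c d; lra.
    by move: (fine _) (dotv _ _) lt => c d; lra.
  have [d d0 hd] := hl _ _ bf.
  set c := b - (a / l + (fine (f x) + dotv u (y - x))).
  have c0 : 0 < c by rewrite subr_gt0.
  have u1 : 0 < nrmv u + 1 by rewrite ltr_wpDl ?nrmv_ge0.
  exists (Num.min d (c / (nrmv u + 1))); first by rewrite lt_min d0 divr_gt0.
  move=> y'; rewrite lt_min => /andP[/hd + ].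
  case E: (f y') (fN y') => [r||] // _; last by move=> _ _; rewrite tilty// ltry.
  rewrite (tiltE _ _ _ E) !lte_fin ltr_pdivlMr// => br le.
  rewrite mulrC -ltr_pdivrMr//; have := CauchySchwarz u (y' - y).
  have : nrmv u * nrmv (y' - y) <= nrmv (y' - y) * (nrmv u + 1).
    by rewrite [nrmv u * _]mulrC ler_wpM2l ?nrmv_ge0// lerDl.
  move=> h1 /le_trans /(_ h1) /le_lt_trans /(_ le); rewrite /c !(dotvDr, dotvNr).
  by move: (a / l) (fine _) br => p q; lra.
- split=> [y|].
    case E: (f y) (fN y) => [r||] // _; first by rewrite (tiltE _ _ _ E).
    by rewrite tilty.
  by exists x; rewrite tilt_self ltry.
- move=> y z t /andP[t0 t1].
  case E: (f y) (fN y) => [r||] // _; last first.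
    rewrite (tilty _ _ l0 E) gt0_muley ?lte_fin// addye ?leey//.
    case E': (f z) (fN z) => [r'||] // _; first by rewrite (tiltE _ _ _ E') -EFinM.
    by rewrite (tilty _ _ l0 E') gt0_muley ?lte_fin ?subr_gt0.
  case E': (f z) (fN z) => [r'||] // _; last first.
    rewrite (tilty _ _ l0 E') gt0_muley ?lte_fin ?subr_gt0// addey ?leey//.
    by rewrite (tiltE _ _ _ E) -EFinM.
  rewrite (tiltE _ _ _ E) (tiltE _ _ _ E') -!EFinM -EFinD.
  have := hc y z t; rewrite t0 t1 E E' -!EFinM -EFinD => /(_ isT) le.
  have fm : f (t *: y + (1 - t) *: z) = (fine (f (t *: y + (1 - t) *: z)))%:E.
    by apply: domE => //; apply: (le_lt_trans le); rewrite ltry.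
  rewrite (tiltE _ _ _ fm) lee_fin; move: le; rewrite fm lee_fin /=.
  move: (fine _) => a; move: (fine _) => b le; rewrite !dotvE.
  have -> : t * (l * (r - (b + (dotv u y - dotv u x)))) +
    (1 - t) * (l * (r' - (b + (dotv u z - dotv u x)))) =
    l * (t * r + (1 - t) * r' - (b + (t * dotv u y + (1 - t) * dotv u z - dotv u x))) by ring.
  by rewrite ler_pM2l//; lra.
- exists x, 0; split; first by rewrite tilt_self.
  by move=> y; rewrite tilt_self dotv0l add0e tilt_ge0.
Qed.

Lemma subdiff_tilt_self : subdiff (tilt f x u l) x 0.
Proof. by split; rewrite tilt_self// => y; rewrite dotv0l add0e tilt_ge0. Qed.

Lemma Prox_tilt_self : Prox (tilt f x u l) x = x.
Proof. by have := subdiff_Prox closed_convex_tilt subdiff_tilt_self; rewrite addr0. Qed.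

Lemma Prox_tilt p (q := Prox (tilt f x u l) p) : subdiff f q (u + l^-1 *: (p - q)).
Proof. by apply: subdiff_tilt; exact: Prox_subdiff closed_convex_tilt _. Qed.

End TiltFacts.

End Tilt.

(** * Second subderivatives bounded by regular normals to the graph *)

Section RegularNormal.
Variables (R : realType) (m : nat).
Local Notation vec := 'cV[R]_m.
Implicit Types (x y z u v w h q g : vec).
Variable f : vec -> \bar R.
Hypothesis hf : closed_convex f.
Local Notation P := (Prox f).
Local Notation Pot := (prox_potential f).

(** The graph is parametrised by y -> (P y, y - P y), which is Lipschitz. The normal inequality thus
    becomes a one-sided first order estimate of [P], with <w, p - x> - <v, h - (p - x)>
    regrouped. *)
Lemma reg_normal_prox x u w v :
  reg_normal (gph (subdiff f)) (col_mx x u) (col_mx w (- v)) ->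
  forall e, 0 < e -> exists2 d, 0 < d & forall h, nrmv h < d ->
    dotv (w + v) (P (x + u + h) - x) <= dotv v h + e * nrmv h.
Proof.
move=> [/gphP hu hN] e e0; have [|d d0 hd] := hN (e / 2); first by rewrite divr_gt0.
exists (d / 2); first by rewrite divr_gt0.
move=> h hh; set p := P (x + u + h).
have hx : P (x + u) = x by exact: subdiff_Prox.
have n1 : nrmv (p - x) <= nrmv h.
  have := Prox_lip hf (x + u + h) (x + u); rewrite hx.
  by have -> : x + u + h - (x + u) = h by vec_ring.
have n2 : nrmv (x + u + h - p - u) <= nrmv h.
  have := Prox_colip hf (x + u + h) (x + u); rewrite hx.
  have -> : x + u + h - (x + u) = h by vec_ring.
  by have -> : x + u + h - P (x + u + h) - (x + u - x) = x + u + h - p - u by rewrite /p; vec_ring.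
have n3 : nrmv (col_mx (p - x) (x + u + h - p - u)) <= 2 * nrmv h.
  by have := nrmv_col_le (p - x) (x + u + h - p - u); lra.
have := hd (col_mx p (x + u + h - p)); rewrite col_mxB dotv_col.
have G : gph (subdiff f) (col_mx p (x + u + h - p)).
  by apply/gphP; exact: Prox_subdiff.
move=> /(_ G) le; have {}le : dotv w (p - x) + dotv (- v) (x + u + h - p - u) <=
    e / 2 * nrmv (col_mx (p - x) (x + u + h - p - u)).
  by apply: le; apply: (le_lt_trans n3); lra.
have := ler_wpM2l (ltW e0) n3; move: le; clear G n1 n2 n3; clearbody p.
move: (nrmv (col_mx _ _)) (nrmv h) => A B; rewrite !dotvE; move: (dotv w p) (dotv w x) (dotv v x) (dotv v u) (dotv v h) (dotv v p).
by move=> *; lra.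
Qed.

(** Write xi for the displacement and h = xi + g with u + g a subgradient at x + xi. The required
    equation reads xi + k / (1 + k) g = - t / (1 + k) v, which is the optimality condition of the
    tilted proximal mapping at scale k / (1 + k). *)
Lemma resolvent_ex x u v (k t : R) : subdiff f x u -> 0 < k -> 0 < t ->
  exists2 h, P (x + u + h) - x = - (t *: v) - k *: h & nrmv (P (x + u + h) - x) <= t * nrmv v.
Proof.
move=> hu k0 t0; have k10 : 0 < 1 + k by rewrite ltr_wpDl.
have l0 : 0 < k / (1 + k) by rewrite divr_gt0.
pose p := x - (t / (1 + k)) *: v.
have := Prox_tilt hf hu l0 p; have := Prox_lip (closed_convex_tilt hf hu l0) p x.
rewrite (Prox_tilt_self hf hu l0); move: (Prox _ p) => q; rewrite /p => nxi hq.
pose h := q - x + (k / (1 + k))^-1 *: (p - q).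
have Ph : P (x + u + h) = q.
  rewrite (_ : x + u + h = q + (u + (k / (1 + k))^-1 *: (p - q))); last by rewrite /h; vec_ring.
  exact: subdiff_Prox.
exists h; rewrite Ph.
  rewrite /h /p invf_div; apply/matrixP => i j; rewrite !mxE.
  by field; rewrite !gt_eqF.
apply: (le_trans nxi); rewrite (_ : x - _ - x = - (t / (1 + k)) *: v); last by vec_ring.
rewrite nrmvZ normrN gtr0_norm ?divr_gt0// ler_wpM2r ?nrmv_ge0//.
by rewrite ler_pdivrMr//; have := mulr_gt0 t0 k0; lra.
Qed.

(* With [z = w + v] and [E h = Pot (x + u + h) - Pot (x + u) - <x, h>], regularity of the
   normal bounds the slopes of [E] along [z], so that [0 <= E (h + t z)] bounds [E h] from
   below.  For the [h] with [P (x + u + h) - x = - t v - k h], [prox_value] turns this into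
   an upper bound for [f] at [P (x + u + h)]. *)
Lemma reg_normal_subderiv2 x u w v :
  reg_normal (gph (subdiff f)) (col_mx x u) (col_mx w (- v)) ->
  (subderiv2 f x u (- v) <= (dotv w v)%:E)%E.
Proof.
move=> hN; have /gphP hu := hN.1; apply/(subderiv2_leP _ _ hu) => e e0.
have hx : P (x + u) = x by exact: subdiff_Prox.
have [z zE] : exists z, z = w + v by exists (w + v).
pose C := `|dotv v z| + 2 * nrmv z + 1.
have C0 : 0 < C by rewrite ltr_wpDl// addr_ge0// mulr_ge0// nrmv_ge0.
have [r r0 [re rv]] : exists2 r, 0 < r & r < e /\ 2 * r * nrmv v <= e / 2.
  have v1 : 0 < 4 * (nrmv v + 1) by rewrite mulr_gt0// ltr_wpDl ?nrmv_ge0.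
  exists (e / (4 * (nrmv v + 1))); first by rewrite divr_gt0.
  have E : e / (4 * (nrmv v + 1)) * (4 * (nrmv v + 1)) = e by rewrite divfK// gt_eqF.
  have : 0 < e / (4 * (nrmv v + 1)) by rewrite divr_gt0.
  move: E; move: (e / _) (nrmv_ge0 v); move: (nrmv v) => A B A0 E B0.
  have := mulr_ge0 (ltW B0) A0; split; lra.
(* For d' = xi / t one has d' + v = - (k / t) h, and k |h / t|^2 will stay below [C]; hence |d' +
   v|^2 <= k C < r^2. The last condition absorbs the remaining terms of order [k] into e / 2. *)
have [k k0 [k1 kr ke]] : exists2 k, 0 < k & [/\ k <= 1, 2 * k * C < r ^+ 2 & k * (2 * nrmv z + 1) <= e / 2].
  have z1 : 0 < 2 * nrmv z + 1 by rewrite ltr_wpDl// mulr_ge0// nrmv_ge0.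
  exists (Num.min 1 (Num.min (r ^+ 2 / (4 * C)) (e / 2 / (2 * nrmv z + 1)))).
    by rewrite !lt_min ltr01 !divr_gt0 ?exprn_gt0// mulr_gt0.
  split; first by rewrite ge_min lexx.
    have : Num.min 1 (Num.min (r ^+ 2 / (4 * C)) (e / 2 / (2 * nrmv z + 1))) <= r ^+ 2 / (4 * C).
      by rewrite !ge_min lexx !orbT.
    rewrite ler_pdivlMr ?mulr_gt0//; have : 0 < r ^+ 2 by rewrite exprn_gt0.
    by move: (Num.min _ _) => K; lra.
  by rewrite -ler_pdivlMr// !ge_min lexx !orbT.
have [d d0 hd] := reg_normal_prox hN k0.
pose B := 2 * nrmv v / k + nrmv z + 1.
have B0 : 0 < B by rewrite ltr_wpDl// addr_ge0 ?nrmv_ge0// divr_ge0 ?mulr_ge0 ?nrmv_ge0// ltW.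
have [t t0 [te td]] : exists2 t, 0 < t & t < e /\ t * B < d.
  exists (Num.min (e / 2) (d / (2 * B))); first by rewrite lt_min !divr_gt0// mulr_gt0.
  have : Num.min (e / 2) (d / (2 * B)) <= e / 2 by rewrite ge_min lexx.
  have : Num.min (e / 2) (d / (2 * B)) <= d / (2 * B) by rewrite ge_min lexx orbT.
  rewrite ler_pdivlMr ?mulr_gt0//; move: (Num.min _ _) => K; split; lra.
have [h xiE nxi] := resolvent_ex v hu k0 t0.
move: xiE nxi; set xi := P (x + u + h) - x; move=> xiE nxi.
have := prox_value hf (x + u) h.
rewrite /= hx -/xi (_ : x + u - x = u); last by vec_ring.
rewrite (_ : P (x + u + h) = x + xi); last by rewrite /xi; vec_ring.
move: xi xiE nxi => xi xiE nxi.
have nh : nrmv h <= t * (2 * nrmv v / k).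
  have -> : h = k^-1 *: (- (t *: v) - xi).
    by rewrite xiE; apply/matrixP => i j; rewrite !mxE; field; rewrite gt_eqF.
  rewrite nrmvZ gtr0_norm ?invr_gt0// ler_pdivrMl//.
  have -> : k * (t * (2 * nrmv v / k)) = 2 * t * nrmv v by field; rewrite gt_eqF.
  by have := nrmvB (- (t *: v)) xi; rewrite nrmvN nrmvZ gtr0_norm//; lra.
set E := Pot _ - Pot _ - _; move=> hval.
have hE : - (t * dotv v h + t ^+ 2 / 2 * dotv v z + k * t * (nrmv h + t * nrmv z)) <= E.
  pose phi s := Pot (x + u + h + (s * t) *: z) - Pot (x + u) - dotv x (h + (s * t) *: z).
  pose ks s := t * dotv z (P (x + u + h + (s * t) *: z) - x).
  have : phi 1 - phi 0 <= t * dotv v h + t ^+ 2 * dotv v z / 2 + k * t * (nrmv h + t * nrmv z).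
    apply: (@riemann_ub _ phi ks) => [s s' _ _ _|s /andP[s0 s1]].
      have := prox_potential_sub hf (x + u + h + (s' * t) *: z) (x + u + h + (s * t) *: z).
      rewrite /phi /ks.
      have -> : x + u + h + (s * t) *: z - (x + u + h + (s' * t) *: z) = (s * t - s' * t) *: z by vec_ring.
      move: (P _) => p'; move: (Pot _) => a; move: (Pot _) => b; move: (Pot _) => c.
      by rewrite !dotvE (dotvC p' z) (dotvC x z); move: (dotv z p') (dotv z x) (dotv x h) => *; lra.
    have nz : nrmv (h + (s * t) *: z) <= nrmv h + t * nrmv z.
      apply: (le_trans (nrmvD _ _)); rewrite lerD2l nrmvZ normrM (ger0_norm s0) (gtr0_norm t0).
      by rewrite ler_wpM2r ?nrmv_ge0// ler_piMl// (ltW t0).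
    have := hd (h + (s * t) *: z); rewrite addrA -zE => le.
    have {}le : dotv z (P (x + u + h + (s * t) *: z) - x) <= dotv v (h + (s * t) *: z) +
      k * nrmv (h + (s * t) *: z).
      apply: le; apply: (le_lt_trans nz); apply: le_lt_trans td.
      by rewrite /B !mulrDr mulr1 -addrA lerD// lerDl ltW.
    rewrite /ks; move: le; move: (P _ - x) => X le.
    have := ler_wpM2l (ltW t0) le; have := ler_wpM2l (ltW (mulr_gt0 k0 t0)) nz.
    rewrite dotvDr dotvZr; move: (dotv z X) (dotv v h) (dotv v z) (nrmv (h + _)) (nrmv h) (nrmv z).
    by move=> *; lra.
  have : 0 <= phi 1.
    rewrite /phi mul1r -(addrA (x + u)); have := prox_potential_sub hf (x + u) (x + u + (h + t *: z)).
    rewrite hx (_ : x + u + (h + t *: z) - (x + u) = h + t *: z); last by vec_ring.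
    by move=> le; rewrite subr_ge0.
  have -> : phi 0 = E by rewrite /phi mul0r scale0r !addr0.
  clearbody E; move: (phi 1) (dotv v h) (dotv v z) (nrmv h) (nrmv z) => X a b c g; lra.
(* The subgradient inequality at the new point. Against the upper bound [F1] it yields the a priori
   bound [F2] on h / t and d'. *)
clearbody E; have psi0 : 0 <= dotv h xi - dotv xi xi / 2 - E.
  have := subdiff_le hu hval; rewrite [x + xi]addrC addrK; lra.
have hxi : dotv h xi = - (t * dotv v h) - k * nrmv h ^+ 2.
  by rewrite xiE !dotvE (dotvC h v) sqr_nrmv; ring.
pose d' := t^-1 *: xi; have d'E : xi = t *: d' by rewrite /d' scalerA divff ?scale1r// gt_eqF.
pose a := nrmv h / t; have aE : nrmv h = a * t by rewrite /a divfK// gt_eqF.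
have a0 : 0 <= a by rewrite divr_ge0 ?nrmv_ge0// ltW.
have t2 : 0 < t ^+ 2 by rewrite exprn_gt0.
(* The cross term k t |h| is at most k (|h|^2 + t^2) / 2, so half of the gain - k |h|^2 in <h, xi>
   survives. *)
have F1 : dotv h xi - dotv xi xi / 2 - E <= t ^+ 2 *
    (dotv v z / 2 + k * nrmv z + k / 2 - dotv d' d' / 2 - k * a ^+ 2 / 2).
  rewrite hxi d'E dotvZl dotvZr aE; move: hE; rewrite aE.
  have := mulr_ge0 (ltW k0) (sqr_ge0 (t * a - t)).
  move: (dotv d' d') (dotv v h) (dotv v z) (nrmv z) => *; lra.
have F2 : k * a ^+ 2 + dotv d' d' <= C.
  have : 0 <= t ^+ 2 * (dotv v z / 2 + k * nrmv z + k / 2 - dotv d' d' / 2 - k * a ^+ 2 / 2).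
    exact: le_trans psi0 F1.
  rewrite pmulr_rge0// /C; have := ler_norm (dotv v z).
  have := ler_wpM2r (nrmv_ge0 z) k1; move: (nrmv_ge0 z).
  by move: (dotv d' d') (`|dotv v z|) (dotv v z) (nrmv z) (a ^+ 2) => *; lra.
have nd : nrmv (d' + v) < r.
  have -> : d' + v = - (k / t) *: h.
    by rewrite /d' xiE; apply/matrixP => i j; rewrite !mxE; field; rewrite gt_eqF.
  rewrite nrmvZ normrN gtr0_norm ?divr_gt0// aE -mulrA [t^-1 * _]mulrC mulfK ?gt_eqF//.
  rewrite -(@ltr_pXn2r _ 2)// ?nnegrE ?(mulr_ge0 (ltW k0) a0) ?(ltW r0)//.
  apply: le_lt_trans kr; have := ler_wpM2l (ltW k0) F2.
  have := mulr_ge0 (ltW k0) (dotv_ge0 d'); have := mulr_ge0 (ltW k0) (ltW C0).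
  by move: (dotv d' d') C a {F1 C0 F2 a0 aE} => X C a; lra.
have dv : dotv v v - 2 * r * nrmv v <= dotv d' d'.
  have le1 := nrmv_subl v (- d'); rewrite opprK nrmvN addrC in le1.
  have := ler_wpM2r (nrmv_ge0 v) le1; have := nrmv_ge0 v; have := nrmv_ge0 d'.
  have := ler_wpM2r (nrmv_ge0 v) (ltW nd); rewrite (addrC d') -!sqr_nrmv.
  have := sqr_ge0 (nrmv v - nrmv d'); rewrite sqrrB.
  by move: (nrmv v) (nrmv d') (nrmv _) => A D F *; nra.
exists t, d'; split; [by rewrite t0 te|by rewrite opprK; exact: lt_trans nd re|].
rewrite -d'E hval lee_fin (_ : dotv u xi = t * dotv u d'); last by rewrite -dotvZr -d'E.
rewrite lerD2l.
apply: (le_trans F1).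
have -> : (dotv w v + e) * (t ^+ 2 / 2) = t ^+ 2 * ((dotv w v + e) / 2) by ring.
rewrite ler_pM2l//; move: dv ke rv; rewrite zE dotvDr (dotvC v w).
have := mulr_ge0 (ltW k0) (sqr_ge0 a).
by move: (dotv d' d') (dotv w v) (dotv v v) (nrmv v) (nrmv (w + v)) (a ^+ 2) => *; lra.
Qed.

End RegularNormal.

(** * Rademacher's theorem for gradients of convex functions *)

Section TupleMeasure.
Variable R : realType.
Local Notation Rm := (measurableTypeR R).

Lemma tnth_lift0 (T : Type) m (q : m.+1.-tuple T) j :
  tnth q (lift ord0 j) = tnth [tuple of behead q] j.
Proof.
rewrite tnth_behead; congr tnth; apply/val_inj.
by rewrite /= inordK // ltnS ltn_ord.
Qed.

Definition consp m (p : Rm * m.-tuple Rm) : m.+1.-tuple Rm := [the m.+1.-tuple Rm of p.1 :: p.2].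

Lemma measurable_consp m : measurable_fun [set: Rm * m.-tuple Rm] (@consp m).
Proof. by apply: measurable_cons. Qed.

Definition tshift m (h q : m.-tuple Rm) : m.-tuple Rm := [tuple tnth q i + tnth h i | i < m].

Lemma measurable_tshift m (h : m.-tuple Rm) : measurable_fun setT (tshift h).
Proof.
apply/measurable_fun_tnthP => i.
rewrite (_ : _ \o _ = (fun q : m.-tuple Rm => (tnth q i : R) + tnth h i)).
  by apply: measurable_funD => //; exact: measurable_tnth.
by apply/funext => q /=; rewrite tnth_mktuple.
Qed.

Lemma lebesgue_measure_shift (a : R) (A : set Rm) : measurable A ->
  lebesgue_measure ((fun s : Rm => s + a) @^-1` A) = lebesgue_measure A :> \bar R.
Proof.
move=> mA.
have ma : measurable_fun setT (fun s : Rm => (s : R) + a : Rm).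
  exact: measurable_funD.
apply/esym.
apply: (@lebesgue_measure_unique R (pushforward lebesgue_measure (fun s : Rm => s + a : Rm))) => //.
move=> _ [[b c]] _ <-.
have E : (fun s : Rm => (s : R) + a : Rm) @^-1` `]b, c]%classic = `]b - a, c - a]%classic.
  by apply/seteqP; split=> s /=; rewrite !in_itv/= ltrBlDr lerBrDr.
transitivity (lebesgue_measure (`]b - a, c - a]%classic : set Rm) : \bar R); last by rewrite -E.
rewrite !lebesgue_measure_itv/= !lte_fin ltrD2r; case: ifP => // _.
by rewrite -!EFinB opprD addrACA opprK addNr addr0.
Qed.

Definition tbox m (p : m.-tuple Rm) (e : R) : set (m.-tuple Rm) :=
  [set q | forall i, `|(tnth q i : R) - tnth p i| < e].

Section Step.
Variables (m : nat) (mu : {sigma_finite_measure set (m.-tuple Rm) -> \bar R}).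
Let prodm : set (Rm * m.-tuple Rm) -> \bar R := (lebesgue_measure \x mu)%E.
(** Recursion step of m-dimensional Lebesgue measure. The induction carries sigma-finiteness for
    Tonelli's theorem, translation invariance, and positivity on boxes, by which null sets have
    dense complement. *)
Definition stepm := pushforward prodm (@consp m).

Let stepm0 : stepm set0 = 0%E.
Proof. by apply: (@measure0 _ _ _ (pushforward prodm (@consp m))); exact: measurable_consp. Qed.

Let stepm_ge0 A : (0 <= stepm A)%E.
Proof. by apply: (@measure_ge0 _ _ _ (pushforward prodm (@consp m))); exact: measurable_consp. Qed.

Let stepm_sigma_additive : semi_sigma_additive stepm.
Proof.
apply: (@measure_semi_sigma_additive _ _ _ (pushforward prodm (@consp m))).
exact: measurable_consp.
Qed.

HB.instance Definition _ := isMeasure.Build _ _ _ stepm stepm0 stepm_ge0 stepm_sigma_additive.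

Definition unconsp (q : m.+1.-tuple Rm) : Rm * m.-tuple Rm := (thead q, [tuple of behead q]).

Lemma measurable_unconsp : measurable_fun setT unconsp.
Proof.
apply: measurable_fun_pair; first exact: measurable_tnth.
exact: measurable_behead.
Qed.

Lemma conspK : cancel (@consp m) unconsp.
Proof. by case=> a t; congr pair; apply/val_inj. Qed.

Let stepm_sigma_finite : sigma_finite setT stepm.
Proof.
have /sigma_finiteP[F [TF ndF Foo]] := sigma_finiteT (@lebesgue_measure R).
have /sigma_finiteP[G [TG ndG Goo]] := sigma_finiteT mu.
exists (fun k => unconsp @^-1` (F k `*` G k)).
  apply/esym/seteqP; split=> // q _.
  have [n _ Fn] : (\bigcup_n F n) (unconsp q).1 by rewrite -TF.
  have [k _ Gk] : (\bigcup_n G n) (unconsp q).2 by rewrite -TG.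
  exists (maxn n k) => //; split.
    by move: Fn; exact/subsetPset/ndF/leq_maxl.
  by move: Gk; exact/subsetPset/ndG/leq_maxr.
move=> k; have [mF Fk] := Foo k; have [mG Gk] := Goo k; split.
  rewrite -[X in measurable X]setTI; apply: measurable_unconsp => //.
  exact: measurableX.
rewrite /stepm /pushforward -comp_preimage (_ : unconsp \o _ = id); last first.
  by apply/funext => q; exact: conspK.
by rewrite preimage_id /prodm product_measure1E// lte_mul_pinfty// ge0_fin_numE.
Qed.

HB.instance Definition _ := Measure_isSigmaFinite.Build _ _ _ stepm stepm_sigma_finite.

Hypothesis mu_shift : forall h A, measurable A -> mu (tshift h @^-1` A) = mu A.
Hypothesis mu_box : forall p e, 0 < e -> (0 < mu (tbox p e))%E.

Lemma measurable_tbox n (p : n.-tuple Rm) e : measurable (tbox p e).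
Proof.
have -> : tbox p e = \big[setI/setT]_(i < n) ((@tnth n Rm ^~ i) @^-1` ball (tnth p i : R) e).
  rewrite -bigcap_seq; apply/seteqP; split=> q /= h i.
    by move=> _; rewrite /ball /= distrC; exact: h.
  by have := h i (mem_index_enum i); rewrite /ball /= distrC.
apply: bigsetI_measurable => i _; rewrite -[X in measurable X]setTI.
by apply: measurable_tnth => //; exact: measurable_ball.
Qed.

Lemma stepm_box p e : 0 < e -> (0 < stepm (tbox p e))%E.
Proof.
move=> e0; rewrite /stepm /pushforward.
rewrite (_ : _ @^-1` _ = ball (thead p : R) e `*` tbox [tuple of behead p] e).
  rewrite /prodm product_measure1E//; [|exact: measurable_ball|exact: measurable_tbox].
  apply: mule_gt0; last exact: mu_box.
  have H : (0 < lebesgue_measure (ball (thead p : R) e))%E.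
    by rewrite lebesgue_measure_ball ?ltW// lte_fin mulrn_wgt0.
  exact: H.
apply/seteqP; split=> -[s q] /=.
  move=> h; split; first by have := h ord0; rewrite /ball /= distrC.
  by move=> i; have := h (lift ord0 i); rewrite tnthS (tnth_lift0 p).
move=> [h0 h] i; case: (unliftP ord0 i) => [j|] ->.
  by have := h j; rewrite tnthS (tnth_lift0 p).
by move: h0; rewrite /ball /= distrC.
Qed.

(** A shift acts on the two factors separately, so its pushforward agrees with the product measure
    on rectangles, and these determine it. *)
Lemma stepm_shift h A : measurable A -> stepm (tshift h @^-1` A) = stepm A.
Proof.
move=> mA; pose S (p : Rm * m.-tuple Rm) : Rm * m.-tuple Rm :=
  ((p.1 : R) + thead h : Rm, tshift [tuple of behead h] p.2).
have mS : measurable_fun setT S.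
  apply: measurable_fun_pair; first by apply: measurable_funD.
  by apply: measurableT_comp; [exact: measurable_tshift|exact: measurable_snd].
have mcA : measurable (@consp m @^-1` A).
  by rewrite -[X in measurable X]setTI; exact: measurable_consp.
rewrite /stepm /pushforward -comp_preimage.
have -> : tshift h \o @consp m = @consp m \o S.
  apply/funext => -[s q]; apply/eq_from_tnth => i /=; rewrite tnth_mktuple.
  case: (unliftP ord0 i) => [j|] ->; last by [].
  by rewrite !tnthS tnth_mktuple (tnth_lift0 h).
rewrite comp_preimage.
have := @product_measure_unique _ _ _ _ _ lebesgue_measure mu (pushforward prodm S) _ _ mcA.
move=> /(_ mS) H; apply/esym; apply: H => B C mB mC.
transitivity (prodm (((fun s : Rm => (s : R) + thead h : Rm) @^-1` B) `*`
    (tshift [tuple of behead h] @^-1` C))).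
  by congr prodm; apply/seteqP; split=> -[].
rewrite /prodm product_measure1E.
- by congr (_ * _)%E; [exact: lebesgue_measure_shift|exact: mu_shift].
- by rewrite -[X in measurable X]setTI; apply: measurable_funD.
- by rewrite -[X in measurable X]setTI; apply: measurable_tshift.
Qed.

End Step.

Lemma tuple_measure m : exists mu : {sigma_finite_measure set (m.-tuple Rm) -> \bar R},
  (forall h A, measurable A -> mu (tshift h @^-1` A) = mu A) /\
  (forall p e, 0 < e -> (0 < mu (tbox p e))%E).
Proof.
elim: m => [|m [mu [h1 h2]]]; last first.
  exists (stepm mu); split; [exact: stepm_shift|exact: stepm_box].
(* In dimension 0 the space is one point, which gets unit mass. *)
exists (dirac [tuple]); split=> [h A mA|p e e0].
  by congr dirac; apply/seteqP; split=> q; rewrite /= (tuple0 (tshift h q)) (tuple0 q).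
have H : tbox p e [tuple] by case.
by rewrite /= /dirac indicE mem_set.
Qed.

End TupleMeasure.

(** * Null sets tested on parallel lines *)

Section NullIdeal.
Variable R : realType.
Local Notation Rm := (measurableTypeR R).

Definition tuple_vec m (q : m.-tuple Rm) : 'cV[R]_m := \col_i tnth q i.
Definition vec_tuple m (p : 'cV[R]_m) : m.-tuple Rm := [tuple p i 0 | i < m].

Definition vmeasurable m (A : set 'cV[R]_m) : Prop := measurable (@tuple_vec m @^-1` A).

Definition line_section m (A : set 'cV[R]_m) (a p : 'cV[R]_m) : set Rm :=
  [set s : Rm | A (p + (s : R) *: a)].

Lemma measurable_line_section m (A : set 'cV[R]_m) a p : vmeasurable A ->
  measurable (line_section A a p).
Proof.
move=> mA; pose F (s : Rm) : m.-tuple Rm := [tuple p i 0 + (s : R) * a i 0 | i < m].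
have mF : measurable_fun setT F.
  apply/measurable_fun_tnthP => i.
  rewrite (_ : _ \o _ = (fun s : Rm => p i 0 + (s : R) * a i 0)).
    apply: measurable_funD; first exact: measurable_cst.
    by apply: measurable_funM => //; exact: measurable_cst.
  by apply/funext => q /=; rewrite tnth_mktuple.
have := mF measurableT _ mA; rewrite setTI; congr measurable.
apply/seteqP; split=> s; rewrite /line_section /=.
  by congr A; apply/matrixP => i j; rewrite ord1 !mxE tnth_mktuple.
by congr A; apply/matrixP => i j; rewrite ord1 !mxE tnth_mktuple.
Qed.

Lemma lebesgue_setT : lebesgue_measure [set: Rm] = +oo%E :> \bar R.
Proof.
by have := @lebesgue_measure_itv R `]-oo, +oo[; rewrite set_itvNyy.
Qed.

Section Line.
Variables (m : nat) (mu : {sigma_finite_measure set (m.-tuple Rm) -> \bar R}).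
Hypothesis mu_shift : forall h A, measurable A -> mu (tshift h @^-1` A) = mu A.
Variables (A : set 'cV[R]_m) (a : 'cV[R]_m).
Hypothesis mA : vmeasurable A.

Let X : set (m.-tuple Rm * Rm) := [set qs | A (tuple_vec qs.1 + (qs.2 : R) *: a)].

Let mX : measurable X.
Proof.
pose F (qs : m.-tuple Rm * Rm) : m.-tuple Rm := [tuple (tnth qs.1 i : R) + (qs.2 : R) * a i 0 | i < m].
have mF : measurable_fun setT F.
  apply/measurable_fun_tnthP => i.
  rewrite (_ : _ \o _ = (fun qs : m.-tuple Rm * Rm => (tnth qs.1 i : R) + (qs.2 : R) * a i 0)).
    apply: measurable_funD.
      by apply: (measurableT_comp (measurable_tnth i)); exact: measurable_fst.
    by apply: measurable_funM => //; exact: measurable_cst.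
  by apply/funext => q /=; rewrite tnth_mktuple.
have := mF measurableT _ mA; rewrite setTI; congr measurable.
apply/seteqP; split=> -[q s]; rewrite /X /=.
  by congr A; apply/matrixP => i j; rewrite ord1 !mxE tnth_mktuple.
by congr A; apply/matrixP => i j; rewrite ord1 !mxE tnth_mktuple.
Qed.

Let xsecE q : xsection X q = line_section A a (tuple_vec q).
Proof. by apply/seteqP; split=> s; rewrite /xsection /= inE. Qed.

Let ysecE s : ysection X s = tshift (vec_tuple ((s : R) *: a)) @^-1` (@tuple_vec m @^-1` A).
Proof.
apply/seteqP; split=> q; rewrite /ysection /= inE /X /=.
  by congr A; apply/matrixP => i j; rewrite ord1 !mxE !tnth_mktuple !mxE.
by congr A; apply/matrixP => i j; rewrite ord1 !mxE !tnth_mktuple !mxE.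
Qed.

Let mphi : measurable_fun setT (fun q => lebesgue_measure (line_section A a (tuple_vec q)) : \bar R).
Proof.
have := @measurable_fun_xsection _ _ _ _ R (@lebesgue_measure R) _ mX.
by congr measurable_fun; apply/funext => q /=; rewrite xsecE.
Qed.

(** The set [X] is measured in both orders: one family of sections consists of the line sections of
    [A], the other of translates of [A], each of measure [mu A]. As 0 times +oo is 0, the value
    vanishes exactly when [A] is null. *)
Let int_phi : (\int[mu]_q (lebesgue_measure (line_section A a (tuple_vec q))) =
  mu (@tuple_vec m @^-1` A) * +oo)%E.
Proof.
transitivity ((mu \x (@lebesgue_measure R))%E X).
  by apply: eq_integral => q _ /=; rewrite xsecE.
rewrite (@product_measure_unique _ _ _ _ _ mu (@lebesgue_measure R) (mu \x^ (@lebesgue_measure R))%E)//.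
  rewrite -lebesgue_setT -integral_cst//.
  by apply: eq_integral => s _ /=; rewrite ysecE mu_shift.
by move=> B C mB mC; exact: product_measure2E.
Qed.

Lemma measurable_line_null :
  vmeasurable [set p | lebesgue_measure (line_section A a p) != 0%E :> \bar R].
Proof.
rewrite /vmeasurable /preimage /=.
have := emeasurable_neq measurableT mphi 0%E.
by rewrite setTI.
Qed.

Lemma null_lineP : mu (@tuple_vec m @^-1` A) = 0%E <->
  mu (@tuple_vec m @^-1` [set p | lebesgue_measure (line_section A a p) != 0%E :> \bar R]) = 0%E.
Proof.
have H : (\int[mu]_q `|lebesgue_measure (line_section A a (tuple_vec q))| =
  mu (@tuple_vec m @^-1` A) * +oo)%E.
  by rewrite -int_phi; apply: eq_integral => q _; rewrite gee0_abs.
have := ae_eq_integral_abs mu measurableT mphi; rewrite H => {}H.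
have mN := measurable_line_null.
split=> [A0|N0].
  have [N [mN' N0 sub]] : ae_eq mu setT (fun q => lebesgue_measure (line_section A a (tuple_vec q)) : \bar R) (cst 0%E).
    by apply/H; rewrite A0 mul0e.
  apply: (subset_measure0 mN mN') => // q /= hq; apply: sub => /= /(_ I) h.
  by rewrite h eqxx in hq.
have : (mu (tuple_vec (m:=m) @^-1` A) * +oo = 0)%E.
  apply/H; exists (@tuple_vec m @^-1` [set p | lebesgue_measure (line_section A a p) != 0%E :> \bar R]).
  split=> // q /= h; apply/eqP => h'; apply: h => _; exact: h'.
by move=> /eqP; rewrite mule_eq0 orbF => /eqP.
Qed.

End Line.

(* A set is null iff its intersection with almost every line of direction [a] is null:
   by Tonelli on [mu \x lebesgue_measure] and translation invariance of [mu]. *)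
Lemma null_ideal m : exists null : set 'cV[R]_m -> Prop,
  [/\ null set0, forall A B, vmeasurable A -> vmeasurable B -> A `<=` B -> null B -> null A,
      forall F : nat -> set 'cV[R]_m, (forall k, vmeasurable (F k)) -> (forall k, null (F k)) ->
        null (\bigcup_k F k),
      forall A a, vmeasurable A ->
        vmeasurable [set p | lebesgue_measure (line_section A a p) != 0%E :> \bar R] /\
        (null A <-> null [set p | lebesgue_measure (line_section A a p) != 0%E :> \bar R]) &
      forall A, vmeasurable A -> null A -> forall p e, 0 < e -> exists2 q, nrmv (q - p) < e & ~ A q].
Proof.
have [mu [hs hb]] := tuple_measure R m.
exists (fun A => mu (@tuple_vec m @^-1` A) = 0%E); split.
- by rewrite preimage_set0 measure0.
- move=> A B mA mB AB B0; apply: (subset_measure0 mA mB) => // q; exact: AB.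
- move=> F mF F0; rewrite preimage_bigcup.
  have mU : measurable (\bigcup_k tuple_vec (m:=m) @^-1` F k).
    by apply: bigcup_measurable => k _; exact: mF.
  apply: (measure_negligible mU); apply: negligible_bigcup => k.
  by exists (tuple_vec (m:=m) @^-1` F k); split; [exact: mF|exact: F0|].
- by move=> A a mA; split; [exact: measurable_line_null|exact: null_lineP].
- move=> A mA A0 p e e0; apply: contrapT => H.
  have e1 : 0 < e / m.+1%:R by rewrite divr_gt0.
  have := hb (vec_tuple p) _ e1.
  suff -> : mu (tbox (vec_tuple p) (e / m.+1%:R)) = 0%E by rewrite ltxx.
  apply: (subset_measure0 (measurable_tbox _ _) mA) => // q hq /=.
  apply: contrapT => nA; apply: H; exists (tuple_vec q) => //.
  apply: (le_lt_trans (nrmv_le_coord _)).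
  apply: (@le_lt_trans _ _ (\sum_(i < m) e / m.+1%:R)).
    apply: ler_sum => i _; apply/ltW; have := hq i.
    by rewrite tnth_mktuple !mxE.
  rewrite sumr_const card_ord -[X in X < _]mulr_natr mulrAC ltr_pdivrMr//.
  by rewrite ltr_pM2l// ltr_nat.
Qed.

End NullIdeal.

(** * Almost everywhere differentiation in one variable *)

Section OneDim.
Variable R : realType.
Local Notation Rm := (measurableTypeR R).
Local Notation lam := (@lebesgue_measure R).

Definition has_diff (g : R -> R) (s l : R) : Prop :=
  forall e : R, 0 < e -> exists2 d : R, 0 < d & forall t, `|t| < d ->
    `|g (s + t) - g s - l * t| <= e * `|t|.

Lemma derive_has_diff (g : R -> R) s l : derivable g s 1 -> derive1 g s = l -> has_diff g s l.
Proof.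
move=> dg; rewrite derive1E => gl e e0.
have /cvgrPdist_lt /(_ _ e0) : (fun t : R => t^-1 *: (g (t *: 1 + s) - g s)) @ 0^' --> l.
  by rewrite -gl; exact: dg.
move=> [d /= d0 hd]; exists d => // t td.
have [->|t0] := eqVneq t 0; first by rewrite addr0 subrr mulr0 subrr normr0 mulr0.
have := hd t; rewrite /= distrC subr0 => /(_ td t0).
rewrite -[t *: 1]/(t * 1) mulr1 [t + s]addrC -[_ *: _]/(_ * _) => /ltW.
move=> le; have -> : g (s + t) - g s - l * t = - ((l - t^-1 * (g (s + t) - g s)) * t).
  by rewrite mulrBl mulrAC mulVf// mul1r opprB.
by rewrite normrN normrM ler_wpM2r.
Qed.

Lemma has_diff_uniq g s l l' : has_diff g s l -> has_diff g s l' -> l = l'.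
Proof.
move=> h h'; apply/eqP; rewrite -subr_eq0 -normr_le0; apply/ler_addgt0Pr => e e0.
have e2 : 0 < e / 2 by rewrite divr_gt0.
have [d d0 hd] := h _ e2; have [d' d'0 hd'] := h' _ e2.
have [t t0 [tltd tltd']] := exists_small d0 d'0.
have td : `|t| < d by rewrite gtr0_norm.
have td' : `|t| < d' by rewrite gtr0_norm.
have := hd _ td; have := hd' _ td'; rewrite (gtr0_norm t0) add0r.
move: (g (s + t)) (g s) => A B; rewrite !ler_norml => /andP[a1 a2] /andP[a3 a4].
have le1 : `|(l - l') * t| <= e * t by rewrite ler_norml; apply/andP; split; lra.
by move: le1; rewrite normrM (gtr0_norm t0) ler_pM2r// ler_norml.
Qed.

(** Lebesgue differentiation of the integral from -oo; differentiability is local, so only agreement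
    of increments near [s] matters. *)
Lemma int_ae_diff (G h : R -> R) a b : lam.-integrable setT (EFin \o h) ->
  (forall s, a <= s <= b -> (\int[lam]_(x in `]-oo, s]) (h x)%:E = (G s - G a)%:E)%E) ->
  exists N : set Rm, [/\ measurable N, lam N = 0%E & forall s, a < s < b -> ~ N s -> has_diff G s (h s)].
Proof.
move=> ih hG.
have [|/=|N [mN N0 sub]] := @FTC1Ny R h.
- by move=> y; apply: integrableS ih.
- by apply: open_integrable_locally ih; exact: openT.
exists N; split => // s /andP[as_ sb] Ns.
have /contrapT [d1 d2] := fun n => Ns (sub s n).
have := derive_has_diff d1 d2 => H e /H [d d0 hd].
exists (Num.min d (Num.min (s - a) (b - s))); first by rewrite !lt_min d0 !subr_gt0 as_.
move=> t; rewrite !lt_min => /andP[td /andP[ta tb]].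
have := hd _ td; rewrite /Rintegral hG; last first.
  by move: ta tb; rewrite !ltr_norml => /andP[? ?] /andP[? ?]; lra.
rewrite hG/=; last by rewrite !ltW.
by have -> : G (s + t) - G a - (G s - G a) = G (s + t) - G s by ring.
Qed.

Section Monotone.
Variable k : R -> R.
Hypothesis hk : forall s t, s <= t -> 0 <= k t - k s <= t - s.

Let k_nd : nondecreasing k.
Proof. by move=> s t /hk /andP[]; rewrite subr_ge0. Qed.

Let lip s t : `|k t - k s| <= `|t - s|.
Proof.
have [st|/ltW ts] := leP s t.
  by have /andP[h1 h2] := hk st; rewrite !ger0_norm// subr_ge0.
by have /andP[h1 h2] := hk ts; rewrite distrC (distrC t) !ger0_norm// subr_ge0.
Qed.

Let k_rc : right_continuous k.
Proof.
apply: right_continuousW => x; apply/cvgrPdist_lt => e e0; near=> y.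
apply: (le_lt_trans (lip _ _)).
by near: y; exact: cvgr_dist_lt.
Unshelve. all: by end_near. Qed.

HB.instance Definition _ := isCumulative.Build R _ R k k_nd k_rc.

Let k' s := s - k s.

Let k'_nd : nondecreasing k'.
Proof. by move=> s t /hk /andP[]; rewrite /k'; lra. Qed.

Let k'_rc : right_continuous k'.
Proof.
apply: right_continuousW => x; apply: cvgB; first exact: cvg_id.
apply/cvgrPdist_lt => e e0; near=> y; apply: (le_lt_trans (lip _ _)).
by near: y; exact: cvgr_dist_lt.
Unshelve. all: by end_near. Qed.

HB.instance Definition _ := isCumulative.Build R _ R k' k'_nd k'_rc.

Let muk := lebesgue_stieltjes_measure (k : cumulative R R).
Let muk' := lebesgue_stieltjes_measure (k' : cumulative R R).

Lemma stieltjes_oc (f : cumulative R R) a b : a <= b ->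
  lebesgue_stieltjes_measure f (`]a, b]%classic : set Rm) = (f b - f a)%:E.
Proof.
move=> ab; rewrite /lebesgue_stieltjes_measure /measure_extension.
by rewrite measurable_mu_extE/=; [rewrite wlength_itv_bnd|exact: is_ocitv].
Qed.

(** The Stieltjes measures of [k] and of s - k s add up to Lebesgue measure, since they do so on
    half-open intervals. *)
Let muk_le A : measurable A -> (muk A <= lam A)%E.
Proof.
move=> mA.
have -> : lam A = measure_add muk muk' A.
  apply: lebesgue_measure_unique => // _ [[a b]] _ <-.
  transitivity (muk (`]a, b]%classic : set Rm) + muk' (`]a, b]%classic : set Rm))%E; last first.
    by rewrite -measure_addE.
  rewrite [(a, b).1]/= [(a, b).2]/=; have [ab|ba] := leP a b; last first.
    have -> : (`]a, b]%classic : set Rm) = set0 by rewrite set_itv_ge// bnd_simp -leNgt ltW.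
    by rewrite /muk /muk' !measure0 adde0.
  rewrite [in LHS]lebesgue_measure_itv /= /muk /muk' !stieltjes_oc//.
  rewrite lte_fin -EFinD /k'; case: ltP => [_|ba].
    have E : b - a = (k b - k a) + ((b - k b) - (a - k a)) by ring.
    by rewrite -EFinD; exact: (congr1 EFin E).
  have -> : a = b by apply/le_anti; rewrite ab.
  have E : 0 = (k b - k b) + ((b - k b) - (b - k b)) by ring.
  by rewrite -EFinD; exact: (congr1 EFin E).
by rewrite measure_addE leeDl.
Qed.

(** The density is the Radon-Nikodym derivative of the Stieltjes measure restricted to ]a, b]. The
    restriction makes it finite and lets integrals from -oo start effectively at [a]. *)
Lemma mono_density a b : a < b -> exists h : R -> R,
  [/\ forall s, 0 <= h s, lam.-integrable setT (EFin \o h),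
      forall s, a <= s <= b -> (\int[lam]_(x in `]-oo, s]) (h x)%:E = (k s - k a)%:E)%E &
      (\int[lam]_(x in `]a, b]) (h x)%:E = (k b - k a)%:E)%E].
Proof.
move=> ab.
have mI : measurable (`]a, b]%classic : set Rm) by exact: measurable_itv.
have Ioo : (muk `]a, b]%classic < +oo)%E by rewrite /muk stieltjes_oc ?ltry ?ltW.
pose nu : {finite_measure set Rm -> \bar R} := mfrestr mI Ioo.
have dom : nu `<< lam.
  apply/null_content_dominatesP => A mA A0; apply/eqP; rewrite eq_le measure_ge0 andbT.
  rewrite -A0; apply: le_trans (muk_le mA).
  by rewrite /nu /= /mfrestr /mrestr le_measure ?inE//; exact: measurableI.
have [h [h0 hfin ih hint]] := radon_nikodym_sigma_finite dom.
have hE : EFin \o (fine \o h) = h by apply/funext => s /=; rewrite fineK.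
exists (fine \o h); split.
- by move=> s; rewrite /= fine_ge0.
- by rewrite hE.
- move=> s /andP[as_ sb]; rewrite [LHS](_ : _ = nu `]-oo, s]%classic).
    rewrite /nu /= /mfrestr /mrestr -stieltjes_oc//; congr muk.
    apply/seteqP; split=> x /=; rewrite !in_itv/=; lra.
  by rewrite hint//; apply: eq_integral => x _ /=; rewrite fineK.
- rewrite [LHS](_ : _ = nu `]a, b]%classic).
    by rewrite /nu /= /mfrestr /mrestr setIid -stieltjes_oc// ltW.
  by rewrite hint//; apply: eq_integral => x _ /=; rewrite fineK.
Qed.

End Monotone.

End OneDim.

Section Lipschitz.
Variable R : realType.
Local Notation Rm := (measurableTypeR R).
Local Notation lam := (@lebesgue_measure R).

Lemma has_diff_affine (g : R -> R) (a b s l : R) :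
  has_diff g s l -> has_diff (fun t => a * g t + b * t) s (a * l + b).
Proof.
move=> h e e0; have a1 : 0 < `|a| + 1 by rewrite ltr_wpDl.
have [|d d0 hd] := h (e / (`|a| + 1)); first by rewrite divr_gt0.
exists d => // t /hd le.
have -> : a * g (s + t) + b * (s + t) - (a * g s + b * s) - (a * l + b) * t =
  a * (g (s + t) - g s - l * t) by ring.
rewrite normrM; apply: (@le_trans _ _ ((`|a| + 1) * (e / (`|a| + 1) * `|t|))).
  by apply: ler_pM => //; rewrite lerDl.
by rewrite mulrA [_ * (e / _)]mulrC divfK// gt_eqF.
Qed.

Lemma null_union (N N' : set Rm) : measurable N -> measurable N' ->
  lam N = 0%E -> lam N' = 0%E -> lam (N `|` N') = 0%E.
Proof.
by move=> mN mN' N0 N'0; apply: (@null_set_setU _ _ _ lam _ _ mN mN' N0 N'0).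
Qed.

Section Lip.
Variables (g : R -> R) (L : R).
Hypothesis gL : forall s t, `|g s - g t| <= L * `|s - t|.

Let C := `|L| + 1.
Let C0 : 0 < C. Proof. by rewrite ltr_wpDl. Qed.
(** The slopes of [g] lie in [-C, C]; this affine change brings them into [0, 1], where
    [mono_density] applies. *)
Let k s := (2 * C)^-1 * g s + 2^-1 * s.

Let hk s t : s <= t -> 0 <= k t - k s <= t - s.
Proof.
move=> st; have ts : 0 <= t - s by rewrite subr_ge0.
have := gL t s; rewrite (ger0_norm ts).
have LC : L * (t - s) <= C * (t - s).
  by rewrite ler_wpM2r// (le_trans (ler_norm L))// lerDl.
move=> /le_trans /(_ LC); rewrite ler_norml => /andP[h1 h2].
have -> : k t - k s = (2 * C)^-1 * (g t - g s) + 2^-1 * (t - s) by rewrite /k; ring.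
have C20 : 0 < 2 * C by rewrite mulr_gt0.
have e1 : (2 * C)^-1 * (C * (t - s)) = 2^-1 * (t - s).
  by field; rewrite gt_eqF.
have h1' : (2 * C)^-1 * - (C * (t - s)) <= (2 * C)^-1 * (g t - g s).
  by rewrite ler_pM2l// invr_gt0.
have h2' : (2 * C)^-1 * (g t - g s) <= (2 * C)^-1 * (C * (t - s)).
  by rewrite ler_pM2l// invr_gt0.
move: h1' h2'; rewrite mulrN e1; move: (_ * (g t - g s)) => X h3 h4; apply/andP; split; lra.
Qed.

Let k_diff s l : has_diff k s l -> has_diff g s (2 * C * l - C).
Proof.
move=> /(@has_diff_affine _ (2 * C) (- C) s l) h e /h [d d0 hd]; exists d => // t /hd.
have E r : 2 * C * k r + - C * r = g r by rewrite /k; field; rewrite gt_eqF.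
by rewrite !E.
Qed.

Let local_diff a b : a < b -> exists N : set Rm, [/\ measurable N, lam N = 0%E &
  forall s, a < s < b -> ~ N s -> exists l, has_diff g s l].
Proof.
move=> ab; have [h [h0 ih hh _]] := mono_density hk ab.
have [N [mN N0 hN]] := int_ae_diff ih hh; exists N; split=> // s sab Ns.
by exists (2 * C * h s - C); exact/k_diff/hN.
Qed.

Lemma lip_ae_diff : exists N : set Rm, [/\ measurable N, lam N = 0%E &
  forall s, ~ N s -> exists l, has_diff g s l].
Proof.
have /choice [N hN] : forall n : nat, exists N : set Rm, [/\ measurable N, lam N = 0%E &
  forall s, - n.+1%:R < s < n.+1%:R -> ~ N s -> exists l, has_diff g s l].
  by move=> n; apply: local_diff; rewrite gtrN// ltr0n.
exists (\bigcup_n N n); split.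
- by apply: bigcup_measurable => n _; have [] := hN n.
- apply: measure_negligible; first by apply: bigcup_measurable => n _; have [] := hN n.
  by apply: negligible_bigcup => n; have [mN N0 _] := hN n; exists (N n); split.
- move=> s Ns; have [_ _ h] := hN (Num.bound `|s|); apply: h; last first.
    by move=> H; apply: Ns; exists (Num.bound `|s|).
  rewrite -ltr_norml; apply: (lt_le_trans (archi_boundP (normr_ge0 s))).
  by rewrite ler_nat.
Qed.

(** A Lipschitz function is the integral of its derivative, so a bound on the derivative off a null
    set bounds the increment. *)
Lemma lip_increment_ge a b c (N : set Rm) : a < b -> measurable N -> lam N = 0%E ->
  (forall s, a < s < b -> ~ N s -> forall l, has_diff g s l -> c <= l) ->
  c * (b - a) <= g b - g a.
Proof.
move=> ab mN N0 hN; have [h [h0 ih hh hI]] := mono_density hk ab.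
have [N' [mN' N'0 hN']] := int_ae_diff ih hh.
have C20 : 0 < 2 * C by rewrite mulr_gt0.
pose c' := (c + C) / (2 * C).
suff : c' * (b - a) <= k b - k a.
  have Eg r : g r = 2 * C * k r - C * r by rewrite /k; field; rewrite gt_eqF.
  have Ec : c = 2 * C * c' - C by rewrite /c'; field; rewrite gt_eqF.
  rewrite (Eg a) (Eg b) {1}Ec => le1; have := ler_wpM2l (ltW C20) le1.
  by move: (k a) (k b) c' {le1 Ec} => p q c1; lra.
have [c'0|c'0] := leP c' 0.
  have /andP[k0 _] := hk (ltW ab); apply: le_trans k0.
  by rewrite mulr_le0_ge0// subr_ge0 ltW.
rewrite -lee_fin -hI.
have -> : ((c' * (b - a))%:E = \int[lam]_(x in (`]a, b]%classic : set Rm)) c'%:E)%E.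
  rewrite integral_cst; last exact: measurable_itv.
  rewrite EFinM; congr (_ * _)%E.
  by have := lebesgue_measure_itv `]a, b]; rewrite /= lte_fin ab EFinB => <-.
have mh : measurable_fun setT (EFin \o h) by have /integrableP[] := ih.
apply: ae_ge0_le_integral.
- exact: measurable_itv.
- by move=> x _; rewrite lee_fin ltW.
- exact: measurable_cst.
- by move=> x _; rewrite lee_fin.
- exact: measurable_funS mh.
(* The end point is discarded as well, since the derivative is controlled on the open interval
   only. *)
exists ((N `|` N') `|` [set b]); split.
- by apply: measurableU; [exact: measurableU|exact: measurable_set1].
- apply: null_union; [exact: measurableU|exact: measurable_set1|exact: null_union|].
  exact: lebesgue_measure_set1.
move=> s /= H; apply: contrapT => /not_orP[/not_orP[Ns N's] sb]; apply: H.
rewrite in_itv/= => /andP[as_ sb']; rewrite lee_fin.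
have sab : a < s < b by rewrite as_ lt_neqAle sb' andbT; apply/eqP.
have := hN _ sab Ns _ (k_diff (hN' _ sab N's)).
by rewrite /c' ler_pdivrMr//; lra.
Qed.

End Lip.
End Lipschitz.

(** * Measurability of conditions on difference quotients *)

Section Borel.
Variables (R : realType) (m : nat).
Local Notation Rm := (measurableTypeR R).
Local Notation vec := 'cV[R]_m.

Lemma rat_approx (x e : R) : 0 < e -> exists q : rat, `|ratr q - x| < e.
Proof.
move=> e0; have [|q] := @rat_in_itvoo R (x - e) (x + e); first by lra.
by rewrite in_itv/= => /andP[h1 h2]; exists q; rewrite ltr_norml; apply/andP; split; lra.
Qed.

Definition rvec (c : 'cV[rat]_m) : vec := \col_i ratr (c i 0).

Lemma rvec_coord_approx (p : vec) (e : R) : 0 < e -> exists c, forall i, `|rvec c i 0 - p i 0| < e.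
Proof.
move=> e0; have /choice [c hc] : forall i, exists q : rat, `|ratr q - p i 0| < e.
  by move=> i; exact: rat_approx.
by exists (\col_i c i) => i; rewrite !mxE.
Qed.

Lemma nrmv_lt_coord (p : vec) (e : R) : 0 < e -> (forall i, `|p i 0| < e / m.+1%:R) -> nrmv p < e.
Proof.
move=> e0 h; apply: (le_lt_trans (nrmv_le_coord _)).
apply: (@le_lt_trans _ _ (\sum_(i < m) e / m.+1%:R)).
  by apply: ler_sum => i _; exact/ltW.
rewrite sumr_const card_ord -[X in X < _]mulr_natr mulrAC ltr_pdivrMr//.
by rewrite ltr_pM2l// ltr_nat.
Qed.

Lemma rvec_approx (p : vec) (e : R) : 0 < e -> exists c, nrmv (rvec c - p) < e.
Proof.
move=> e0; have [|c hc] := @rvec_coord_approx p (e / m.+1%:R); first by rewrite divr_gt0.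
by exists c; apply: nrmv_lt_coord => // i; rewrite !mxE; have := hc i; rewrite mxE.
Qed.

(** [U] is the countable union of the boxes inside it that have rational centres and radii 1/(n +
    1). *)
Lemma vmeasurable_open (U : set vec) : open_setv U -> vmeasurable U.
Proof.
move=> oU; rewrite /vmeasurable.
pose B (cn : 'cV[rat]_m * nat) : set (m.-tuple Rm) :=
  [set q | tbox (vec_tuple (rvec cn.1)) cn.2.+1%:R^-1 q /\
    (forall q', tbox (vec_tuple (rvec cn.1)) cn.2.+1%:R^-1 q' -> U (tuple_vec q'))].
have -> : @tuple_vec R m @^-1` U = \bigcup_cn B cn.
  apply/seteqP; split=> [q /= Uq|q [cn _ [h1 h2]]]; last exact: h2.
  have [d d0 hd] := oU _ Uq.
  have [|N hN] := @cvgr_inv R (d / m.+1%:R / 2); first by rewrite !divr_gt0.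
  have := hN _ (leqnn N); rewrite subr0 ger0_norm ?invr_ge0// => lt.
  have n0 : (0 : R) < N.+1%:R^-1 by rewrite invr_gt0.
  have [c hc] := rvec_coord_approx (tuple_vec q) n0.
  exists (c, N) => //; split=> /=.
    by move=> i; rewrite tnth_mktuple distrC; have := hc i; rewrite [tuple_vec q _ _]mxE.
  move=> q' hq'; apply: hd; apply: nrmv_lt_coord => // i; rewrite !mxE.
  have := hq' i; have := hc i; rewrite tnth_mktuple [tuple_vec q _ _]mxE.
  move: (rvec c i 0) (tnth q i : R) (tnth q' i : R) lt => x y z.
  move: (N.+1%:R^-1) (d / m.+1%:R) => A D lt.
  rewrite !ltr_norml => /andP[a1 a2] /andP[a3 a4]; apply/andP; split; lra.
apply: countable_bigcupT_measurable; first exact: countableP.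
move=> cn; have [h|nh] := pselect (forall q', tbox (vec_tuple (rvec cn.1)) cn.2.+1%:R^-1 q' -> U (tuple_vec q')).
  have -> : B cn = tbox (vec_tuple (rvec cn.1)) cn.2.+1%:R^-1.
    by apply/seteqP; split=> [q []|q].
  exact: measurable_tbox.
have -> : B cn = set0 by apply/seteqP; split=> [q []|q].
exact: measurable0.
Qed.

Definition vcontinuous (phi : vec -> R) := forall p e, 0 < e ->
  exists2 d, 0 < d & forall p', nrmv (p' - p) < d -> `|phi p' - phi p| < e.

Lemma vmeasurable_le (phi : vec -> R) c : vcontinuous phi -> vmeasurable [set p | `|phi p| <= c].
Proof.
move=> hphi; rewrite /vmeasurable.
have -> : @tuple_vec R m @^-1` [set p | `|phi p| <= c] = ~` (@tuple_vec R m @^-1` [set p | c < `|phi p|]).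
  apply/seteqP; split=> q /=; first by move=> h; apply/negP; rewrite -leNgt.
  by move/negP; rewrite -leNgt.
apply: measurableC; apply: vmeasurable_open => p /= hp.
have [|d d0 hd] := hphi p (`|phi p| - c); first by rewrite subr_gt0.
exists d => // p' /hd lt; have := ler_normB (phi p') (phi p' - phi p).
have -> : phi p' - (phi p' - phi p) = phi p by ring.
by move: (`|_|) (`|phi p'|) (`|phi p|) lt => X Y Z; lra.
Qed.

(** A Cauchy form of the statement that two families have the same limit as the rational parameter
    tends to 0. No limit value occurs, so the set is a countable combination of closed conditions;
    for u = v it expresses that the limit exists. *)
Definition agree (u v : rat -> vec -> R) : set vec :=
  [set p | forall k : nat, exists n : nat, forall q1 q2 : rat,
    0 < `|q1| < n.+1%:R^-1 -> 0 < `|q2| < n.+1%:R^-1 -> `|u q1 p - v q2 p| <= k.+1%:R^-1].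

Lemma vmeasurable_agree u v : (forall q, vcontinuous (u q)) -> (forall q, vcontinuous (v q)) ->
  vmeasurable (~` agree u v).
Proof.
move=> hu hv; rewrite /vmeasurable -preimage_setC; apply: measurableC.
pose S (k n : nat) (q : rat * rat) := @tuple_vec R m @^-1`
  [set p | 0 < `|q.1| < n.+1%:R^-1 -> 0 < `|q.2| < n.+1%:R^-1 -> `|u q.1 p - v q.2 p| <= k.+1%:R^-1].
have -> : @tuple_vec R m @^-1` agree u v = \bigcap_k \bigcup_n \bigcap_q S k n q.
  apply/seteqP; split=> p /= h k.
    by move=> _; have [n hn] := h k; exists n => // -[q1 q2] _; exact: hn.
  by have [n _ hn] := h k I; exists n => q1 q2; exact: (hn (q1, q2) I).
apply: bigcap_measurable => // k _; apply: bigcup_measurable => n _.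
rewrite -[X in measurable X]setCK; apply: measurableC; rewrite setC_bigcap.
apply: countable_bigcupT_measurable; first exact: countableP.
move=> -[q1 q2]; apply: measurableC; rewrite /S /=.
have [h1|h1] := boolP (0 < `|q1| < n.+1%:R^-1); last first.
  rewrite (_ : _ @^-1` _ = setT); first exact: measurableT.
  by apply/seteqP; split.
have [h2|h2] := boolP (0 < `|q2| < n.+1%:R^-1); last first.
  rewrite (_ : _ @^-1` _ = setT); first exact: measurableT.
  by apply/seteqP; split.
rewrite (_ : _ @^-1` _ = @tuple_vec R m @^-1` [set p | `|u q1 p - v q2 p| <= k.+1%:R^-1]).
  apply: vmeasurable_le => p e e0.
  have e2 : 0 < e / 2 by rewrite divr_gt0.
  have [d1 d10 hd1] := hu q1 p _ e2; have [d2 d20 hd2] := hv q2 p _ e2.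
  exists (Num.min d1 d2); first by rewrite lt_min d10.
  move=> p'; rewrite lt_min => /andP[/hd1 + /hd2].
  move: (u q1 p) (u q1 p') (v q2 p) (v q2 p') => a b c d.
  by rewrite !ltr_norml => /andP[a1 a2] /andP[a3 a4]; apply/andP; split; lra.
by apply/seteqP; split=> p /=; [apply|].
Qed.

End Borel.

(** * Derivatives through rational difference quotients *)

Section Calculus.
Variable R : realType.
Local Notation Rm := (measurableTypeR R).
Local Notation lam := (@lebesgue_measure R).

Lemma has_diff_derive (g : R -> R) s l : has_diff g s l -> derivable g s 1 /\ derive1 g s = l.
Proof.
move=> h.
have H : (fun t : R => t^-1 *: (g (t *: 1 + s) - g s)) @ 0^' --> l.
  apply/cvgrPdist_lt => e e0; have [|d d0 hd] := h (e / 2); first by rewrite divr_gt0.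
  exists d => //= t; rewrite /= distrC subr0 => td t0; have := hd _ td.
  rewrite -[t *: 1]/(t * 1) mulr1 [t + s]addrC -[_ *: _]/(_ * _) => le.
  have -> : l - t^-1 * (g (s + t) - g s) = - (t^-1 * (g (s + t) - g s - l * t)).
    by field.
  rewrite normrN normrM normfV; apply: (@le_lt_trans _ _ (`|t|^-1 * (e / 2 * `|t|))).
    by rewrite ler_wpM2l// invr_ge0.
  by rewrite mulrC mulfK ?normr_eq0// ltr_pdivrMr// ltr_pMr// ltr1n.
split; first by apply/cvg_ex; exists l; exact: H.
by rewrite derive1E; exact: (cvg_lim _ H).
Qed.

Lemma has_diff_continuous (g : R -> R) s l : has_diff g s l -> {for s, continuous g}.
Proof.
by move=> /has_diff_derive [h _]; apply/differentiable_continuous/derivable1_diffP.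
Qed.

Lemma has_diff_integral (F f : R -> R) a b : (forall s, has_diff F s (f s)) ->
  continuous f -> a < b ->
  (\int[lam]_(x in (`[a, b]%classic : set Rm)) (f x)%:E = (F b - F a)%:E)%E.
Proof.
move=> hF cf ab; rewrite (@continuous_FTC2 _ f F)// ?EFinB//.
- exact: continuous_subspaceT.
- split; first by move=> x _; exact: (has_diff_derive (hF x)).1.
    by apply: cvg_at_right_filter; exact: (has_diff_continuous (hF a)).
  by apply: cvg_at_left_filter; exact: (has_diff_continuous (hF b)).
- by move=> x _; exact: (has_diff_derive (hF x)).2.
Qed.

Lemma int_ae_diff_itv (G h : R -> R) a b : lam.-integrable (`[a, b]%classic : set Rm) (EFin \o h) ->
  (forall s, a < s <= b ->
     (\int[lam]_(x in (`[a, s]%classic : set Rm)) (h x)%:E = (G s - G a)%:E)%E) ->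
  exists N : set Rm, [/\ measurable N, lam N = 0%E & forall s, a < s < b -> ~ N s -> has_diff G s (h s)].
Proof.
move=> ih hG.
have mab : measurable (`[a, b]%classic : set Rm) by exact: measurable_itv.
have [||N [mN N0 hN]] := @int_ae_diff R G (h \_ (`[a, b]%classic)) a b.
- have [H _] := @integrable_mkcond _ _ _ lam _ (EFin \o h) mab.
  have := H ih; congr (_.-integrable _ _).
  by rewrite restrict_EFin.
- move=> s /andP[as_ sb].
  have E : (\int[lam]_(x in (`]-oo, s]%classic : set Rm)) ((h \_ `[a, b]%classic) x)%:E =
     \int[lam]_(x in (`[a, s]%classic : set Rm)) (h x)%:E)%E.
    transitivity (\int[lam]_(x in (`]-oo, s]%classic : set Rm)) (((EFin \o h) \_ (`[a, b]%classic : set Rm)) x))%E.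
      by apply: eq_integral => x _; exact: (esym (congr1 (fun k => k x) (restrict_EFin h `[a, b]%classic))).
    rewrite -integral_mkcondr; congr (integral _ _ _).
    by apply/seteqP; split=> x /=; rewrite !in_itv/=; [move=> [? /andP[-> _]]|move=> /andP[-> xs]; split=> //=; exact: le_trans xs sb].
  rewrite E; move: as_; rewrite le_eqVlt => /predU1P[<-|as_]; last by apply: hG; rewrite as_.
  by rewrite set_itv1 integral_set1 subrr.
exists N; split=> // s sab Ns; have := hN s sab Ns; rewrite patchE mem_set//=.
by move: sab => /andP[as_ sb]; rewrite in_itv/= !ltW.
Qed.

Definition rat_agree (al be : R -> R) : Prop := forall k : nat, exists n : nat, forall q1 q2 : rat,
  0 < `|q1| < n.+1%:R^-1 -> 0 < `|q2| < n.+1%:R^-1 ->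
  `|(ratr q1)^-1 * (al (ratr q1) - al 0) - (ratr q2)^-1 * (be (ratr q2) - be 0)| <= k.+1%:R^-1.

Lemma ratr_norm_lt (q : rat) (n : nat) : (`|ratr q| < n.+1%:R^-1 :> R) = (`|q| < n.+1%:R^-1).
Proof. by rewrite -ratr_norm -(ltr_rat R) fmorphV/= ratr_nat. Qed.

Lemma has_diff_rat_agree al be l : has_diff al 0 l -> has_diff be 0 l -> rat_agree al be.
Proof.
move=> h h' k; have e0 : 0 < (k.+1%:R^-1 : R) / 2 by rewrite divr_gt0// invr_gt0.
have [d d0 hd] := h _ e0; have [d' d'0 hd'] := h' _ e0.
have [|n hn] := @cvgr_inv R (Num.min d d'); first by rewrite lt_min d0.
have := hn _ (leqnn n); rewrite subr0 ger0_norm ?invr_ge0// lt_min => /andP[nd nd'].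
have key (ga : R -> R) (c : R) (q : rat) : n.+1%:R^-1 < c ->
    (forall t, `|t| < c -> `|ga (0 + t) - ga 0 - l * t| <= k.+1%:R^-1 / 2 * `|t|) ->
    0 < `|q| < n.+1%:R^-1 -> `|(ratr q)^-1 * (ga (ratr q) - ga 0) - l| <= k.+1%:R^-1 / 2.
  move=> nc hc /andP[q0 qn]; have := hc (ratr q); rewrite add0r => /(_ _)/wrap[].
    by apply: lt_trans nc; rewrite ratr_norm_lt.
  have q00 : ratr q != 0 :> R by rewrite fmorph_eq0 -normr_gt0.
  move=> le; have -> : (ratr q)^-1 * (ga (ratr q) - ga 0) - l =
    (ratr q)^-1 * (ga (ratr q) - ga 0 - l * ratr q) by field.
  by rewrite normrM normfV ler_pdivrMl ?normr_gt0// [X in _ <= X]mulrC.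
exists n => q1 q2 h1 h2; have := key _ _ _ nd hd h1; have := key _ _ _ nd' hd' h2.
move: (_ * (be _ - _)) (_ * (al _ - _)) (k.+1%:R^-1) => A B e.
by rewrite !ler_norml => /andP[a1 a2] /andP[a3 a4]; apply/andP; split; lra.
Qed.

(** Boundedness of the quotients gives a subsequential limit [l], the Cauchy condition makes it the
    limit over all rational steps, and the Lipschitz bound extends it to real steps. *)
Lemma rat_agree_has_diff al be (L : R) : (forall s t, `|al s - al t| <= L * `|s - t|) ->
  (forall s t, `|be s - be t| <= L * `|s - t|) -> rat_agree al be ->
  exists l, has_diff al 0 l /\ has_diff be 0 l.
Proof.
move=> hal hbe h.
pose x j := (j.+1%:R : R) * (al j.+1%:R^-1 - al 0).
have [|s hs [l hl]] := @bounded_cvgr_sub R x L.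
  move=> j; rewrite /x normrM ger0_norm//; have := hal j.+1%:R^-1 0.
  by rewrite subr0 (ger0_norm (_ : 0 <= j.+1%:R^-1)) ?invr_ge0// ler_pdivlMr// mulrC.
have hbe' k : exists n : nat, forall q : rat, 0 < `|q| < n.+1%:R^-1 ->
    `|(ratr q)^-1 * (be (ratr q) - be 0) - l| <= k.+1%:R^-1.
  have [n hn] := h k; exists n => q hq.
  have hc : cvgr (fun j => `|(x \o s) j - (ratr q)^-1 * (be (ratr q) - be 0)|)
      `|l - (ratr q)^-1 * (be (ratr q) - be 0)|.
    apply/cvgrP; apply: (@cvg_norm _ _ _ _ _ (fun j => (x \o s) j - (ratr q)^-1 * (be (ratr q) - be 0))).
    by apply: cvgB; [exact/cvgrP|exact: cvg_cst].
  rewrite distrC; apply/ler_addgt0Pr => e e0; have [N hN] := hc _ e0.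
  pose j := maxn N n.+1; have := hN j (leq_maxl _ _).
  have js : (n < s j)%N by apply: leq_trans (incr_seq_ge hs j); exact: leq_maxr.
  have := hn ((s j).+1%:R^-1) q; rewrite fmorphV/= ratr_nat invrK => H.
  have {}H : `|(x \o s) j - (ratr q)^-1 * (be (ratr q) - be 0)| <= k.+1%:R^-1.
    apply: H => //; rewrite normfV ger0_norm// invr_gt0 ltr0n/= ltf_pV2 ?posrE//.
    by rewrite ltr_nat ltnS.
  move: H; move: (`|_ - _|) (`|l - _|) (k.+1%:R^-1) => A B e1 H.
  by rewrite ltr_norml => /andP[]; lra.
have ext (ga : R -> R) : (forall s t, `|ga s - ga t| <= L * `|s - t|) ->
   (forall k, exists n : nat, forall q : rat, 0 < `|q| < n.+1%:R^-1 ->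
    `|(ratr q)^-1 * (ga (ratr q) - ga 0) - l| <= k.+1%:R^-1) -> has_diff ga 0 l.
  move=> hga hk e e0.
  have [|k hkk] := @cvgr_inv R (e / 3); first by rewrite divr_gt0.
  have := hkk _ (leqnn k); rewrite subr0 ger0_norm ?invr_ge0// => ke.
  have [n hn] := hk k; exists n.+1%:R^-1; first by rewrite invr_gt0.
  move=> t tn; have [->|t0] := eqVneq t 0.
    by rewrite addr0 mulr0 subrr subr0 !normr0 mulr0.
  have tp : 0 < `|t| by rewrite normr_gt0.
  have Lp : 0 < `|L| + `|l| + 1 by rewrite ltr_wpDl// addr_ge0.
  (* The three entries keep the rational step q away from 0 and below 1/(n + 1), and make the errors
     from the Lipschitz bound and from l (q - t) less than e |t| / 3. The rational quotient
     contributes at most e |t| / 2, as |q| <= 3 |t| / 2. *)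
  pose eta := Num.min (`|t| / 2) (Num.min (n.+1%:R^-1 - `|t|) (e / 3 * `|t| / (`|L| + `|l| + 1))).
  have eta0 : 0 < eta.
    rewrite !lt_min; apply/and3P; split; [by rewrite divr_gt0|by rewrite subr_gt0|].
    by rewrite divr_gt0// mulr_gt0// divr_gt0.
  have [q hq] := rat_approx t eta0.
  move: hq; rewrite !lt_min => /andP[q1 /andP[q2 q3]].
  have := ler_normB (ratr q) (ratr q - t); have := ler_normB t (t - ratr q).
  have := ler_normD t (ratr q - t).
  rewrite (distrC t (ratr q)).
  have -> : t - (t - ratr q) = ratr q by ring.
  have -> : ratr q - (ratr q - t) = t by ring.
  have -> : t + (ratr q - t) = ratr q by ring.
  move=> n1 _ n2.
  have qn : `|ratr q| < n.+1%:R^-1 :> R.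
    by move: q2; move: (n.+1%:R^-1) => c q2; clear - n1 q2; lra.
  have q0 : 0 < `|ratr q| :> R.
    have H1 : `|t| / 2 < `|ratr q| by clear - n2 q1; lra.
    by apply: lt_trans H1; rewrite divr_gt0.
  have qq0 : ratr q != 0 :> R by rewrite -normr_gt0.
  have hq0 : 0 < `|q| by rewrite normr_gt0; apply: contraNneq qq0 => ->; rewrite rmorph0.
  have := hn q; rewrite -ratr_norm_lt qn hq0 => /(_ isT) le; rewrite add0r.
  have -> : ga t - ga 0 - l * t = (ga t - ga (ratr q)) + ratr q * ((ratr q)^-1 * (ga (ratr q) - ga 0) - l) +
     l * (ratr q - t) by field.
  apply: (le_trans (ler_normD _ _)); apply: (le_trans (lerD (ler_normD _ _) (lexx _))).
  rewrite (normrM (ratr q)) (normrM l); have := hga t (ratr q); rewrite (distrC t) => le2.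
  have le3 : `|ratr q| * `|(ratr q)^-1 * (ga (ratr q) - ga 0) - l| <= (3 / 2 * `|t|) * (e / 3).
    apply: ler_pM => //; last by apply: (le_trans le); exact: ltW.
    by clear - n1 q1; lra.
  have le4 : L * `|ratr q - t| <= `|L| * `|ratr q - t| by rewrite ler_wpM2r// ler_norm.
  have : `|ratr q - t| * (`|L| + `|l| + 1) < e / 3 * `|t| by rewrite -ltr_pdivlMr.
  have := mulr_gt0 e0 tp; move: le2 le3 le4 (normr_ge0 (ratr q - t)).
  move: (`|ga t - _|) (`|ratr q| * _) => A B.
  clear; lra.
exists l; split; apply: ext => // k.
(* The quotients of [al] are compared with [l] through one auxiliary quotient of [be]; the index 2
   (k + 1) makes each of the two errors at most half of 1/(k + 1). *)
have [n' hn'] := hbe' (2 * k.+1)%N; have [n2 hn2] := h (2 * k.+1)%N.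
exists n2 => q hq.
have [q' hq'] : exists q' : rat, 0 < `|q'| < n2.+1%:R^-1 /\ 0 < `|q'| < n'.+1%:R^-1.
  exists ((maxn n2 n').+2%:R^-1); rewrite normfV ger0_norm// invr_gt0 ltr0n/= !ltf_pV2 ?posrE//.
  by rewrite !ltr_nat !ltnS leq_maxl leq_maxr.
have := hn2 _ _ hq hq'.1; have := hn' _ hq'.2.
have le : ((2 * k.+1).+1%:R^-1 : R) <= k.+1%:R^-1 / 2.
  by rewrite -invfM -natrM lef_pV2 ?posrE ?ltr0n// ler_nat mulnC leqW.
move: le; move: (_ * (be _ - _)) (_ * (al _ - _)) (k.+1%:R^-1) ((2 * k.+1).+1%:R^-1) => A B e1 e2 le.
by rewrite !ler_norml => /andP[a1 a2] /andP[a3 a4]; apply/andP; split; lra.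
Qed.

End Calculus.

Lemma cvg_EFin_seq (R : realType) (u : nat -> R) (l : R) :
  u @ \oo --> l -> (fun j => (u j)%:E) @ \oo --> l%:E.
Proof. by move=> h; apply: cvg_EFin => //; exact: nearW. Qed.

(** * Almost everywhere symmetry of directional derivatives of a Lipschitz gradient *)

Section Rademacher.
Variables (R : realType) (m : nat).
Local Notation Rm := (measurableTypeR R).
Local Notation lam := (@lebesgue_measure R).
Local Notation vec := 'cV[R]_m.
Implicit Types (a b p w : vec).

Variables (Phi : vec -> R) (P : vec -> vec).
Hypothesis hsub : forall p p', dotv (P p) (p' - p) <= Phi p' - Phi p.
Hypothesis hlip : forall p p', nrmv (P p - P p') <= nrmv (p - p').

Definition line a p b (t : R) := dotv a (P (p + t *: b)).

Lemma line_lip a p b s t : `|line a p b s - line a p b t| <= (nrmv a * nrmv b) * `|s - t|.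
Proof.
rewrite /line -dotvNr -dotvDr; apply: (le_trans (CauchySchwarz_abs _ _)).
rewrite -mulrA ler_wpM2l ?nrmv_ge0//; apply: (le_trans (hlip _ _)).
have -> : p + s *: b - (p + t *: b) = (s - t) *: b by vec_ring.
by rewrite nrmvZ mulrC.
Qed.

Lemma line_shift a p b s t : line a (p + s *: b) b t = line a p b (s + t).
Proof. by rewrite /line; congr (dotv a (P _)); vec_ring. Qed.

Lemma has_diff_line_shift a p b s l :
  has_diff (line a p b) s l <-> has_diff (line a (p + s *: b) b) 0 l.
Proof.
by split=> h e /h [d d0 hd]; exists d => // t /hd; rewrite !line_shift addr0 add0r.
Qed.

Definition quot a b (q : rat) p := (ratr q)^-1 * (line a p b (ratr q) - line a p b 0).

Lemma vcontinuous_quot a b q : vcontinuous (quot a b q).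
Proof.
move=> p e e0; pose c := `|(ratr q : R)^-1| * (2 * nrmv a) + 1.
have c0 : 0 < c by rewrite ltr_wpDl// mulr_ge0// mulr_ge0// nrmv_ge0.
exists (e / c); first by rewrite divr_gt0.
move=> p'; rewrite ltr_pdivlMr// => le.
have k t : `|line a p' b t - line a p b t| <= nrmv a * nrmv (p' - p).
  rewrite /line -dotvNr -dotvDr; apply: (le_trans (CauchySchwarz_abs _ _)).
  rewrite ler_wpM2l ?nrmv_ge0//; apply: (le_trans (hlip _ _)).
  by have -> : p' + t *: b - (p + t *: b) = p' - p by vec_ring.
rewrite /quot -mulrBr normrM; apply: le_lt_trans le.
have le2 : `|line a p' b (ratr q) - line a p' b 0 - (line a p b (ratr q) - line a p b 0)| <=
    2 * nrmv a * nrmv (p' - p).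
  move: (k (ratr q)) (k 0); move: (line a p' b (ratr q)) (line a p b (ratr q)) => A B.
  move: (line a p' b 0) (line a p b 0) (nrmv a * _) (mulrA 2 (nrmv a) (nrmv (p' - p))) => C D N <-.
  by rewrite !ler_norml => /andP[? ?] /andP[? ?]; apply/andP; split; lra.
rewrite /c mulrDr mulr1 mulrA; apply: (@le_trans _ _ (nrmv (p' - p) * `|(ratr q)^-1| * (2 * nrmv a))); last first.
  by rewrite lerDl nrmv_ge0.
by rewrite [nrmv (p' - p) * _]mulrC -mulrA ler_wpM2l// [nrmv (p' - p) * _]mulrC.
Qed.

Definition good a b a' b' := agree (quot a b) (quot a' b').

Lemma goodP a b p : good a b b a p <-> exists l, has_diff (line a p b) 0 l /\ has_diff (line b p a) 0 l.
Proof.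
split=> [h|[l [h1 h2]]]; last exact: (has_diff_rat_agree h1 h2).
apply: (@rat_agree_has_diff R _ _ (nrmv a * nrmv b)) => //.
  by move=> s t; exact: line_lip.
by move=> s t; rewrite mulrC [nrmv a * _]mulrC mulrC; exact: line_lip.
Qed.

Lemma good_selfP a b p : good a b a b p <-> exists l, has_diff (line a p b) 0 l.
Proof.
split=> [h|[l h1]]; last exact: (has_diff_rat_agree h1 h1).
have [||l [hl _]] := @rat_agree_has_diff R _ _ (nrmv a * nrmv b) _ _ h.
- by move=> s t; exact: line_lip.
- by move=> s t; exact: line_lip.
by exists l.
Qed.

Definition bad a b a' b' := ~` good a b a' b'.

Lemma vmeasurable_bad a b a' b' : vmeasurable (bad a b a' b').
Proof. by apply: vmeasurable_agree => q; exact: vcontinuous_quot. Qed.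

(** The increment lies between the slopes at the two ends, whose difference is controlled by the
    Lipschitz bound on [P]. *)
Lemma Phi_diff a p s : has_diff (fun t => Phi (p + t *: a)) s (line a p a s).
Proof.
move=> e e0; pose c := nrmv a ^+ 2 + 1.
have c0 : 0 < c by rewrite ltr_wpDl// sqr_ge0.
exists (e / c); first by rewrite divr_gt0.
move=> t; rewrite ltr_pdivlMr// => te.
have h1 := hsub (p + s *: a) (p + (s + t) *: a).
have h2 := hsub (p + (s + t) *: a) (p + s *: a).
have E1 : p + (s + t) *: a - (p + s *: a) = t *: a by vec_ring.
have E2 : p + s *: a - (p + (s + t) *: a) = - t *: a by vec_ring.
move: h1 h2; rewrite E1 E2 !dotvZr !(dotvC _ a) -!/(line _ _ _ _) => h1 h2.
have := line_lip a p a (s + t) s; have -> : s + t - s = t by ring.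
move: h1 h2; move: (Phi _) (line a p a _) (line a p a _) => A B C; move: (Phi _) => D h1 h2 h3.
have h4 : `|t| * `|B - C| <= `|t| * (nrmv a * nrmv a * `|t|) by rewrite ler_wpM2l.
have h5 : `|t| * (nrmv a * nrmv a * `|t|) <= e * `|t|.
  rewrite mulrC ler_wpM2r//; apply: ltW; apply: le_lt_trans te.
  by rewrite mulrC ler_wpM2l// /c expr2 lerDl.
have h6 : `|t * (B - C)| <= e * `|t| by rewrite normrM; exact: le_trans h4 h5.
move: h6; rewrite !ler_norml => /andP[h6 h7]; apply/andP; split; lra.
Qed.

Lemma has_diff_comb (g g' : R -> R) s l l' c : has_diff g s l -> has_diff g' s l' ->
  has_diff (fun t => c * (g t - g' t)) s (c * (l - l')).
Proof.
move=> h h' e e0; have c1 : 0 < 2 * (`|c| + 1) by rewrite mulr_gt0// ltr_wpDl.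
have [|d d0 hd] := h (e / (2 * (`|c| + 1))); first by rewrite divr_gt0.
have [|d' d'0 hd'] := h' (e / (2 * (`|c| + 1))); first by rewrite divr_gt0.
exists (Num.min d d'); first by rewrite lt_min d0.
move=> t; rewrite lt_min => /andP[/hd h1 /hd' h2].
have -> : c * (g (s + t) - g' (s + t)) - c * (g s - g' s) - c * (l - l') * t =
  c * ((g (s + t) - g s - l * t) - (g' (s + t) - g' s - l' * t)) by ring.
rewrite normrM; apply: (@le_trans _ _ ((`|c| + 1) * (2 * (e / (2 * (`|c| + 1)) * `|t|)))).
  apply: ler_pM => //; first by rewrite lerDl.
  apply: (le_trans (ler_normB _ _)); move: h1 h2; move: (`|_|) (`|_|) (_ * `|t|) => A B D; lra.
have -> : (`|c| + 1) * (2 * (e / (2 * (`|c| + 1)) * `|t|)) = e * `|t|; last by [].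
by field; rewrite gt_eqF// ltr_wpDl.
Qed.

Lemma has_diff_seq (g : R -> R) s l : has_diff g s l ->
  cvgr (fun j => j.+1%:R * (g (s + j.+1%:R^-1) - g s)) l.
Proof.
move=> h e e0; have [|d d0 hd] := h (e / 2); first by rewrite divr_gt0.
have [N hN] := @cvgr_inv R _ d0; exists N => j /hN; rewrite subr0 => /hd.
have j0 : (0 : R) < j.+1%:R by rewrite ltr0n.
rewrite (ger0_norm (_ : 0 <= j.+1%:R^-1)) ?invr_ge0// => le.
have -> : j.+1%:R * (g (s + j.+1%:R^-1) - g s) - l =
  j.+1%:R * (g (s + j.+1%:R^-1) - g s - l * j.+1%:R^-1) by field; rewrite ?natr1 gt_eqF.
rewrite normrM gtr0_norm//; apply: (@le_lt_trans _ _ (j.+1%:R * (e / 2 * j.+1%:R^-1))).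
  by rewrite ler_pM2l.
by rewrite mulrC mulfVK ?gt_eqF// ltr_pdivrMr// ltr_pMr// ltr1n.
Qed.

(* Directional derivatives of a gradient [P] are symmetric almost everywhere: along
   [p + s a], the difference quotients in direction [b] of [Phi] have derivative in [s] equal to
   those of [<a, P>]; by dominated convergence, [<b, P>] is an integral of the
   derivative of [<a, P>] in direction [b]. *)
Section Mixed.
Variables (a b p : vec).

Let u (j : nat) (s : R) : R := j.+1%:R * (line a (p + s *: a) b j.+1%:R^-1 - line a (p + s *: a) b 0).
(** A limit superior is measurable on the whole line; off [Z] it is the directional derivative, by
    [h_lim]. *)
Let h (s : R) : R := fine (limn_esup (fun j => (u j s)%:E)).
Let Z := line_section (bad a b a b) a p.

Let u_bound j s : `|u j s| <= nrmv a * nrmv b.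
Proof.
rewrite /u normrM ger0_norm//; have := line_lip a (p + s *: a) b j.+1%:R^-1 0.
rewrite subr0 (ger0_norm (_ : 0 <= j.+1%:R^-1)) ?invr_ge0// ler_pdivlMr//.
by rewrite mulrC.
Qed.

Let F (j : nat) (s : R) := j.+1%:R * (Phi (p + j.+1%:R^-1 *: b + s *: a) - Phi (p + s *: a)).

Let uE j s : u j s = j.+1%:R * (line a (p + j.+1%:R^-1 *: b) a s - line a p a s).
Proof.
rewrite /u; congr (_ * (_ - _)); first by rewrite /line; congr (dotv a (P _)); vec_ring.
by rewrite /line scale0r addr0.
Qed.

Let F_diff j s : has_diff (F j) s (u j s).
Proof. by rewrite uE; apply: has_diff_comb; exact: Phi_diff. Qed.

Let u_continuous j : continuous (u j).
Proof.
move=> s; apply/cvgrPdist_lt => e e0; pose c := (j.+1%:R : R) * (2 * (nrmv a * nrmv a)) + 1.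
have c0 : 0 < c by rewrite ltr_wpDl// !mulr_ge0// nrmv_ge0.
exists (e / c); first by rewrite /= divr_gt0.
move=> t; rewrite /= ltr_pdivlMr// => st; apply: le_lt_trans st.
rewrite !uE -mulrBr normrM ger0_norm// /c mulrDr mulr1.
have h1 := line_lip a (p + j.+1%:R^-1 *: b) a s t; have h2 := line_lip a p a s t.
apply: (@le_trans _ _ (j.+1%:R * (2 * (nrmv a * nrmv a) * `|s - t|))); last first.
  by rewrite mulrA [`|s - t| * _]mulrC lerDl.
rewrite ler_wpM2l//; move: h1 h2.
move: (line a p a s) (line a p a t) (line a (p + j.+1%:R^-1 *: b) a s) (line a (p + j.+1%:R^-1 *: b) a t).
move=> A B C D; rewrite -mulrA; move: (nrmv a * nrmv a * `|s - t|) => X.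
by rewrite !ler_norml => /andP[? ?] /andP[? ?]; apply/andP; split; lra.
Qed.

Let u_cvg s l : has_diff (line a (p + s *: a) b) 0 l -> cvgr (u ^~ s) l.
Proof. by move=> /has_diff_seq; under eq_fun do rewrite add0r. Qed.

Let h_lim s l : has_diff (line a (p + s *: a) b) 0 l -> h s = l.
Proof.
move=> /u_cvg /cvgrP hl; rewrite /h.
have /cvg_limn_einf_sup[_ ->] // : (fun j => (u j s)%:E) @ \oo --> l%:E.
exact: cvg_EFin_seq hl.
Qed.

Let mu_ j : measurable_fun setT (EFin \o u j).
Proof. by apply/measurable_EFinP; exact: continuous_measurable_fun. Qed.

Let mh D : measurable D -> measurable_fun D (EFin \o h).
Proof.
move=> mD; apply/measurable_EFinP; apply: measurable_funTS.
apply: measurableT_comp; first exact: fine_measurable.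
by apply: measurable_fun_limn_esup => j; exact: mu_.
Qed.

Hypothesis Z0 : lam Z = 0%E.

Let Zgood s : ~ Z s -> exists l, has_diff (line a (p + s *: a) b) 0 l.
Proof. by move=> /contrapT /good_selfP. Qed.

Let mZ : measurable Z.
Proof. by apply: measurable_line_section; exact: vmeasurable_bad. Qed.

Let dct (a0 s : R) : a0 < s -> lam.-integrable (`[a0, s]%classic : set Rm) (EFin \o h) /\
  (\int[lam]_(x in (`[a0, s]%classic : set Rm)) (h x)%:E = (line b p a s - line b p a a0)%:E)%E.
Proof.
move=> as_.
have mD : measurable (`[a0, s]%classic : set Rm) by exact: measurable_itv.
have [|||||ih _ hc] := @dominated_convergence _ Rm R lam (`[a0, s]%classic : set Rm) mD
  (fun j => EFin \o u j) (EFin \o h) (cst (nrmv a * nrmv b)%:E).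
- by move=> j; apply: measurable_funTS; exact: mu_.
- exact: mh.
- exists Z; split=> // x /= H; apply: contrapT => Zx; apply: H => _.
  have [l hl] := Zgood Zx; rewrite (h_lim hl).
  by apply: cvg_EFin_seq; apply/cvgrP; exact: u_cvg.
- apply/integrableP; split; first exact: measurable_cst.
  rewrite (eq_integral (cst (nrmv a * nrmv b)%:E)); last first.
    by move=> x _; rewrite /= ger0_norm// mulr_ge0// nrmv_ge0.
  rewrite integral_cst//; apply: lte_mul_pinfty => //.
    by rewrite lee_fin mulr_ge0// nrmv_ge0.
  by have := lebesgue_measure_itv `[a0, s]; rewrite /= lte_fin as_ => ->; rewrite -EFinB ltry.
- by exists set0; split => // x /= H; apply: H => j _; rewrite lee_fin; exact: u_bound.
split=> //.
have hi j : (\int[lam]_(x in (`[a0, s]%classic : set Rm)) (u j x)%:E = (F j s - F j a0)%:E)%E.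
  apply: has_diff_integral => //.
have hF t : cvgr (fun j => F j t) (line b p a t).
  have := has_diff_seq (Phi_diff b (p + t *: a) 0).
  have -> : line b (p + t *: a) b 0 = line b p a t by rewrite /line scale0r addr0.
  congr cvgr; apply/funext => j; rewrite /F add0r scale0r addr0; congr (_ * (Phi _ - _)); vec_ring.
have hc' : (fun j => (F j s - F j a0)%:E) @ \oo --> (line b p a s - line b p a a0)%:E.
  by apply: cvg_EFin_seq; apply/cvgrP; apply: cvgrD => //; exact: cvgrN.
apply: (cvg_unique _ hc) => //=.
by under eq_fun do rewrite hi.
Qed.

Lemma mixed_ae : lam (line_section (bad a b b a) a p) = 0%E.
Proof.
have mB : measurable (line_section (bad a b b a) a p).
  by apply: measurable_line_section; exact: vmeasurable_bad.
have /choice [N hN] : forall n : nat, exists N : set Rm, [/\ measurable N, lam N = 0%E &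
  forall s, - n.+1%:R < s < n.+1%:R -> ~ N s -> has_diff (line b p a) s (h s)].
  move=> n; apply: int_ae_diff_itv; first by apply: (dct _).1; rewrite gtrN// ltr0n.
  by move=> s /andP[s1 _]; exact: (dct s1).2.
have mU : measurable (Z `|` \bigcup_n N n).
  by apply: measurableU => //; apply: bigcup_measurable => n _; have [] := hN n.
apply: (subset_measure0 mB mU); last first.
  apply: null_union => //; first by apply: bigcup_measurable => n _; have [] := hN n.
  apply: measure_negligible; first by apply: bigcup_measurable => n _; have [] := hN n.
  by apply: negligible_bigcup => n; have [mN N0 _] := hN n; exists (N n); split.
move=> s hs; apply: contrapT => /not_orP[Zs Ns]; apply: hs.
have [l hl] := Zgood Zs; apply/goodP; exists l; split => //.
rewrite -has_diff_line_shift -(h_lim hl).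
have [_ _ H] := hN (Num.bound `|s|); apply: H; last first.
  by move=> H; apply: Ns; exists (Num.bound `|s|).
rewrite -ltr_norml; apply: (lt_le_trans (archi_boundP (normr_ge0 s))).
by rewrite ler_nat.
Qed.

End Mixed.

End Rademacher.

(** * From directional derivatives to Jacobians on almost every point of a line *)

Section RademacherLine.
Variables (R : realType) (m : nat).
Local Notation Rm := (measurableTypeR R).
Local Notation lam := (@lebesgue_measure R).
Local Notation vec := 'cV[R]_m.
Implicit Types (a b p w : vec).

Lemma has_diffD (g g' : R -> R) s l l' : has_diff g s l -> has_diff g' s l' ->
  has_diff (fun t => g t + g' t) s (l + l').
Proof.
move=> h h'.
have := has_diff_comb 1 h (has_diff_comb (-1) h' (has_diff_comb 0 h' h')).
rewrite (_ : 1 * _ = l + l'); last by ring.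
congr (has_diff _ _ _); apply/funext => t; ring.
Qed.

Lemma has_diff_sum (I : Type) (r : seq I) (c : I -> R) (g : I -> R -> R) s l :
  (forall i, has_diff (g i) s (l i)) ->
  has_diff (fun t => \sum_(i <- r) c i * g i t) s (\sum_(i <- r) c i * l i).
Proof.
move=> h; elim: r => [|i r IH].
  rewrite big_nil => e e0; exists 1 => // t _; rewrite !big_nil subrr mul0r subrr normr0.
  by rewrite mulr_ge0// ltW.
rewrite big_cons; under eq_fun do rewrite big_cons.
suff h1 : has_diff (fun t => c i * g i t) s (c i * l i) by exact: (has_diffD h1 IH).
have := has_diff_affine (c i) 0 (h i).
by rewrite addr0; under eq_fun do rewrite mul0r addr0.
Qed.

Variables (Phi : vec -> R) (P : vec -> vec).
Hypothesis hsub : forall p p', dotv (P p) (p' - p) <= Phi p' - Phi p.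
Hypothesis hlip : forall p p', nrmv (P p - P p') <= nrmv (p - p').

Local Notation bad := (bad P).
Local Notation E i := (delta_mx i 0 : vec).

Lemma bad_self_ae a b p : lam (line_section (bad a b a b) b p) = 0%E.
Proof.
have [N [mN N0 hN]] := lip_ae_diff (line_lip hlip a p b).
have mB : measurable (line_section (bad a b a b) b p).
  by apply: measurable_line_section; exact: vmeasurable_bad.
apply: (subset_measure0 mB mN) => // s hs; apply: contrapT => /hN [l hl]; apply: hs.
apply/(good_selfP hlip); exists l; exact: (has_diff_line_shift P a p b s l).1 hl.
Qed.

(** Rational vectors keep the number of conditions countable. Each one pairs a coordinate direction
    with a rational direction and includes symmetry of the two derivatives. *)
Definition all_good p := forall (i : 'I_m) (c : 'cV[rat]_m), good P (E i) (rvec R c) (rvec R c) (E i) p.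

Lemma rvec_delta i : rvec R (delta_mx i 0) = E i.
Proof. by apply/matrixP => r s; rewrite /rvec !mxE ord1 /= rmorph_nat. Qed.

(** Symmetry supplies linearity: the derivative of <e_i, P> in direction c equals that of <c, P> in
    direction e_i, and the latter is linear in c. *)
Lemma all_good_dir p : all_good p -> exists V : 'M[R]_m, forall c (i : 'I_m),
  has_diff (line P (E i) p (rvec R c)) 0 ((V *m rvec R c) i 0).
Proof.
move=> hp.
have /choice [V hV] : forall ik : 'I_m * 'I_m, exists l : R,
    has_diff (line P (E ik.1) p (E ik.2)) 0 l /\ has_diff (line P (E ik.2) p (E ik.1)) 0 l.
  move=> [i k] /=; have := hp i (delta_mx k 0).
  by rewrite rvec_delta => /(goodP hlip).
exists (\matrix_(i, k) V (i, k)) => c i.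
have /(goodP hlip) [l [hl hl']] := hp i c.
suff -> : ((\matrix_(i, k) V (i, k)) *m rvec R c) i 0 = l by [].
rewrite mxE; apply: has_diff_uniq hl'.
have : has_diff (fun t => \sum_k rvec R c k 0 * line P (E k) p (E i) t) 0 (\sum_k rvec R c k 0 * V (i, k)).
  by apply: has_diff_sum => k; have [] := hV (i, k).
congr (has_diff _ _ _); last by apply: eq_bigr => k _; rewrite mulrC [in RHS]mxE.
apply/funext => t; rewrite /line [RHS]/dotv.
by apply: eq_bigr => k _; rewrite dotv_delta.
Qed.

(** If the expansion fails along some h_j -> 0, a subsequence of the unit vectors h_j / |h_j|
    converges. A rational vector near its limit replaces them, at a cost controlled by the Lipschitz
    bound on [P] and by the norm of V. *)
Lemma all_good_jacobian p : all_good p -> exists T, is_jacobian P p T.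
Proof.
move=> /all_good_dir [V hV]; exists V => e e0; apply: contrapT => H.
have [C C0 hC] := mulmx_bound V.
have /choice [h hh] : forall j : nat, exists h, nrmv h < j.+1%:R^-1 /\
    e * nrmv h < nrmv (P (p + h) - P p - V *m h).
  move=> j; apply: contrapT => nh; apply: H; exists j.+1%:R^-1; first by rewrite invr_gt0.
  by move=> h hj; rewrite leNgt; apply/negP => lt; apply: nh; exists h.
have h0 j : 0 < nrmv (h j).
  rewrite lt_neqAle nrmv_ge0 andbT eq_sym; apply/eqP => /nrmv_eq0 z.
  by have := (hh j).2; rewrite z nrmv0 mulr0 addr0 mulmx0 subrr subrr nrmv0 ltxx.
pose om j := (nrmv (h j))^-1 *: h j.
have omn j : nrmv (om j) = 1 by rewrite nrmvZ gtr0_norm ?invr_gt0// mulVf// gt_eqF.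
have hE j : h j = nrmv (h j) *: om j by rewrite scalerA mulfV ?scale1r// gt_eqF.
have [|s is_ [w hw]] := @bounded_cvgv_sub _ _ om 1; first by move=> j; rewrite omn.
(* Replacing the direction costs 2 de in [P] and 2 C de in V, together e / 2; the other half is left
   for the expansion along the rational vector. *)
pose de := e / (4 * (1 + C)).
have C1 : 0 < 1 + C by rewrite addr_gt0.
have de0 : 0 < de by rewrite divr_gt0// mulr_gt0.
have deE : e = 4 * (de + C * de).
  by rewrite /de; field; rewrite gt_eqF.
have [c hc] := rvec_approx w de0.
have e2 : 0 < e / 2 / m.+1%:R by rewrite !divr_gt0.
have /choice [d hd] : forall i : 'I_m, exists d, 0 < d /\ forall t, `|t| < d ->
    `|line P (E i) p (rvec R c) (0 + t) - line P (E i) p (rvec R c) 0 - (V *m rvec R c) i 0 * t| <= e / 2 / m.+1%:R * `|t|.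
  by move=> i; have [d d0 h'] := hV c i _ e2; exists d.
have [d' d'0 hd'] : exists2 d' : R, 0 < d' & forall i, d' <= d i.
  have : forall r : seq 'I_m, exists2 d' : R, 0 < d' & forall i, i \in r -> d' <= d i.
    elim=> [|i r [d' d'0 h']]; first by exists 1.
    exists (Num.min (d i) d'); first by rewrite lt_min d'0 (hd i).1.
    move=> k; rewrite inE => /orP[/eqP->|/h' le]; first by rewrite ge_min lexx.
    by rewrite ge_min le orbT.
  move=> /(_ (enum 'I_m)) [d' d'0 h']; exists d' => // i; apply: h'; exact: mem_enum.
have [N1 hN1] := hw _ de0; have [N2 hN2] := @cvgr_inv R _ d'0.
pose j := s (maxn N1 N2).
have om_c : nrmv (om j - rvec R c) <= 2 * de.
  apply: (le_trans (nrmv_tri w _ _)); have := hN1 _ (leq_maxl N1 N2); rewrite /= -/j.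
  move: hc; rewrite nrmvC; move: (nrmv (om j - w)) (nrmv _) => x y; clear; lra.
have [hj1 hj2] := hh j.
have tj : nrmv (h j) < d'.
  apply: lt_trans hj1 _; have := hN2 j (leq_trans (leq_maxr N1 N2) (incr_seq_ge is_ _)).
  by rewrite subr0 (ger0_norm (_ : 0 <= j.+1%:R^-1)) ?invr_ge0.
move: hj2; apply/negP; rewrite -leNgt.
pose t := nrmv (h j).
have -> : P (p + h j) - P p - V *m h j =
  (P (p + h j) - P (p + t *: rvec R c)) + (P (p + t *: rvec R c) - P p - V *m (t *: rvec R c))
   + V *m (t *: (rvec R c - om j)).
  rewrite {2}(hE j) -/t scalerBr mulmxBr; vec_ring.
have ge1 : nrmv (P (p + h j) - P (p + t *: rvec R c)) <= t * (2 * de).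
  apply: le_trans (hlip _ _) _; rewrite {1}(hE j) -/t.
  have -> : p + t *: om j - (p + t *: rvec R c) = t *: (om j - rvec R c) by vec_ring.
  by rewrite nrmvZ gtr0_norm ?h0// ler_wpM2l// nrmv_ge0.
have ge2 : nrmv (V *m (t *: (rvec R c - om j))) <= t * (2 * (C * de)).
  rewrite -scalemxAr nrmvZ gtr0_norm ?h0// ler_wpM2l ?nrmv_ge0//.
  apply: le_trans (hC _) _; rewrite nrmvC mulrCA ler_wpM2l// ltW//.
have ge3 : nrmv (P (p + t *: rvec R c) - P p - V *m (t *: rvec R c)) <= t * (e / 2).
  apply: (le_trans (nrmv_le_coord _)).
  apply: (@le_trans _ _ (\sum_(i < m) e / 2 / m.+1%:R * t)).
    apply: ler_sum => i _; have := (hd i).2 t; rewrite gtr0_norm ?h0// => /(_ (lt_le_trans tj (hd' i))).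
    rewrite /line !dotv_delta add0r scale0r addr0 -scalemxAr; congr (`|_| <= _).
    by rewrite !mxE [t * _]mulrC.
  rewrite sumr_const card_ord -[X in X <= _]mulr_natr.
  have -> : e / 2 / m.+1%:R * t * m%:R = t * (e / 2) * (m%:R / m.+1%:R) by ring.
  rewrite ger_pMr ?mulr_gt0 ?h0 ?divr_gt0//.
  by rewrite ler_pdivrMr// mul1r ler_nat.
apply: le_trans (nrmvD _ _) _; apply: le_trans (lerD (nrmvD _ _) ge2) _.
move: ge1 ge3; move: (nrmv _) (nrmv (_ - P p - _)) => x y; rewrite -/t.
have -> : e / 2 = 2 * (de + C * de) by rewrite deE; field.
rewrite deE; move: (C * de) => cd; clearbody t de => *; lra.
Qed.

(** The countable union of the bad sets is null, hence null on almost every line of direction [w];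
    since boxes are not null, such a line passes within [e] of [p]. *)
Lemma rademacher_line p w e : 0 < e -> exists2 p0, nrmv (p0 - p) < e & exists N : set Rm,
  [/\ measurable N, lam N = 0%E &
      forall s : R, ~ N s -> exists T, is_jacobian P (p0 + s *: w) T].
Proof.
move=> e0; have [null [null0 nullS nullU nullL nulld]] := null_ideal R m.
have selfN a b : null (bad a b a b).
  apply/(nullL _ b (vmeasurable_bad hlip _ _ _ _)).2.
  rewrite (_ : [set p | _] = set0)//; apply/seteqP; split=> // q /=.
  by rewrite bad_self_ae eqxx.
(* By [selfN], almost every line of direction [a] meets [bad a b a b] in a null set. On these lines
   [mixed_ae] applies, and nullity is read back from the same direction. *)
have mixN a b : null (bad a b b a).
  have mB := vmeasurable_bad hlip a b b a; have mS := vmeasurable_bad hlip a b a b.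
  have [mBl iB] := nullL _ a mB; have [mSl iS] := nullL _ a mS.
  apply/iB; apply: nullS (iS.1 (selfN a b)) => // q /=; apply: contraNN => /eqP q0.
  exact/eqP/(mixed_ae hsub hlip q0).
pose B (n : nat) : set vec := if unpickle n is Some (i, c) then bad (E i) (rvec R c) (rvec R c) (E i) else set0.
have mB n : vmeasurable (B n).
  rewrite /B; case: unpickle => [[i c]|]; first exact: vmeasurable_bad.
  by rewrite /vmeasurable preimage_set0; exact: measurable0.
have mU : vmeasurable (\bigcup_n B n).
  by rewrite /vmeasurable preimage_bigcup; apply: bigcup_measurable => n _; exact: mB.
have nU : null (\bigcup_n B n).
  by apply: nullU => // n; rewrite /B; case: unpickle => [[i c]|].
have [mL iL] := nullL _ w mU.
have [p0 hp0 np0] := nulld _ mL (iL.1 nU) p e e0.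
exists p0 => //; exists (line_section (\bigcup_n B n) w p0); split.
- exact: measurable_line_section.
- by apply/eqP; move/negP: np0; rewrite negbK.
move=> s hs; apply: all_good_jacobian => i c; apply: contrapT => bd; apply: hs.
by exists (pickle (i, c)) => //=; rewrite /B pickleK.
Qed.

End RademacherLine.

(** * Jacobians realising a second subderivative *)

Section Curvature.
Variables (R : realType) (m : nat).
Local Notation vec := 'cV[R]_m.
Implicit Types (x y z u v w h p q : vec).

Section Envelope.
Variable f : vec -> \bar R.
Hypothesis hf : closed_convex f.
Local Notation P := (Prox f).

Definition moreau p := fine (f (P p)) + dotv (p - P p) (p - P p) / 2.

Lemma moreau_sub p p' : dotv (p - P p) (p' - p) <= moreau p' - moreau p.
Proof.
rewrite /moreau; have := subdiff_le2 (Prox_subdiff hf p) (Prox_subdiff hf p').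
have -> : p' - p = ((p' - P p') - (p - P p)) + (P p' - P p).
  by move: (P p) (P p') => q q'; vec_ring.
move: (p - P p) (p' - P p') => a b; have := dotv_ge0 (b - a).
rewrite [dotv a (b - a + _)]dotvDr; move: (dotv a (P p' - P p)) => X.
rewrite !dotvE (dotvC b a); move: (fine _) (fine _) (dotv a b) (dotv a a) (dotv b b) => A B C D E.
clear; lra.
Qed.

Lemma moreau_le p r : (f p <= r%:E)%E -> moreau p <= r.
Proof.
move=> le; have pf : f p = (fine (f p))%:E.
  apply: domE; first by case: hf.
  by apply: le_lt_trans le _; exact: ltry.
move: le; rewrite pf lee_fin; apply: le_trans.
rewrite /moreau; have := subdiff_le (Prox_subdiff hf p) pf; have := dotv_ge0 (p - P p).
move: (dotv _ _) (fine _) (fine _) => A B C; clear; lra.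
Qed.

Lemma has_diff_jacobian p v s T : is_jacobian P (p + s *: v) T ->
  has_diff (fun t => dotv v (p + t *: v - P (p + t *: v))) s (dotv v (v - T *m v)).
Proof.
move=> h e e0; pose c := (nrmv v + 1) * (nrmv v + 1).
have n0 : 0 <= nrmv v by exact: nrmv_ge0.
have n1 : 0 < nrmv v + 1 by rewrite ltr_wpDl.
have c0 : 0 < c by rewrite mulr_gt0.
have [|d d0 hd] := h (e / c); first by rewrite divr_gt0.
exists (d / (nrmv v + 1)); first by rewrite divr_gt0.
move=> t; rewrite ltr_pdivlMr// => td.
have /hd : nrmv (t *: v) < d.
  by rewrite nrmvZ; apply: le_lt_trans td; rewrite ler_wpM2l// lerDl.
have E1 : p + s *: v + t *: v = p + (s + t) *: v by vec_ring.
rewrite E1 => le.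
have -> : dotv v (p + (s + t) *: v - P (p + (s + t) *: v)) - dotv v (p + s *: v - P (p + s *: v)) -
    dotv v (v - T *m v) * t = - dotv v (P (p + (s + t) *: v) - P (p + s *: v) - T *m (t *: v)).
  rewrite -scalemxAr; move: (P _) (P _) (T *m v) => a b r; rewrite !dotvE; ring.
rewrite normrN; apply: le_trans (CauchySchwarz_abs _ _) _.
apply: (@le_trans _ _ (nrmv v * (e / c * nrmv (t *: v)))); first by rewrite ler_wpM2l.
rewrite nrmvZ.
have -> : nrmv v * (e / c * (`|t| * nrmv v)) = e * `|t| * (nrmv v * nrmv v / c) by ring.
rewrite ler_piMr ?mulr_ge0 ?(ltW e0)// ler_pdivrMr// mul1r ler_pM// lerDl//.
Qed.

(** Were the curvature above c + e almost everywhere on a line close to [x, x + t v], integrating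
    twice would make the envelope at its far end exceed the bound c t^2 / 2 inherited from [f]. *)
Lemma moreau_curvature x v t c e r : P x = x -> f x = 0%E -> (forall y, (0 <= f y)%E) ->
  0 < t -> (f (x + t *: v) <= (c * (t ^+ 2 / 2))%:E)%E -> 0 < e -> 0 < r ->
  exists p T, [/\ nrmv (p - x) < r + t * nrmv v, is_jacobian P p T & dotv v (v - T *m v) <= c + e].
Proof.
move=> Px fx f0 t0 ft e0 r0.
have n0 : 0 <= nrmv v by exact: nrmv_ge0.
(* Displacing the line by at most d costs d^2 + 2 d t |v|, which is strictly less than d K when 0 <
   d <= 1. *)
pose K := 2 + 3 * t * nrmv v.
have K0 : 0 < K by rewrite ltr_pwDl// !mulr_ge0// ltW.
have t2 : 0 < t ^+ 2 by rewrite exprn_gt0.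
have b0 : 0 < e * (t ^+ 2 / 2) / K by rewrite divr_gt0// mulr_gt0// divr_gt0.
pose d := Num.min (Num.min r 1) (e * (t ^+ 2 / 2) / K).
have d0 : 0 < d by rewrite !lt_min r0 ltr01.
have [p0 hp0 [N [mN N0 hN]]] := rademacher_line (prox_potential_sub hf) (Prox_lip hf) x v d0.
pose g s := dotv v (p0 + s *: v - P (p0 + s *: v)).
have gL s s' : `|g s - g s'| <= nrmv v * nrmv v * `|s - s'|.
  rewrite /g -dotvNr -dotvDr; apply: le_trans (CauchySchwarz_abs _ _) _.
  rewrite -mulrA ler_wpM2l//; apply: le_trans (Prox_colip hf _ _) _.
  have -> : p0 + s *: v - (p0 + s' *: v) = (s - s') *: v by vec_ring.
  by rewrite nrmvZ mulrC.
suff [s [st Ns [l hl lc]]] : exists s, [/\ 0 < s < t, ~ N s & exists2 l, has_diff g s l & l <= c + e].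
  have [T hT] := hN s Ns; exists (p0 + s *: v), T; split=> //.
    have -> : p0 + s *: v - x = (p0 - x) + s *: v by vec_ring.
    apply: le_lt_trans (nrmvD _ _) _; rewrite nrmvZ; move/andP: st => [s0 st].
    rewrite gtr0_norm// ltr_leD//; last by rewrite ler_wpM2r// ltW.
    by apply: lt_le_trans hp0 _; rewrite /d !ge_min lexx.
  by have := has_diff_uniq (has_diff_jacobian hT) hl => ->.
apply: contrapT => H.
(* By the negated claim every derivative of [g] off [N] exceeds c + e. *)
have gi s : 0 <= s <= t -> g 0 + (c + e) * s <= g s.
  move=> /andP[]; rewrite le_eqVlt => /orP[/eqP<- _|s0 st]; first by rewrite mulr0 addr0.
  have [|le] := @pselect ((c + e) * (s - 0) <= g s - g 0); first by rewrite subr0 lerBrDl.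
  exfalso; apply: le; apply: (lip_increment_ge gL s0 mN N0).
  move=> s' /andP[s'0 s's] Ns l hl; rewrite leNgt; apply/negP => lc; apply: H.
  by exists s'; split; [rewrite s'0 (lt_le_trans s's st)|by []|exists l => //; exact: ltW].
have F0 : 0 <= moreau p0.
  rewrite /moreau addr_ge0 ?divr_ge0 ?dotv_ge0//.
  by rewrite fine_ge0.
pose q := p0 + t *: v.
have Fq : moreau p0 + t * g 0 + (c + e) * t ^+ 2 / 2 <= moreau q.
  (* The segment is run backwards, from [q] to [p0], because [riemann_ub] gives upper bounds. *)
  pose ph s := moreau (p0 + (t * (1 - s)) *: v); pose k s := - (t * g (t * (1 - s))).
  have h1 s s' : 0 <= s -> s <= s' -> s' <= 1 -> ph s' - ph s <= k s' * (s' - s).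
    move=> _ _ _; have := moreau_sub (p0 + (t * (1 - s')) *: v) (p0 + (t * (1 - s)) *: v).
    have -> : p0 + (t * (1 - s)) *: v - (p0 + (t * (1 - s')) *: v) = (t * (s' - s)) *: v.
      by clear; vec_ring.
    rewrite dotvZr dotvC -/(g _) -/(ph s) -/(ph s') mulrAC /k.
    by rewrite mulNr => h; rewrite -opprB lerN2.
  have h2 s : 0 <= s <= 1 -> k s <= - (t * g 0) - (c + e) * t ^+ 2 + (c + e) * t ^+ 2 * s + 0.
    move=> /andP[s0 s1].
    have : 0 <= t * (1 - s) <= t.
      by rewrite mulr_ge0 ?subr_ge0 ?(ltW t0)//= ler_piMr ?(ltW t0)// gerBl.
    move=> /gi; rewrite /k -(ler_pM2l t0).
    move: (g _) (g 0) => A B; clear; lra.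
  have := riemann_ub h1 h2.
  have -> : ph 1 = moreau p0 by congr moreau; rewrite subrr mulr0 scale0r addr0.
  have -> : ph 0 = moreau q by congr moreau; rewrite subr0 mulr1.
  move: (moreau p0) (moreau q) (g 0) => A B G; clear; lra.
have g0 : - (nrmv v * d) <= g 0.
  rewrite lerNl; apply: le_trans (ler_norm _) _; rewrite normrN /g scale0r addr0.
  apply: le_trans (CauchySchwarz_abs _ _) _; rewrite ler_wpM2l//.
  have := Prox_colip hf p0 x; rewrite Px subrr subr0 => /le_trans; apply; exact: ltW.
have Fx : moreau q <= c * (t ^+ 2 / 2) + (d + t * nrmv v) * d.
  have := moreau_le ft; have := moreau_sub q (x + t *: v).
  have -> : x + t *: v - q = - (p0 - x) by rewrite /q; vec_ring.
  have : dotv (q - P q) (p0 - x) <= (d + t * nrmv v) * d.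
    apply: le_trans (CauchySchwarz _ _) _; apply: ler_pM; rewrite ?nrmv_ge0//; last exact: ltW.
    have := Prox_colip hf q x; rewrite Px subrr subr0 => /le_trans; apply.
    have -> : q - x = (p0 - x) + t *: v by rewrite /q; vec_ring.
    by apply: le_trans (nrmvD _ _) _; rewrite nrmvZ (gtr0_norm t0) lerD2r ltW.
  rewrite dotvNr; move: (dotv _ _) (moreau _) (moreau _) (_ * d) (c * _) => A B C D E; clear; lra.
have d1 : d <= 1 by rewrite /d !ge_min lexx orbT.
have dK : d * K <= e * (t ^+ 2 / 2) by rewrite -ler_pdivlMr// /d ge_min lexx orbT.
have dd : d * d <= d by rewrite ler_piMr// ltW.
have gt : t * - (nrmv v * d) <= t * g 0 by rewrite ler_pM2l.
have C0 : 0 <= t * (nrmv v * d) by rewrite !mulr_ge0// ltW.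
move: F0 Fq Fx dK dd gt d0 C0; rewrite /K.
have -> : d * (2 + 3 * t * nrmv v) = 2 * d + 3 * (t * (nrmv v * d)) by ring.
have -> : (d + t * nrmv v) * d = d * d + t * (nrmv v * d) by ring.
rewrite mulrN -(mulrA (c + e)) mulrDl.
clearbody d.
move: (moreau p0) (moreau q) (t * (nrmv v * d)) (t * g 0) (d * d) => A B C D E.
move: (c * (t ^+ 2 / 2)) (e * (t ^+ 2 / 2)) => X Y.
clear; lra.
Qed.

End Envelope.

Lemma unitmx_coercive (A : 'M[R]_m) (c : R) : 0 < c ->
  (forall h, c * dotv h h <= dotv h (A *m h)) -> A \in unitmx.
Proof.
move=> c0 hA; rewrite -unitmx_tr unitmxE unitfE; apply/det0P => -[v v0 vA].
have Av : A *m v^T = 0 by rewrite -[A]trmxK -trmx_mul vA trmx0.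
have := hA v^T; rewrite Av dotv0r pmulr_rle0// => le.
have /dotv_eq0 /(congr1 trmx) : dotv v^T v^T = 0 by apply/le_anti; rewrite le dotv_ge0.
by rewrite trmxK trmx0 => vz; rewrite vz eqxx in v0.
Qed.

Section Transfer.
Variables (f : vec -> \bar R) (x u : vec) (l : R).
Hypotheses (hf : closed_convex f) (hu : subdiff f x u) (l0 : 0 < l) (l1 : l <= 1).
Local Notation P := (Prox f).
Local Notation J := (Prox (tilt f x u l)).

Lemma tilt_subdiff q g : subdiff f q (u + l^-1 *: g) -> subdiff (tilt f x u l) q g.
Proof.
move=> hg; have fq := subdiff_dom hg; split; first by rewrite (tiltE _ _ _ fq).
move=> y; have [fy|fy] := eqVneq (f y) +oo%E; first by rewrite (tilty _ _ l0 fy) leey.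
have fy' : f y = (fine (f y))%:E.
  by apply: domE; [case: hf|rewrite ltey].
rewrite (tiltE _ _ _ fq) (tiltE _ _ _ fy') -EFinD lee_fin.
have := ler_wpM2l (ltW l0) (subdiff_le hg fy').
have [d dE] : exists d, d = y - q by exists (y - q).
have -> : y - x = d + (q - x) by rewrite dE; vec_ring.
rewrite -dE (dotvDl u) dotvZl (dotvDr d).
have lK : l * (l^-1 * dotv g d) = dotv g d by rewrite mulrA mulfV ?mul1r// gt_eqF.
rewrite !(mulrDr l) lK; move: (dotv g d) (dotv u d) (dotv u (q - x)) => A B C.
move: (fine _) (fine _) (fine _) => D E F; lra.
Qed.

(* [y |-> (1 - l) P y + l (y - u)] inverts the map [p |-> J p + u + (p - J p) / l] and is
   Lipschitz, so that a Jacobian of [J] transfers to [P]. *)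
Lemma Prox_tilt_inv y : J ((1 - l) *: P y + l *: (y - u)) = P y.
Proof.
have h : subdiff (tilt f x u l) (P y) (l *: (y - P y - u)).
  apply: tilt_subdiff; rewrite scalerA mulVf ?gt_eqF// scale1r addrC subrK.
  exact: Prox_subdiff.
have -> : (1 - l) *: P y + l *: (y - u) = P y + l *: (y - P y - u).
  by move: (P y) => q; vec_ring.
by rewrite (subdiff_Prox (closed_convex_tilt hf hu l0) h).
Qed.

Lemma Prox_tilt_jacobian p T (y := J p + u + l^-1 *: (p - J p)) : is_jacobian J p T ->
  exists2 V, is_jacobian P y V & forall v, exists2 z, V *m z = T *m v & z = T *m v + l^-1 *: (v - T *m v).
Proof.
move=> hT; have hft := closed_convex_tilt hf hu l0.
(* [B] is the derivative of the map p -> J p + u + (p - J p) / l. Firm nonexpansiveness of T and l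
   <= 1 give <h, B h> >= |h|^2, so [B] is invertible and T B^-1 is the candidate suggested by the
   chain rule. *)
pose B := T + l^-1 *: (1%:M - T).
have BE h : B *m h = T *m h + l^-1 *: (h - T *m h).
  by rewrite mulmxDl -scalemxAl mulmxBl mul1mx.
have uB : B \in unitmx.
  apply: (@unitmx_coercive _ 1) => // h; rewrite mul1r BE.
  have := prox_jacobian_firm hft h hT.
  have := dotv_ge0 (h - T *m h); rewrite !dotvE (dotvC (T *m h) h).
  have : 1 <= l^-1 by rewrite invf_ge1.
  move: (l^-1) (dotv h h) (dotv (T *m h) (T *m h)) (dotv h (T *m h)) => k a b c h1 h2 h3.
  have : 0 <= (k - 1) * (a - c) by apply: mulr_ge0; lra.
  rewrite mulrBl mul1r; move: (k * (a - c)) => X; lra.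
have Py : P y = J p.
  by have := subdiff_Prox hf (Prox_tilt hf hu l0 p); rewrite addrA.
have X0 : (1 - l) *: P y + l *: (y - u) = p.
  rewrite Py /y; move: (J p) => q; apply/matrixP => i j; rewrite !mxE; field; by rewrite (gt_eqF l0).
exists (T *m invmx B); last first.
  by move=> v; exists (B *m v); [rewrite -mulmxA mulKmx|exact: BE].
move=> e e0; have [C C0 hC] := mulmx_bound (T *m invmx B).
pose M := 1 + C * l^-1.
have li : 0 < l^-1 by rewrite invr_gt0.
have M0 : 0 < M by rewrite addr_gt0// mulr_gt0.
have [|d d0 hd] := hT (e / M); first by rewrite divr_gt0.
exists d => // h hh; pose dP := P (y + h) - P y.
pose k := l *: h + (1 - l) *: dP.
have dPh : nrmv dP <= nrmv h.
  have := Prox_lip hf (y + h) y; have -> : y + h - y = h by rewrite addrAC subrr add0r.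
  exact.
have kh : nrmv k <= nrmv h.
  apply: le_trans (nrmvD _ _) _; rewrite !nrmvZ gtr0_norm// ger0_norm ?subr_ge0//.
  have := ler_wpM2l (_ : 0 <= 1 - l) dPh; rewrite subr_ge0 => /(_ l1).
  move: (nrmv h) ((1 - l) * _) => a b; lra.
(* As P (y + h) = J (p + k), this is the linearisation error of [J] at [p]. Solving B k = h + (1/l -
   1) r for k expresses the error of T B^-1 through [r], with total factor at most [M]. *)
pose r := dP - T *m k.
have rle : nrmv r <= e / M * nrmv h.
  apply: le_trans (_ : e / M * nrmv k <= _); last by apply: ler_wpM2l kh; rewrite divr_ge0 // ltW.
  have pk : p + k = (1 - l) *: P (y + h) + l *: (y + h - u).
    rewrite -{1}X0 /k /dP; move: (P (y + h)) (P y) => a b; vec_ring.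
  by have := hd k (le_lt_trans kh hh); rewrite pk Prox_tilt_inv -Py.
have step (h' a b : vec) : a - b + l^-1 *: (l *: h' + (1 - l) *: a - (a - b)) =
    h' + (l^-1 * (1 - l)) *: b.
  by apply/matrixP => i j; rewrite !mxE; field; by rewrite (gt_eqF l0).
have kE : B *m k = h + (l^-1 * (1 - l)) *: r.
  rewrite BE; have -> : T *m k = dP - r by rewrite /r opprB addrC subrK.
  exact: step.
have -> : P (y + h) - P y - T *m invmx B *m h = r + (l^-1 * (1 - l)) *: (T *m invmx B *m r).
  have W : T *m invmx B *m h = T *m k - (l^-1 * (1 - l)) *: (T *m invmx B *m r).
    have -> : h = B *m k - (l^-1 * (1 - l)) *: r by rewrite kE addrK.
    by rewrite mulmxBr -[T *m _ *m (B *m k)]mulmxA mulKmx// -scalemxAr.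
  have fin (a b c : vec) : a - (b - c) = a - b + c by rewrite opprB addrCA addrC.
  rewrite W; exact: fin.
apply: le_trans (nrmvD _ _) _.
have ln : `|l^-1 * (1 - l)| <= l^-1.
  by rewrite normrM (gtr0_norm li) ger0_norm ?subr_ge0// ler_piMr// ?(ltW li)// gerBl ltW.
have le1 : nrmv ((l^-1 * (1 - l)) *: (T *m invmx B *m r)) <= l^-1 * (C * nrmv r).
  by rewrite nrmvZ ler_pM ?nrmv_ge0.
apply: le_trans (lerD (lexx _) le1) _.
have -> : nrmv r + l^-1 * (C * nrmv r) = M * nrmv r by rewrite /M; ring.
by rewrite mulrC -ler_pdivlMr// mulrAC.
Qed.

End Transfer.

Lemma subderiv2_ge_jacobian f x u v c e : closed_convex f -> subdiff f x u ->
  (subderiv2 f x u v <= c%:E)%E -> 0 < e ->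
  exists y V z, [/\ nrmv (y - (x + u)) < e, is_jacobian (Prox f) y V,
    nrmv (V *m z - v) < e & dotv (z - V *m z) (V *m z) <= c + e].
Proof.
move=> hf hu hc e0.
have c0 : 0 <= c by rewrite -lee_fin; apply: le_trans (subderiv2_ge0 v hu) hc.
have ce : 0 < c + e by rewrite ltr_wpDl.
have n1 : 0 < nrmv v + 1 by rewrite ltr_wpDl// nrmv_ge0.
(* This gives l (c + e) < (e / 2)^2, which bounds |T v' - v'|^2. *)
pose l := Num.min 1 (e / 2 * (e / 2) / (c + e) / 2).
have l0 : 0 < l by rewrite lt_min ltr01 !divr_gt0// mulr_gt0// divr_gt0.
have l1 : l <= 1 by rewrite ge_min lexx.
have lce : l * (c + e) < e / 2 * (e / 2).
  apply: (@le_lt_trans _ _ (e / 2 * (e / 2) / 2)); last first.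
    by rewrite ltr_pdivrMr// ltr_pMr ?ltr1n// mulr_gt0// divr_gt0.
  by rewrite -ler_pdivlMr// mulrAC ge_min lexx orbT.
(* The distance from the final point to x + u is at most (1 + 1/l) |p - x|, so [p] must be within
   [b] of [x]: half for the displacement of the line, half for t |v'| <= eta (|v| + 1). *)
pose b := e / (1 + l^-1).
have li : 0 < 1 + l^-1 by rewrite addr_gt0// invr_gt0.
have b0 : 0 < b by rewrite divr_gt0.
pose eta := Num.min (Num.min (e / 2) 1) (b / 2 / (nrmv v + 1)).
have eta0 : 0 < eta by rewrite !lt_min ltr01 !divr_gt0.
have [t [v' [/andP[t0 te] v'v le]]] := (subderiv2_leP v c hu).1 hc _ eta0.
have ee : eta <= e / 2 by rewrite !ge_min lexx.
have e1 : eta <= 1 by rewrite !ge_min lexx orbT.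
have eb : eta * (nrmv v + 1) <= b / 2 by rewrite -ler_pdivlMr// ge_min lexx orbT.
have fxt : f (x + t *: v') = (fine (f (x + t *: v')))%:E.
  by apply: domE; [case: hf|apply: le_lt_trans le _; rewrite ltry].
have hft := closed_convex_tilt hf hu l0.
have tle : (tilt f x u l (x + t *: v') <= (l * (c + eta) * (t ^+ 2 / 2))%:E)%E.
  move: le; rewrite (tiltE _ _ _ fxt) fxt !lee_fin -mulrA ler_pM2l//.
  have -> : x + t *: v' - x = t *: v' by rewrite addrC addKr.
  rewrite dotvZr /=; move: (fine (f x)) (fine _) (t * dotv _ _) ((c + eta) * _) => A B C D; clear; lra.
have [|||||||p [T [pp hT hTv]]] := @moreau_curvature _ hft x v' t (l * (c + eta)) (l * eta) (b / 2).
- exact: Prox_tilt_self.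
- exact: tilt_self.
- by move=> y; exact: tilt_ge0.
- by [].
- by [].
- by rewrite mulr_gt0.
- by rewrite divr_gt0.
have [V hV /(_ v') [z Vz zE]] := Prox_tilt_jacobian hf hu l0 l1 hT.
have firm := prox_jacobian_firm hft v' hT.
have q1 : dotv v' (v' - T *m v') <= l * (c + e).
  apply: le_trans hTv _; rewrite -mulrDr ler_pM2l//.
  by move: ee e0; clear; move: eta => a; lra.
have px : nrmv (p - x) < b.
  apply: lt_le_trans pp _; rewrite [X in _ <= X](splitr b) lerD2l; apply: le_trans eb.
  apply: ler_pM; rewrite ?nrmv_ge0 ?(ltW t0) ?(ltW te)//.
  apply: le_trans (nrmv_subl v' v) _; rewrite addrC lerD2l; apply: le_trans (ltW v'v) e1.
pose q := Prox (tilt f x u l) p.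
exists (q + u + l^-1 *: (p - q)), V, z; split => //; first 1 last.
- rewrite Vz; suff : nrmv (T *m v' - v') ^+ 2 < (e / 2) ^+ 2.
    rewrite ltr_pXn2r ?nnegrE ?nrmv_ge0 ?divr_ge0 ?ltW// => n2.
    apply: le_lt_trans (nrmv_tri v' _ _) _; rewrite [X in _ < X]splitr ltr_leD//.
    exact: ltW (lt_le_trans v'v ee).
  rewrite sqr_nrmv expr2; apply: le_lt_trans lce; apply: le_trans q1.
  move: firm; rewrite !dotvE (dotvC (T *m v') v').
  move: (dotv _ _) (dotv _ _) (dotv _ _) => X Y Z; lra.
- rewrite Vz zE addrC addKr dotvZl -(ler_pM2l l0) mulrA mulfV ?gt_eqF// mul1r.
  apply: le_trans q1; have := dotv_ge0 (v' - T *m v'); rewrite !dotvE (dotvC (T *m v') v').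
  move: (dotv _ _) (dotv _ _) (dotv _ _) => X Y Z; lra.
- have := Prox_colip (closed_convex_tilt hf hu l0) p x.
  have := Prox_lip (closed_convex_tilt hf hu l0) p x.
  rewrite (Prox_tilt_self hf hu l0) subrr subr0.
  rewrite -/q => h1 h2.
  have -> : q + u + l^-1 *: (p - q) - (x + u) = (q - x) + l^-1 *: (p - q) by vec_ring.
  apply: le_lt_trans (nrmvD _ _) _; rewrite nrmvZ gtr0_norm ?invr_gt0//.
  apply: (@le_lt_trans _ _ (nrmv (p - x) * (1 + l^-1))); last by rewrite -ltr_pdivlMr.
  rewrite mulrDr mulr1 lerD// mulrC ler_wpM2r// invr_ge0 ltW//.
Qed.

End Curvature.

(** * Limits of Jacobians and the minimum over the coderivative *)

Section LimitJacobian.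
Variables (R : realType) (m : nat).
Local Notation vec := 'cV[R]_m.
Implicit Types (x y z u v w h p q : vec).

(** On the kernel of V the bound is linear in [h], hence forces [v] to be orthogonal to it; for
    symmetric V this means that [v] lies in the range. *)
Lemma sym_range (V : 'M[R]_m) v (C : R) : V^T = V ->
  (forall h, 2 * dotv v h - dotv h (V *m h) <= C) -> exists z, v = V *m z.
Proof.
move=> sV hV.
have ort h : V *m h = 0 -> dotv v h = 0.
  move=> Vh; apply: contrapT => /eqP n0.
  have := hV ((C + 1) / (2 * dotv v h) *: h).
  rewrite -scalemxAr Vh scaler0 dotv0r subr0 dotvZr.
  have -> : 2 * ((C + 1) / (2 * dotv v h) * dotv v h) = C + 1 by field.
  by rewrite gerDl ler10.
have : (v^T <= V)%MS.
  rewrite submxE; apply/eqP/matrixP => i j; rewrite ord1 !mxE.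
  have /ort o : V *m col j (cokermx V) = 0 by rewrite colE mulmxA mulmx_coker mul0mx.
  by rewrite -[RHS]o; apply: eq_bigr => k _; rewrite !mxE.
move=> /submxP [D DV]; exists D^T.
by rewrite -[v]trmxK DV trmx_mul sV.
Qed.

Section Fun.
Variable f : vec -> \bar R.
Hypothesis hf : closed_convex f.
Local Notation P := (Prox f).

Lemma prox_jacobian_le1 y V i j : is_jacobian P y V -> `|V i j| <= 1.
Proof.
move=> hV; have := prox_jacobian_firm hf (delta_mx j 0) hV.
have := CauchySchwarz (V *m delta_mx j 0) (delta_mx j 0).
have d1 : nrmv (delta_mx j 0 : vec) = 1.
  by rewrite /nrmv dotv_delta mxE !eqxx sqrtr1.
rewrite d1 mulr1 -sqr_nrmv => h1 h2.
have h3 : nrmv (V *m delta_mx j 0) <= 1.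
  rewrite leNgt; apply/negP => lt; have := le_trans h2 h1; apply/negP; rewrite -ltNge.
  by rewrite expr2 ltr_pMr// (lt_trans ltr01).
by apply: le_trans h3; apply: le_trans (le_coord_nrmv _ i); rewrite -colE mxE.
Qed.

Lemma limit_jacobian x u v (xk uk vk : nat -> vec) (ck : nat -> R) c :
  (forall k, subdiff f (xk k) (uk k)) -> cvgv xk x -> cvgv uk u -> cvgv vk v -> cvgr ck c ->
  (forall k, (subderiv2 f (xk k) (uk k) (vk k) <= (ck k)%:E)%E) ->
  exists V z, [/\ B_subdiff P (x + u) V, v = V *m z & dotv (z - v) v <= c].
Proof.
move=> hs hx hu hv hc hd.
have /choice [F hF] : forall k, exists yVz : vec * 'M[R]_m * vec,
    let: (y, V, z) := yVz in [/\ nrmv (y - (xk k + uk k)) < k.+1%:R^-1, is_jacobian P y V,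
    nrmv (V *m z - vk k) < k.+1%:R^-1 & dotv (z - V *m z) (V *m z) <= ck k + k.+1%:R^-1].
  move=> k; have [|y [V [z H]]] := subderiv2_ge_jacobian hf (hs k) (hd k) (e := k.+1%:R^-1).
    by rewrite invr_gt0.
  by exists (y, V, z).
pose yk k := (F k).1.1; pose Vk k := (F k).1.2; pose zk k := (F k).2.
have {}hF k : [/\ nrmv (yk k - (xk k + uk k)) < k.+1%:R^-1, is_jacobian P (yk k) (Vk k),
    nrmv (Vk k *m zk k - vk k) < k.+1%:R^-1 &
    dotv (zk k - Vk k *m zk k) (Vk k *m zk k) <= ck k + k.+1%:R^-1].
  by have := hF k; rewrite /yk /Vk /zk; case: (F k) => -[].
have [|s is_ [V hV]] := @bounded_cvgm_sub R m m Vk 1.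
  by move=> k i j; have [_ h _ _] := hF k; exact: prox_jacobian_le1 h.
have tail n (a b : nat -> 'cV[R]_n) l : cvgv a l -> (forall k, nrmv (b k - a k) < k.+1%:R^-1) -> cvgv b l.
  move=> ha hb; have -> : b = (fun k => (b k - a k) + a k) by apply/funext => k; rewrite subrK.
  rewrite -[l]add0r; apply: cvgvD => //; apply: cvgv_squeeze (@cvgr_inv R) _.
  by move=> k; rewrite subr0 ltW.
have hy : cvgv yk (x + u).
  by apply: tail (cvgvD hx hu) _ => k; have [] := hF k.
have hw : cvgv (fun k => Vk k *m zk k) v.
  by apply: tail hv _ => k; have [] := hF k.
have sV : V^T = V.
  apply/matrixP => i j; rewrite mxE.
  have h1 : cvgr (fun k => (Vk \o s) k i j) (V j i).
    have := hV j i; congr cvgr; apply/funext => k /=.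
    have [_ jk _ _] := hF (s k).
    by rewrite -{1}(prox_jacobian_sym hf jk) mxE.
  exact: cvgr_uniq h1 (hV i j).
(* Positive semidefiniteness of the k-th Jacobian at z_k - h, followed by the limit. *)
have ineq h : 2 * dotv v h - dotv h (V *m h) <= c + dotv v v.
  have H k : 2 * dotv (Vk k *m zk k) h - dotv h (Vk k *m h) <=
      ck k + k.+1%:R^-1 + dotv (Vk k *m zk k) (Vk k *m zk k).
    have [_ jk _ le] := hF k; have := prox_jacobian_firm hf (zk k - h) jk.
    have := dotv_ge0 (Vk k *m (zk k - h)).
    have sy : dotv (Vk k *m h) (zk k) = dotv h (Vk k *m zk k).
      by rewrite dotv_mulmxl (prox_jacobian_sym hf jk).
    move: le; rewrite mulmxBr; rewrite !dotvE sy (dotvC (Vk k *m h) h) (dotvC h (Vk k *m zk k)).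
    rewrite (dotvC (Vk k *m zk k) (zk k)).
    move: (dotv (Vk k *m zk k) h) (dotv h _) (dotv (zk k) _) (dotv (Vk k *m zk k) (Vk k *m zk k)).
    move: (k.+1%:R^-1) (ck k) => a b A B C D.
    move: (dotv _ _) (dotv _ _) (dotv _ _) => G H I; clear; lra.
  have l1 := cvgr_sub is_ (cvgv_dotv hw (@cvgv_cst R m h)).
  have l2 := cvgv_dotv (@cvgv_cst R m h) (cvgm_mulmx hV (@cvgv_cst R m h)).
  have l3 := cvgr_sub is_ (cvgrD (cvgrD hc (@cvgr_inv R)) (cvgv_dotv hw hw)).
  rewrite -[c]addr0; apply: cvgr_le (cvgrD (cvgrM (@cvgr_cst R 2) l1) (cvgrN l2)) l3 _.
  by move=> k; exact: H (s k).
have [z vz] := sym_range sV ineq.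
exists V, z; split=> //.
  exists (yk \o s), (Vk \o s); split; first by move=> k; have [] := hF (s k).
  by split=> //; exact: cvgv_sub.
have := ineq z; rewrite -vz dotvDl dotvNl (dotvC z v).
move: (dotv _ _) (dotv _ _) => A B; clear; lra.
Qed.

Lemma coderiv_jacobian x u v w : coderiv (subdiff f) x u v w ->
  exists V z, [/\ B_subdiff P (x + u) V, v = V *m z & dotv (z - v) v <= dotv w v].
Proof.
move=> [pk [nk [hp [cp [cn hn]]]]].
pose xk k := usubmx (pk k); pose uk k := dsubmx (pk k).
pose wk k := usubmx (nk k); pose dk k := dsubmx (nk k).
have pE k : pk k = col_mx (xk k) (uk k) by rewrite vsubmxK.
have nE k : nk k = col_mx (wk k) (dk k) by rewrite vsubmxK.
have [cx cu] : cvgv xk x /\ cvgv uk u.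
  by apply/cvgv_col; move: cp; congr cvgv; apply/funext => k; exact: pE.
have [cw cd] : cvgv wk w /\ cvgv dk (- v).
  by apply/cvgv_col; move: cn; congr cvgv; apply/funext => k; exact: nE.
have hs k : subdiff f (xk k) (uk k) by apply/gphP; rewrite -pE.
have hd k : (subderiv2 f (xk k) (uk k) (dk k) <= (- dotv (wk k) (dk k))%:E)%E.
  have := @reg_normal_subderiv2 _ _ _ hf (xk k) (uk k) (wk k) (- dk k).
  by rewrite !opprK dotvNr -pE -nE; apply.
have [V [z [BV vz le]]] := limit_jacobian hs cx cu cd (cvgrN (cvgv_dotv cw cd)) hd.
(* Regular normals bound second subderivatives in directions tending to - v; the sign is moved to
   z. *)
exists V, (- z); split=> //; first by rewrite mulmxN -vz opprK.
by move: le; rewrite !dotvE; move: (dotv _ _) (dotv _ _) (dotv _ _) => A B C; clear; lra.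
Qed.

Lemma B_subdiff_approx x u V z e : subdiff f x u -> B_subdiff P (x + u) V -> 0 < e ->
  exists x' u' v', [/\ subdiff f x' u', nrmv (x' - x) < e, nrmv (u' - u) < e,
    nrmv (v' - V *m z) < e &
    (subderiv2 f x' u' v' <= (dotv (z - V *m z) (V *m z) + e)%:E)%E].
Proof.
move=> hu [yk [Vk [hV [cy cV]]]] e0.
have cw := cvgm_mulmx cV (@cvgv_cst R m z).
have cd := cvgv_dotv (cvgvB (@cvgv_cst R m z) cw) cw.
have e2 : 0 < e / 2 by rewrite divr_gt0.
have [N1 h1] := cy _ e2; have [N2 h2] := cw _ e0; have [N3 h3] := cd _ e0.
pose k := maxn N1 (maxn N2 N3).
have {}h1 := h1 k (leq_maxl _ _).
have {}h2 := h2 k (leq_trans (leq_maxl _ _) (leq_maxr _ _)).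
have {}h3 := h3 k (leq_trans (leq_maxr _ _) (leq_maxr _ _)).
have Px := subdiff_Prox hf hu.
have hx : nrmv (P (yk k) - x) < e / 2.
  by apply: le_lt_trans h1; rewrite -{1}Px; exact: Prox_lip.
exists (P (yk k)), (yk k - P (yk k)), (Vk k *m z); split=> //.
- exact: Prox_subdiff.
- by apply: lt_trans hx _; rewrite ltr_pdivrMr// ltr_pMr// ltr1n.
- have -> : yk k - P (yk k) - u = (yk k - (x + u)) - (P (yk k) - x).
    by move: (P _) => q; vec_ring.
  by apply: le_lt_trans (nrmvB _ _) _; rewrite [X in _ < X]splitr ltrD.
apply: le_trans (subderiv2_prox_jacobian hf z (hV k)) _; rewrite lee_fin.
by move: h3; rewrite ltr_norml => /andP[_]; rewrite ltrBlDl => /ltW.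
Qed.

(** Real bounds [ck] avoid limits of extended reals. The attained values are upward closed, and by
    [coderiv_min] their least element is the minimum over the coderivative. *)
Definition attained x u v (r : R) : Prop :=
  exists (xk uk vk : nat -> vec) (ck : nat -> R),
    [/\ forall k, subdiff f (xk k) (uk k), cvgv xk x /\ cvgv uk u, cvgv vk v, cvgr ck r &
      forall k, (subderiv2 f (xk k) (uk k) (vk k) <= (ck k)%:E)%E].

Lemma attained_jacobian x u v r : attained x u v r ->
  exists V z, [/\ B_subdiff P (x + u) V, v = V *m z & dotv (z - v) v <= r].
Proof. by move=> [xk [uk [vk [ck [hs [hx hu] hv hc hd]]]]]; exact: limit_jacobian hd. Qed.

(** A diagonal choice: the k-th point realises the k-th matrix up to 1/(k + 1). Since the matrix may
    vary with k, the lemma also applies to minimising sequences. *)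
Lemma B_subdiff_attained x u (Vk : nat -> 'M[R]_m) (zk : nat -> vec) v r : subdiff f x u ->
  (forall k, B_subdiff P (x + u) (Vk k)) -> (forall k, v = Vk k *m zk k) ->
  (forall k, dotv (zk k - v) v <= r + k.+1%:R^-1) -> attained x u v r.
Proof.
move=> hu hB hv hr.
have inv0 k : (0 : R) < k.+1%:R^-1 by rewrite invr_gt0.
have /choice [F hF] : forall k, exists xuv : vec * vec * vec,
    [/\ subdiff f xuv.1.1 xuv.1.2, nrmv (xuv.1.1 - x) < k.+1%:R^-1, nrmv (xuv.1.2 - u) < k.+1%:R^-1,
    nrmv (xuv.2 - v) < k.+1%:R^-1 &
    (subderiv2 f xuv.1.1 xuv.1.2 xuv.2 <= (r + k.+1%:R^-1 + k.+1%:R^-1)%:E)%E].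
  move=> k; have [x' [u' [v' [a b c]]]] := B_subdiff_approx (zk k) hu (hB k) (inv0 k).
  rewrite -hv => d le; exists (x', u', v'); split=> //=; apply: le_trans le _.
  by rewrite lee_fin lerD2r.
exists (fun k => (F k).1.1), (fun k => (F k).1.2), (fun k => (F k).2),
  (fun k => r + k.+1%:R^-1 + k.+1%:R^-1).
split; [by move=> k; have [] := hF k|split|..].
- by apply: cvgv_squeeze (@cvgr_inv R) _ => k; have [_ /ltW] := hF k.
- by apply: cvgv_squeeze (@cvgr_inv R) _ => k; have [_ _ /ltW] := hF k.
- by apply: cvgv_squeeze (@cvgr_inv R) _ => k; have [_ _ _ /ltW] := hF k.
- have := cvgrD (cvgrD (@cvgr_cst R r) (@cvgr_inv R)) (@cvgr_inv R).
  by rewrite !addr0.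
- by move=> k; have [] := hF k.
Qed.

(** Every coderivative element dominates one of the form z - V z by [coderiv_jacobian], so the
    minimum is the infimum over the B-subdifferential. A minimising sequence makes this infimum
    [attained], and the compactness in [limit_jacobian] returns a matrix that realises it. *)
Lemma coderiv_min x u v : subdiff f x u -> coderiv_dom (subdiff f) x u v ->
  exists mn : R, [/\ ex_min [set (dotv w v)%:E | w in coderiv (subdiff f) x u v] mn%:E,
    attained x u v mn & forall r, attained x u v r -> mn <= r].
Proof.
move=> hu [w0 hw0].
pose A : set R := [set r | exists V z, [/\ B_subdiff P (x + u) V, v = V *m z & r = dotv (z - v) v]].
have A0 : A !=set0.
  by have [V [z [h1 h2 _]]] := coderiv_jacobian hw0; exists (dotv (z - v) v), V, z.
have Alb : lbound A 0.
  move=> r [V [z [BV vz ->]]].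
  have h : coderiv (subdiff f) x u v (z - v) by rewrite vz; exact: coderiv_B_subdiff.
  have at_ : attained x u v (dotv (z - v) v).
    apply: (@B_subdiff_attained x u (fun=> V) (fun=> z)) => // k.
    by rewrite lerDl invr_ge0.
  have [xk [uk [vk [ck [hs _ _ hc hd]]]]] := at_.
  apply: cvgr_le (@cvgr_cst R 0) hc _ => k.
  by have := le_trans (subderiv2_ge0 (vk k) (hs k)) (hd k); rewrite lee_fin.
have hA : has_inf A by split=> //; exists 0.
have at_ : attained x u v (inf A).
  have /choice [Vz hVz] : forall k, exists Vz : 'M[R]_m * vec,
      [/\ B_subdiff P (x + u) Vz.1, v = Vz.1 *m Vz.2 & dotv (Vz.2 - v) v <= inf A + k.+1%:R^-1].
    move=> k; have [|_ [V [z [h1 h2 ->]]] /ltW lt] := inf_adherent (_ : 0 < k.+1%:R^-1) hA.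
      by rewrite invr_gt0.
    by exists (V, z).
  by apply: (@B_subdiff_attained x u (fun k => (Vz k).1) (fun k => (Vz k).2)) => // k; have [] := hVz k.
have infA V z : B_subdiff P (x + u) V -> v = V *m z -> inf A <= dotv (z - v) v.
  by move=> BV vz; apply: ge_inf; [exists 0|exists V, z].
have low r : attained x u v r -> inf A <= r.
  by move=> /attained_jacobian [V [z [h1 h2]]]; apply: le_trans; exact: infA h1 h2.
exists (inf A); split=> //; split.
  have [V [z [BV vz le]]] := attained_jacobian at_.
  exists (z - v); first by rewrite {2}vz [X in coderiv _ _ _ X]vz; exact: coderiv_B_subdiff.
  by congr EFin; apply/le_anti; rewrite le (infA _ _ BV vz).
move=> _ [w hw <-]; rewrite lee_fin.
by have [V [z [h1 h2]]] := coderiv_jacobian hw; apply: le_trans; exact: infA h1 h2.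
Qed.

End Fun.
End LimitJacobian.

(** * Epigraphs *)

Section Epigraph.
Variables (R : realType) (m : nat).
Local Notation vec := 'cV[R]_m.
Implicit Types (x y z u v w h : vec) (p q : 'cV[R]_(m + 1)).

Lemma pt_eta p : p = pt (usubmx p) (dsubmx p 0 0).
Proof.
rewrite -{1}[p]vsubmxK; congr col_mx.
by apply/matrixP => i j; rewrite !ord1 [RHS]mxE.
Qed.

Lemma dotv_pt x y (a b : R) : dotv (pt x a) (pt y b) = dotv x y + a * b.
Proof. by rewrite /pt dotv_col; congr (_ + _); rewrite /dotv big_ord1 !mxE. Qed.

Lemma ptB x y (a b : R) : pt x a - pt y b = pt (x - y) (a - b).
Proof. by rewrite /pt col_mxB; congr col_mx; apply/matrixP => i j; rewrite !mxE. Qed.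

Lemma ptDZ x y (a b t : R) : pt x a + t *: pt y b = pt (x + t *: y) (a + t * b).
Proof.
by rewrite /pt scale_col_mx add_col_mx; congr col_mx; apply/matrixP => i j; rewrite !mxE.
Qed.

Lemma nrmv_pt_ge x (a : R) : nrmv x <= nrmv (pt x a) /\ `|a| <= nrmv (pt x a).
Proof.
have [h1 h2] := nrmv_col_ge x (const_mx a : 'cV[R]_1); split=> //.
by apply: le_trans h2; have := le_coord_nrmv (const_mx a : 'cV[R]_1) 0; rewrite mxE.
Qed.

Lemma nrmv_pt_le x (a : R) : nrmv (pt x a) <= nrmv x + `|a|.
Proof.
apply: le_trans (nrmv_col_le _ _) _; rewrite lerD2l.
by apply: le_trans (nrmv_le_coord _) _; rewrite big_ord1 mxE.
Qed.

Lemma cvgv_pt (xk : nat -> vec) (ak : nat -> R) x a :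
  cvgv (fun k => pt (xk k) (ak k)) (pt x a) <-> cvgv xk x /\ cvgr ak a.
Proof.
split=> [h|[hx ha]].
  split=> e /h [N hN]; exists N => k /hN; rewrite ptB; apply: le_lt_trans.
    by have [] := nrmv_pt_ge (xk k - x) (ak k - a).
  by have [] := nrmv_pt_ge (xk k - x) (ak k - a).
move=> e e0; have e2 : 0 < e / 2 by rewrite divr_gt0.
have [N hN] := hx _ e2; have [N' hN'] := ha _ e2; exists (maxn N N') => k.
rewrite geq_max => /andP[/hN h1 /hN' h2]; rewrite ptB; apply: le_lt_trans (nrmv_pt_le _ _) _.
by rewrite [X in _ < X]splitr ltrD.
Qed.

Variable f : vec -> \bar R.
Hypothesis hf : closed_convex f.

Lemma epi_pt x (a : R) : epi f (pt x a) <-> (f x <= a%:E)%E.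
Proof. by rewrite /epi /= /pt col_mxKu col_mxKd mxE. Qed.

Definition epi_indic p : \bar R := if `[< epi f p >] then 0%E else +oo%E.
Local Notation F := epi_indic.

Lemma epi_indicT p : epi f p -> F p = 0%E.
Proof. by move=> h; rewrite /F asboolT. Qed.

Lemma epi_indic_ltP p : (F p < +oo)%E <-> epi f p.
Proof.
split=> [|h]; last by rewrite epi_indicT// ltry.
by rewrite /F; case: asboolP.
Qed.

Lemma epi_indic_ge0 p : (0 <= F p)%E.
Proof. by rewrite /F; case: asboolP => // _; rewrite leey. Qed.

Lemma subdiff_indic p q : subdiff F p q <->
  epi f p /\ forall p', epi f p' -> dotv q (p' - p) <= 0.
Proof.
split=> [[fin h]|[ep h]].
  have ep : epi f p by apply/epi_indic_ltP; rewrite ltey_eq fin.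
  split=> // p' ep'; have := h p'; rewrite !epi_indicT// add0e lee_fin.
  exact.
split; first by rewrite epi_indicT.
move=> p'; rewrite (epi_indicT ep) add0e /F; case: asboolP => [/h|_]; last by rewrite leey.
by rewrite lee_fin.
Qed.

Lemma subdiff_indic_pt x u : subdiff f x u -> subdiff F (pt x (fine (f x))) (pt u (-1)).
Proof.
move=> hu; apply/subdiff_indic; split; first by apply/epi_pt; rewrite -(subdiff_dom hu).
move=> p'; rewrite (pt_eta p'); move: (usubmx p') (dsubmx p' 0 0) => y a /epi_pt ya.
have fy : f y = (fine (f y))%:E.
  by apply: domE; [case: hf|apply: le_lt_trans ya _; rewrite ltry].
move: ya; rewrite fy lee_fin => ya; have := subdiff_le hu fy.
rewrite ptB dotv_pt; move: (dotv _ _) (fine _) (fine _) ya => A B C; clear; lra.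
Qed.

Lemma closed_convex_indic : closed_convex F.
Proof.
have [hl hp hc [x0 [u0 hu0]]] := hf.
split.
- move=> p; rewrite (pt_eta p); move: (usubmx p) (dsubmx p 0 0) => x a c.
  rewrite {1}/F; case: asboolP => [_ c0|nep ca].
    by exists 1 => // p' _; apply: lt_le_trans c0 (epi_indic_ge0 _).
  have hxa : (a%:E < f x)%E by rewrite ltNge; apply/negP => /epi_pt.
  have [b ab bf] : exists2 b : R, a < b & (b%:E < f x)%E.
    case fx: (f x) hxa => [r| |] //.
      rewrite lte_fin => ar; exists ((a + r) / 2); rewrite ?lte_fin; lra.
    by move=> _; exists (a + 1); rewrite ?ltry// ltrDl.
  have [d d0 hd] := hl x b bf; exists (Num.min d (b - a)); first by rewrite lt_min d0 subr_gt0.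
  move=> p'; rewrite (pt_eta p'); move: (usubmx p') (dsubmx p' 0 0) => x' a'.
  rewrite ptB lt_min => /andP[h1 h2]; have [g1 g2] := nrmv_pt_ge (x' - x) (a' - a).
  have lt1 := hd _ (le_lt_trans g1 h1).
  rewrite /F; case: asboolP => [/epi_pt le|_]; last by rewrite ltry.
  have := lt_le_trans lt1 le; rewrite lte_fin => lt2.
  exfalso; have := le_lt_trans g2 h2; rewrite ltr_norml => /andP[_ lt3]; move: lt2 lt3; clear; lra.
- split; first by move=> p; rewrite /F; case: asboolP.
  by exists (pt x0 (fine (f x0))); have [h _] := subdiff_indic_pt hu0; rewrite ltey_eq h.
- move=> p p' t t01; have /andP[t0 t1] := t01.
  have t1' : 0 < 1 - t by rewrite subr_gt0.
  have [ep|nep] := pselect (epi f p); last first.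
    rewrite [F p]/F (asboolF nep) gt0_muley ?lte_fin// addye ?leey// -ltNye.
    by apply: lt_le_trans (ltNyr 0) _; rewrite mule_ge0 ?epi_indic_ge0// lee_fin ltW.
  have [ep'|nep] := pselect (epi f p'); last first.
    by rewrite [F p']/F (asboolF nep) (epi_indicT ep) mule0 add0e gt0_muley ?lte_fin// leey.
  rewrite (epi_indicT ep) (epi_indicT ep'); move: ep ep'; rewrite (pt_eta p) (pt_eta p').
  move: (usubmx p) (dsubmx p 0 0) (usubmx p') (dsubmx p' 0 0) => x a y b /epi_pt xa /epi_pt yb.
  rewrite !mule0 adde0 epi_indicT//.
  have -> : t *: pt x a + (1 - t) *: pt y b = pt (t *: x + (1 - t) *: y) (t * a + (1 - t) * b).
    rewrite -ptDZ; congr (_ + _); rewrite /pt scale_col_mx; congr col_mx.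
    by apply/matrixP => i j; rewrite !mxE.
  apply/epi_pt; apply: le_trans (hc x y t t01) _.
  by rewrite [X in (_ <= X)%E]EFinD !EFinM leeD// lee_wpmul2l// lee_fin ltW.
- by exists (pt x0 (fine (f x0))), (pt u0 (-1)); exact: subdiff_indic_pt.
Qed.

(** On a convex set the regular normal inequality, tested on short segments towards p' and rescaled,
    becomes the global inequality of convex analysis; that one is stable under limits. *)
Lemma N_epiE : N_epi f = subdiff F.
Proof.
apply/funext => p; apply/seteqP; split=> q.
  move=> [pk [qk [hC [hp [hq hn]]]]].
  have [hl _ _ _] := closed_convex_indic.
  have ep : epi f p.
    apply/epi_indic_ltP; apply: (@le_lt_trans _ _ 0%E); last by rewrite ltry.
    by apply: (lsc_seq hl hp (@cvgr_cst R 0)) => k; rewrite epi_indicT.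
  apply/subdiff_indic; split=> // p' ep'.
  have le k : dotv (qk k) (p' - pk k) <= 0.
    apply/ler_addgt0Pr => e e0; rewrite add0r.
    have n1 : 0 < nrmv (p' - pk k) + 1 by rewrite ltr_wpDl// nrmv_ge0.
    have [_ h] := hn k; have [|d d0 hd] := h (e / (nrmv (p' - pk k) + 1)); first by rewrite divr_gt0.
    have [t t0 [td t1]] := exists_small (divr_gt0 d0 n1) ltr01.
    have et : epi f (pk k + t *: (p' - pk k)).
      apply/epi_indic_ltP; have [_ _ hc _] := closed_convex_indic.
      have -> : pk k + t *: (p' - pk k) = t *: p' + (1 - t) *: pk k by vec_ring.
      by apply: le_lt_trans (hc _ _ t _) _; rewrite ?t0// !epi_indicT// !mule0 adde0 ltry.
    have := hd _ et; rewrite [_ + _ - _]addrC addKr nrmvZ gtr0_norm// dotvZr => /(_ _)/wrap[].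
      apply: le_lt_trans (_ : _ <= t * (nrmv (p' - pk k) + 1)) _; last by rewrite -ltr_pdivlMr.
      by rewrite ler_pM2l// lerDl.
    rewrite mulrCA ler_pM2l// => /le_trans; apply.
    rewrite mulrAC ler_pdivrMr// ler_pM2l// lerDl//.
  exact: cvgr_le (cvgv_dotv hq (cvgvB (@cvgv_cst R _ p') hp)) (@cvgr_cst R 0) le.
move=> /subdiff_indic [ep h]; exists (fun=> p), (fun=> q); split=> //.
split; first exact: cvgv_cst.
split; first exact: cvgv_cst.
move=> _; split=> // e e0; exists 1 => // p' ep' _; apply: le_trans (h _ ep') _.
by rewrite mulr_ge0 ?nrmv_ge0// ltW.
Qed.

Lemma subderiv2_indic_pt x u v c : subdiff f x u -> (subderiv2 f x u v <= c%:E)%E ->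
  (subderiv2 F (pt x (fine (f x))) (pt u (-1)) (pt v (dotv u v)) <= c%:E)%E.
Proof.
move=> hu hc; apply/(subderiv2_leP _ _ (subdiff_indic_pt hu)) => e e0.
have K0 : 0 < nrmv u + `|c| + 2 by rewrite ltr_wpDl// addr_ge0// nrmv_ge0.
have [e' [e'0 e'1 e'e]] : exists e', [/\ 0 < e', e' <= 1 & e' * (nrmv u + `|c| + 2) <= e].
  exists (Num.min 1 (e / (nrmv u + `|c| + 2))); split.
  - by rewrite lt_min ltr01 divr_gt0.
  - by rewrite ge_min lexx.
  - by rewrite -ler_pdivlMr// ge_min lexx orbT.
have [t [d [/andP[t0 te] dv le]]] := (subderiv2_leP v c hu).1 hc _ e'0.
have e'u : 0 <= e' * nrmv u by rewrite mulr_ge0 ?nrmv_ge0// ltW.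
have e'c : 0 <= e' * `|c| by rewrite mulr_ge0// ltW.
(* The height that the bound on [f] at x + t d guarantees to be in the epigraph; its excess over <u,
   d> is what contributes c + e' to the quotient of the indicator. *)
pose b := dotv u d + (c + e') * t / 2.
exists t, (pt d b); split.
- rewrite t0 /=; apply: lt_le_trans te _; move: e'e e'u e'c e'0.
  by rewrite !mulrDr; move: (e' * _) (e' * `|c|) => X Y; clear; lra.
- rewrite ptB; apply: le_lt_trans (nrmv_pt_le _ _) _.
  have l1 : `|b - dotv u v| <= nrmv u * e' + (`|c| + 1) * e' / 2.
    have -> : b - dotv u v = dotv u (d - v) + (c + e') * t / 2.
      by rewrite /b dotvDr dotvNr; ring.
    apply: le_trans (ler_normD _ _) _; apply: lerD.
      by apply: le_trans (CauchySchwarz_abs _ _) _; rewrite ler_wpM2l ?nrmv_ge0// ltW.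
    rewrite normrM [`|2^-1|]ger0_norm// ler_wpM2r// normrM (gtr0_norm t0) ler_pM ?(ltW te)//.
      by rewrite ltW.
    by apply: le_trans (ler_normD _ _) _; rewrite lerD2l gtr0_norm.
  apply: lt_le_trans e'e; apply: lt_le_trans (ltr_leD dv l1) _; move: e'0 e'c.
  rewrite mulrDl !mulrDr [nrmv u * _]mulrC [`|c| * _]mulrC.
  by move: (e' * nrmv u) (e' * `|c|) => X Y; clear; lra.
- rewrite ptDZ dotv_pt (epi_indicT (_ : epi f (pt x _))); last first.
    by apply/epi_pt; rewrite -(subdiff_dom hu).
  rewrite epi_indicT; last first.
    apply/epi_pt; apply: le_trans le _; rewrite lee_fin /b.
    by rewrite le_eqVlt; apply/orP; left; apply/eqP; field.
  rewrite /= lee_fin add0r /b.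
  have -> : t * (dotv u d + -1 * (dotv u d + (c + e') * t / 2)) + (c + e) * (t ^+ 2 / 2) =
    (e - e') * (t ^+ 2 / 2) by field.
  rewrite mulr_ge0 ?divr_ge0 ?sqr_ge0// subr_ge0; move: e'e e'u e'c e'0.
  by rewrite !mulrDr; move: (e' * _) (e' * `|c|) => X Y; clear; lra.
Qed.

(** A normal with negative last coordinate forces the base point onto the graph. Finiteness of the
    second subderivative makes the excess b' - <w, d'> of nearby directions (d', b') of order t;
    this gives b = <w, v> in the limit and, since [f] lies below the heights b', the bound c / s. *)
Lemma subderiv2_indic_inv x u v (a b s c : R) (w := s^-1 *: u) : 0 < s ->
  subdiff F (pt x a) (pt u (- s)) -> (subderiv2 F (pt x a) (pt u (- s)) (pt v b) <= c%:E)%E ->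
  [/\ a = fine (f x), subdiff f x w, b = dotv w v & (subderiv2 f x w v <= (c / s)%:E)%E].
Proof.
move=> s0 hF hc; have [/epi_pt xa h] := (subdiff_indic _ _).1 hF.
have hp : proper_fun f by case: hf.
have fx : f x = (fine (f x))%:E by apply: domE => //; apply: le_lt_trans xa _; rewrite ltry.
have wE y : dotv u y = s * dotv w y by rewrite /w dotvZl mulrA mulfV ?mul1r// gt_eqF.
have aE : a = fine (f x).
  apply/le_anti; move: xa; rewrite {1}fx lee_fin => ->; rewrite andbT.
  have : epi f (pt x (fine (f x))) by apply/epi_pt; rewrite -fx.
  by move=> /h; rewrite ptB dotv_pt subrr dotv0r add0r mulNr oppr_le0 pmulr_rge0// subr_ge0.
have hw : subdiff f x w.
  split; first by rewrite fx.
  move=> y; have [fy|fy] := eqVneq (f y) +oo%E; first by rewrite fy leey.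
  have fyE : f y = (fine (f y))%:E by apply: domE => //; rewrite ltey.
  have : epi f (pt y (fine (f y))) by apply/epi_pt; rewrite -fyE.
  move=> /h; rewrite ptB dotv_pt wE fx fyE -EFinD lee_fin aE mulNr -mulrBr pmulr_rle0//.
  by rewrite /= subr_le0 lerBrDl.
have K e : 0 < e -> exists t d b', [/\ 0 < t < e, nrmv (d - v) < e, `|b' - b| < e,
    (f (x + t *: d) <= (fine (f x) + t * b')%:E)%E &
    s * (b' - dotv w d) <= (c + e) * (t / 2)].
  move=> e0; have [t [p' [te]]] := (subderiv2_leP _ _ hF).1 hc _ e0.
  rewrite (pt_eta p'); move: (usubmx p') (dsubmx p' 0 0) => d b'.
  rewrite ptB ptDZ => near le; have [n1 n2] := nrmv_pt_ge (d - v) (b' - b).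
  have ep : epi f (pt (x + t *: d) (a + t * b')).
    by apply/epi_indic_ltP; apply: le_lt_trans le _; rewrite ltry.
  exists t, d, b'; split=> //.
  - exact: le_lt_trans n1 near.
  - exact: le_lt_trans n2 near.
  - by have /epi_pt := ep; rewrite aE.
  have /andP[t0 _] := te.
  move: le; rewrite (epi_indicT ep) (epi_indicT (_ : epi f (pt x a))); last exact/epi_pt.
  rewrite /= lee_fin add0r dotv_pt wE.
  have -> : t * (s * dotv w d + - s * b') + (c + e) * (t ^+ 2 / 2) =
      t * ((c + e) * (t / 2) - s * (b' - dotv w d)) by ring.
  by rewrite pmulr_rge0// subr_ge0.
split=> //.
  apply/eqP; rewrite -subr_eq0 -normr_le0; apply/ler_addgt0Pr => e e0; rewrite add0r.
  pose M := 1 + (`|c| + 1) / s + nrmv w.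
  have M0 : 0 < M.
    by rewrite ltr_pwDl ?nrmv_ge0// addr_gt0// divr_gt0// ltr_wpDl.
  have [e' [e'0 e'1 e'e]] : exists e', [/\ 0 < e', e' <= 1 & e' * M <= e].
    exists (Num.min 1 (e / M)); split.
    - by rewrite lt_min ltr01 divr_gt0.
    - by rewrite ge_min lexx.
    - by rewrite -ler_pdivlMr// ge_min lexx orbT.
  have [t [d [b' [/andP[t0 te] dv bb le1 le2]]]] := K _ e'0.
  have fE : f (x + t *: d) = (fine (f (x + t *: d)))%:E.
    by apply: domE => //; apply: le_lt_trans le1 _; rewrite ltry.
  have lo : 0 <= b' - dotv w d.
    have := subdiff_le hw fE; move: le1; rewrite fE lee_fin => le1 le3.
    have := le_trans le3 le1; have -> : x + t *: d - x = t *: d by rewrite addrC addKr.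
    by rewrite lerD2l dotvZr ler_pM2l// subr_ge0.
  have up : b' - dotv w d <= (`|c| + 1) / s * e'.
    rewrite -(ler_pM2l s0); apply: le_trans le2 _.
    have -> : s * ((`|c| + 1) / s * e') = (`|c| + 1) * e' by field; rewrite gt_eqF.
    apply: (@le_trans _ _ ((`|c| + 1) * (t / 2))).
      by rewrite ler_wpM2r ?divr_ge0 ?(ltW t0)// lerD// ler_norm.
    rewrite ler_wpM2l ?addr_ge0//; move: t0 te e'0; clear; lra.
  have cs := CauchySchwarz_abs w (d - v).
  have {}cs : `|dotv w d - dotv w v| <= nrmv w * e'.
    by rewrite -dotvNr -dotvDr; apply: le_trans cs _; rewrite ler_wpM2l ?nrmv_ge0// ltW.
  apply: le_trans e'e; rewrite /M; move: cs bb lo up.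
  rewrite !(mulrDr e') mulr1 [nrmv w * _]mulrC [_ / s * e']mulrC.
  move: (e' * _) (e' * nrmv w) (dotv w d) (dotv w v) => X Y A B.
  rewrite ltr_norml !ler_norml => /andP[? ?] /andP[? ?] ? ?; apply/andP; split; lra.
apply/(subderiv2_leP _ _ hw) => e e0.
have [e1 [e10 e1e e1s]] : exists e1, [/\ 0 < e1, e1 <= e & e1 <= e * s].
  by exists (Num.min e (e * s)); rewrite lt_min e0 mulr_gt0// !ge_min !lexx orbT.
have [t [d [b' [/andP[t0 te] dv bb le1 le2]]]] := K _ e10.
exists t, d; split; [by rewrite t0 (lt_le_trans te)|exact: lt_le_trans dv _|].
apply: le_trans le1 _; rewrite lee_fin -addrA lerD2l.
have -> : (c / s + e) * (t ^+ 2 / 2) = t * ((c / s + e) * (t / 2)) by ring.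
rewrite -mulrDr ler_pM2l// -lerBlDl -(ler_pM2l s0); apply: le_trans le2 _.
have -> : s * ((c / s + e) * (t / 2)) = (c + e * s) * (t / 2) by field; rewrite gt_eqF.
by rewrite ler_wpM2r ?divr_ge0 ?(ltW t0)// lerD2l.
Qed.

(** [f] need not be continuous on its domain; the values converge because the subgradient
    inequalities at both points, with bounded subgradients, give a Lipschitz estimate. *)
Lemma cvg_subdiff_value (xk uk : nat -> vec) x u : subdiff f x u -> (forall k, subdiff f (xk k) (uk k)) ->
  cvgv xk x -> cvgv uk u -> cvgr (fun k => fine (f (xk k))) (fine (f x)).
Proof.
move=> hu hs hx hk.
have [C hC] := cvgv_bounded hk.
pose B k := (`|C| + nrmv u) * nrmv (xk k - x).
have B0 : cvgr B 0.
  have := cvgrM (@cvgr_cst R (`|C| + nrmv u)) (cvgv_nrmv (cvgvB hx (@cvgv_cst R _ x))).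
  by rewrite subrr nrmv0 mulr0.
apply: cvgr_squeeze B0 _ => k.
have h1 := subdiff_le2 hu (hs k); have h2 := subdiff_le2 (hs k) hu.
have h3 := CauchySchwarz_abs u (xk k - x).
have h4 := CauchySchwarz_abs (uk k) (x - xk k).
have h5 : nrmv (uk k) * nrmv (x - xk k) <= `|C| * nrmv (xk k - x).
  by rewrite nrmvC ler_wpM2r ?nrmv_ge0// (le_trans (hC k))// ler_norm.
move: (le_trans h4 h5) h3 h1 h2; rewrite !ler_norml /B mulrDl.
have n1 : 0 <= `|C| * nrmv (xk k - x) by rewrite mulr_ge0 ?nrmv_ge0.
have n2 : 0 <= nrmv u * nrmv (xk k - x) by rewrite mulr_ge0 ?nrmv_ge0.
move: (`|C| * _) (nrmv u * _) n1 n2 => X Y; move: (dotv _ _) (dotv _ _) (fine _) (fine _) => G H I J.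
clear; move=> X0 Y0 /andP[? ?] /andP[? ?] ? ?; apply/andP; split; lra.
Qed.

Lemma attained_epi x u v r : subdiff f x u -> attained f x u v r ->
  attained F (pt x (fine (f x))) (pt u (-1)) (pt v (dotv u v)) r.
Proof.
move=> hu [xk [uk [vk [ck [hs [hx hk] hv hc hd]]]]].
exists (fun k => pt (xk k) (fine (f (xk k)))), (fun k => pt (uk k) (-1)),
  (fun k => pt (vk k) (dotv (uk k) (vk k))), ck; split=> //.
- by move=> k; exact: subdiff_indic_pt.
- split; apply/cvgv_pt; split=> //; last exact: cvgr_cst.
  exact: cvg_subdiff_value hs hx hk.
- by apply/cvgv_pt; split=> //; exact: cvgv_dotv.
- by move=> k; exact: subderiv2_indic_pt.
Qed.

Lemma attained_epi_inv x u v (a b r : R) : attained F (pt x a) (pt u (-1)) (pt v b) r ->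
  b = dotv u v /\ attained f x u v r.
Proof.
move=> [pk [qk [wk [ck [hs [hp hq] hw hc hd]]]]].
pose xk k := usubmx (pk k); pose ak k := dsubmx (pk k) 0 0.
pose uk k := usubmx (qk k); pose sk k := - dsubmx (qk k) 0 0.
pose vk k := usubmx (wk k); pose bk k := dsubmx (wk k) 0 0.
have pE k : pk k = pt (xk k) (ak k) by exact: pt_eta.
have qE k : qk k = pt (uk k) (- sk k) by rewrite /sk opprK; exact: pt_eta.
have wE k : wk k = pt (vk k) (bk k) by exact: pt_eta.
have [hx ha] : cvgv xk x /\ cvgr ak a.
  by apply/cvgv_pt; move: hp; congr cvgv; apply/funext.
have [hu hms] : cvgv uk u /\ cvgr (fun k => - sk k) (-1).
  by apply/cvgv_pt; move: hq; congr cvgv; apply/funext.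
have [hv hb] : cvgv vk v /\ cvgr bk b.
  by apply/cvgv_pt; move: hw; congr cvgv; apply/funext.
have hsk : cvgr sk 1.
  by have := cvgrN hms; rewrite opprK; congr cvgr; apply/funext => k; rewrite opprK.
have h2 : (0 : R) < 1 / 2 by rewrite divr_gt0.
(* Only from some index on is the last coordinate of the normals safely negative; the shifted
   sequence can be rescaled to last coordinate -1. *)
have [N hN] := hsk _ h2.
pose s k := (k + N)%N.
have is_ : incr_seq s by move=> k; rewrite /s addSn.
have sge k : 1 / 2 < sk (s k).
  have := hN (s k) (leq_addl _ _); rewrite ltr_norml => /andP[+ _]; clear; lra.
have s0 k : 0 < sk (s k) by apply: lt_trans (sge k).
have hsi : cvgr (fun k => (sk (s k))^-1) 1.
  apply/cvgrP; rewrite -[X in _ --> X]invr1; apply: cvgV; first exact: oner_neq0.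
  by apply/cvgrP; exact: (cvgr_sub is_ hsk).
have H k : [/\ ak (s k) = fine (f (xk (s k))), subdiff f (xk (s k)) ((sk (s k))^-1 *: uk (s k)),
    bk (s k) = dotv ((sk (s k))^-1 *: uk (s k)) (vk (s k)) &
    (subderiv2 f (xk (s k)) ((sk (s k))^-1 *: uk (s k)) (vk (s k)) <= (ck (s k) / sk (s k))%:E)%E].
  by apply: subderiv2_indic_inv (s0 k) _ _; rewrite -pE -qE// -wE.
have hu' : cvgv (fun k => (sk (s k))^-1 *: uk (s k)) u.
  by have := cvgvZ hsi (cvgv_sub is_ hu); rewrite scale1r.
split.
  apply: cvgr_uniq (cvgr_sub is_ hb) _.
  have := cvgv_dotv hu' (cvgv_sub is_ hv); congr cvgr; apply/funext => k /=.
  by have [_ _ ->] := H k.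
exists (xk \o s), (fun k => (sk (s k))^-1 *: uk (s k)), (vk \o s), (fun k => ck (s k) * (sk (s k))^-1).
split; [by move=> k; have [] := H k|split=> //|..].
- exact: cvgv_sub.
- exact: cvgv_sub.
- by have := cvgrM (cvgr_sub is_ hc) hsi; rewrite mulr1.
- by move=> k; have [] := H k.
Qed.

Lemma coderiv_min_epi x u v b mn mn' : subdiff f x u ->
  attained f x u v mn -> (forall r, attained f x u v r -> mn <= r) ->
  attained F (pt x (fine (f x))) (pt u (-1)) (pt v b) mn' ->
  (forall r, attained F (pt x (fine (f x))) (pt u (-1)) (pt v b) r -> mn' <= r) -> mn' = mn.
Proof.
move=> hu h1 h2 h3 h4; have [bE h5] := attained_epi_inv h3.
by apply/le_anti; rewrite h2// andbT; apply: h4; rewrite bE; exact: attained_epi.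
Qed.

End Epigraph.

(** * Limits of second subderivatives *)

Section Limits.
Variable R : realType.
Implicit Types (a : nat -> \bar R).

Lemma limn_esup_le a (c : nat -> R) r : cvgr c r -> (forall k, (a k <= (c k)%:E)%E) ->
  (limn_esup a <= r%:E)%E.
Proof.
move=> hc ha; rewrite limn_esup_lim (cvg_lim _ (@cvg_esups_inf _ a))//.
apply/lee_addgt0Pr => e /hc [N hN]; apply: le_trans (ereal_inf_lbound _) _.
  by exists N.
apply: ge_ereal_sup => _ [k /= Nk <-]; apply: le_trans (ha k) _.
rewrite -EFinD lee_fin; have := hN k Nk; rewrite ltr_norml => /andP[_].
by rewrite ltrBlDl => /ltW.
Qed.

(** The selection [g] is cofinal rather than increasing, which suffices for limits along it. *)
Lemma limn_einf_lt_sub a r : (limn_einf a < r%:E)%E ->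
  exists2 g : nat -> nat, forall N, (N <= g N)%N & forall N, (a (g N) <= r%:E)%E.
Proof.
rewrite limn_einf_lim (cvg_lim _ (@cvg_einfs_sup _ a))// => lt.
have /choice [g hg] : forall N, exists k, (N <= k)%N /\ (a k <= r%:E)%E.
  move=> N; have : (einfs a N < r%:E)%E.
    by apply: le_lt_trans lt; apply: ereal_sup_ubound; exists N.
  by move=> /ereal_inf_lt [_ [k /= Nk <-] /ltW]; exists k.
by exists g => N; have [] := hg N.
Qed.

Lemma limn_einf_ge0 a : (forall k, (0 <= a k)%E) -> (0 <= limn_einf a)%E.
Proof.
move=> ha; rewrite limn_einf_lim (cvg_lim _ (@cvg_einfs_sup _ a))//.
apply: le_trans (ereal_sup_ubound _); last by exists 0%N.
by apply: le_ereal_inf_tmp => _ [k _ <-].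
Qed.

End Limits.

(** * Bounds for the second-order variational function *)

Section SOVFBounds.
Variables (R : realType) (m : nat) (f : 'cV[R]_m -> \bar R).
Hypothesis hf : closed_convex f.
Implicit Types (x u v : 'cV[R]_m).

(** Condition (C) lets a single matrix of the B-subdifferential realise the minimum over the convex
    hull, and for such a matrix zb - v is in the coderivative. *)
Lemma SOVF_ge_coderiv x u v (mn : \bar R) : subdiff f x u -> condC f x u ->
  ex_min [set (dotv w v)%:E | w in coderiv (subdiff f) x u v] mn -> (mn <= SOVF f x u v)%E.
Proof.
move=> hu [W BW [_ hW]] [_ hmn]; apply: le_ereal_inf_tmp => _ [d [V [JV vd]] <-].
have /hW [zb [vz [[_ h] _]]] : rge_union f x u v by exists V; split=> //; exists d.
apply: le_trans (h _ _); last by exists d => //; exists V.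
apply: hmn; exists (zb - v); last by rewrite dotvC.
by rewrite {2}vz [X in coderiv _ _ _ X]vz; exact: coderiv_B_subdiff.
Qed.

Lemma SOVF_le_attained x u v r : attained f x u v r -> (SOVF f x u v <= r%:E)%E.
Proof.
move=> /(attained_jacobian hf) [V [z [BV vz le]]].
apply: (@le_trans _ _ (dotv v (z - v))%:E); last by rewrite lee_fin dotvC.
apply: ereal_inf_lbound; exists z => //; exists V; split=> //.
exists 1%N, (fun=> 1), (fun=> V); split=> //; split; first by rewrite big_ord1.
by split=> //; rewrite big_ord1 scale1r.
Qed.

(** Each real r above the lower limit bounds the second subderivatives along a cofinal selection,
    hence is [attained]. *)
Lemma SOVF_le_liminf x u v (xk uk vk : nat -> 'cV[R]_m) :
  cvgv xk x -> cvgv uk u -> (forall k, subdiff f (xk k) (uk k)) -> cvgv vk v ->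
  (SOVF f x u v <= limn_einf (fun k => subderiv2 f (xk k) (uk k) (vk k)))%E.
Proof.
move=> hx hu hs hv; set a := fun k => _.
have key r : (limn_einf a < r%:E)%E -> (SOVF f x u v <= r%:E)%E.
  move=> /limn_einf_lt_sub [g gN ha]; apply: SOVF_le_attained.
  have sub n (b : nat -> 'cV[R]_n) l : cvgv b l -> cvgv (b \o g) l.
    by move=> h e /h [N hN]; exists N => k Nk; apply: hN; exact: leq_trans Nk (gN k).
  exists (xk \o g), (uk \o g), (vk \o g), (fun=> r); split=> //; try exact: sub.
  - by move=> k; exact: hs.
  - by split; exact: sub.
  - exact: cvgr_cst.
(* This excludes the value -oo, which the real bounds in [key] could not reach. *)
have : (0 <= limn_einf a)%E by apply: limn_einf_ge0 => k; exact: subderiv2_ge0.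
case E : (limn_einf a) key => [r| |] key r0 //; last by rewrite leey.
by apply/lee_addgt0Pr => e e0; rewrite -EFinD; apply: key; rewrite lte_fin ltrDl.
Qed.

End SOVFBounds.

Theorem theorem3p5 (R : realType) (m : nat) (f : 'cV[R]_m -> \bar R)
  (x u : 'cV[R]_m) :
  lsc_fun f -> proper_fun f -> convex_fun f ->
  dom f x -> subdiff f x u ->
  (* (i) *)
  (condA f x u ->
   forall v : 'cV[R]_m, coderiv_dom (subdiff f) x u v ->
   exists (xk uk vk : nat -> 'cV[R]_m),
     cvgv xk x /\ cvgv uk u /\ (forall k, subdiff f (xk k) (uk k)) /\ cvgv vk v /\
     (exists mn : \bar R,
        ex_min [set (dotv w v)%:E | w in coderiv (subdiff f) x u v] mn /\
        (limn_esup (fun k => subderiv2 f (xk k) (uk k) (vk k)) <= mn)%E) /\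
     (condC f x u ->
        (limn_esup (fun k => subderiv2 f (xk k) (uk k) (vk k)) <= SOVF f x u v)%E)) /\
  (* (ii) *)
  (condA f x u -> condC f x u ->
   forall v : 'cV[R]_m, (SOVF f x u v < +oo)%E ->
   forall (xk uk vk : nat -> 'cV[R]_m),
     cvgv xk x -> cvgv uk u -> (forall k, subdiff f (xk k) (uk k)) -> cvgv vk v ->
     (SOVF f x u v <= limn_einf (fun k => subderiv2 f (xk k) (uk k) (vk k)))%E) /\
  (* (iii) *)
  (C2_cone_reducible f ->
   (exists2 r : R, 0 < r & forall x' u' : 'cV[R]_m,
       nrmv (x' - x) < r -> subdiff f x' u' -> condA f x' u') ->
   condC f x u ->
   forall (v : 'cV[R]_m) (beta : R),
     coderiv_dom (subdiff f) x u v ->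
     coderiv_dom (N_epi f) (pt x (fine (f x))) (pt u (-1)) (pt v beta) ->
     exists mn : \bar R,
       ex_min [set (dotv w v)%:E | w in coderiv (subdiff f) x u v] mn /\
       ex_min [set (dotv zg (pt v beta))%:E
                 | zg in coderiv (N_epi f) (pt x (fine (f x))) (pt u (-1)) (pt v beta)] mn).
Proof.
move=> hl hp hc _ hu.
have hf : closed_convex f by split=> //; exists x, u.
split; [|split].
- move=> _ v hv; have [mn [hmn [xk [uk [vk [ck [hs [hx hk] hw hck hd]]]]] _]] := coderiv_min hf hu hv.
  have le := limn_esup_le hck hd.
  exists xk, uk, vk; do 4 split=> //; split; first by exists mn%:E.
  by move=> hC; apply: le_trans le (SOVF_ge_coderiv hf hu hC hmn).
- by move=> _ _ v _ xk uk vk; exact: SOVF_le_liminf.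
- move=> _ _ _ v beta hv; rewrite N_epiE// => hvb.
  have [mn [hmn at_ low]] := coderiv_min hf hu hv.
  (* The same result in dimension m + 1, for the indicator of the epigraph. *)
  have [mn' [hmn' at' low']] := coderiv_min (closed_convex_indic hf) (subdiff_indic_pt hf hu) hvb.
  exists mn%:E; split=> //.
  by rewrite -(coderiv_min_epi hf hu at_ low at' low').
Qed.
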